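(* Let $\mathcal{B}(\Omega)$ be a strong $\ell^2$-valued Bergman-type space for which the constant $\kappa$ from property (A.6) satisfies $\kappa>0$. There are constants $c,C>0$, depending only on the space, such that for every $T$ in the Toeplitz algebra $\mathcal{T}_{L^\infty_{\mathrm{fin}}}$ the following hold. (a) $\displaystyle c\,\|T\|_e\le\sup_{\|f\|_{\mathcal{B}(\Omega)}\le1}\ \limsup_{\mathfrak{d}(z,0)\to\infty}\|T^zf\|_{\mathcal{B}(\Omega)}\le C\,\|T\|_e.$ (b) If $\displaystyle\sup_{e}\ \lim_{\mathfrak{d}(z,0)\to\infty}\|T(k_ze)\|_{\mathcal{B}(\Omega)}=0$, where the supremum is over all finite $e\in\ell^2$ with $\|e\|_{\ell^2}=1$, then $T$ is compact.
   Context: Notation: $\{e_k\}_{k\ge1}$ is the standard orthonormal basis of $\ell^2$; a vector $e\in\ell^2$ is finite if only finitely many coordinates are nonzero. A function $f:\Omega\to\ell^2$ is measurable (analytic) if every $\langle f(\cdot),e_k\rangle_{\ell^2}$ is. $L^2(\Omega,\ell^2;d\sigma)$ has inner product $\int_\Omega\langle f,g\rangle_{\ell^2}d\sigma$. A strong $\ell^2$-valued Bergman-type space $\mathcal{B}(\Omega)$ is given by the following data and assumptions. (A.1) $\Omega\subset\mathbb{C}^n$ is a connected open set containing $0$; for each $z\in\Omega$ there is an involution $\varphi_z\in\mathrm{Aut}(\Omega)$ (biholomorphic, $\varphi_z\circ\varphi_z=\mathrm{id}$) with $\varphi_z(0)=z$. (A.2) $\mathfrak{d}$ is a metric on $\Omega$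 with $\mathfrak{d}(u,v)=\mathfrak{d}(\varphi_z(u),\varphi_z(v))$ for all $z,u,v$; $(\Omega,\mathfrak{d})$ is separable and its closed balls are compact. $D(z,r)$ is the $\mathfrak{d}$-ball of center $z$ and radius $r$. (A.3) $\sigma$ is a finite Borel measure on $\Omega$. $\mathcal{B}(\Omega)$ is the space of analytic $f:\Omega\to\ell^2$ in $L^2(\Omega,\ell^2;d\sigma)$, and $\mathcal{B}(\Omega,\mathbb{C})$ the space of scalar analytic functions in $L^2(\Omega,\mathbb{C};d\sigma)$, with the inherited norms and inner products. They are reproducing kernel Hilbert spaces: there are $K_z\in\mathcal{B}(\Omega,\mathbb{C})$ with $f(z)=\int_\Omega\overline{K_z(w)}f(w)\,d\sigma(w)$ for all $z\in\Omega$ and all $f$ in $\mathcal{B}(\Omega,\mathbb{C})$ or in $\mathcal{B}(\Omega)$ (coordinatewise integral). $k_z:=K_z/\|K_z\|_{\mathcal{B}(\Omega,\mathbb{C})}$, and $z\mapsto\|K_z\|_{\mathcal{B}(\Omega,\mathbb{C})}$ is continuous on $(\Omega,\mathfrak{d})$. (A.4) $d\lambda(z):=\|K_z\|^2_{\mathcal{B}(\Omega,\mathbb{C})}d\sigma(z)$ satisfies $\lambda(E)=\lambda(\varphi_z(E))$ for Borel $E$ and all $z$, and is doubling: $\lambda(D(z,2r))\le C\lambda(D(z,r))$ for all $z\in\Omega$, $r>0$, for some $C>1$. (A.5) $|\langle k_z,k_w\rangle_{\mathcal{B}(\Omega,\mathbb{C})}|= 1/\|K_{\varphi_z(w)}\|_{\mathcal{B}(\Omega,\mathbb{C})}$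 for all $z,w$. (A.6) Either there is $0<\kappa<2$ such that $$\int_\Omega\frac{|\langle K_z,K_w\rangle|^{(r+s)/2}}{\|K_z\|^s\|K_w\|^r}\,d\lambda(w)\le C(r,s)<\infty\quad\text{for all }z\in\Omega$$ (norms and inner products in $\mathcal{B}(\Omega,\mathbb{C})$) for all $r>\kappa>s>0$; or this holds for all $r=s>0$, in which case one sets $\kappa=0$. (A.7) $\|K_z\|_{\mathcal{B}(\Omega,\mathbb{C})}\to\infty$ as $\mathfrak{d}(z,0)\to\infty$. For $e\in\ell^2$, $k_ze$ denotes the function $w\mapsto k_z(w)e$. The translation operator $U_z$ on $\mathcal{B}(\Omega)$ is $U_zf(w)=f(\varphi_z(w))k_z(w)$, and $T^z:=U_zTU_z^*$. The essential norm is $\|T\|_e=\inf\{\|T-A\|_{\mathcal{L}(\mathcal{B}(\Omega))}:A\text{ compact on }\mathcal{B}(\Omega)\}$. Toeplitz algebra: $L^\infty_{\mathrm{fin}}$ is the set of $u:\Omega\to\mathcal{L}(\ell^2)$ that are measurable (all $\langle u(\cdot)e_k,e_i\rangle$ measurable), with $\|u(\cdot)\|_{\mathcal{L}(\ell^2)}\in L^\infty(\Omega,\mathbb{C};d\sigma)$, and finite: there is $d\in\mathbb{N}$ such that for all $z$, $\langle u(z)e_i,e_k\rangle=0$ whenever $i>d$ or $k>d$. $T_u=PM_u$ with $(M_uf)(z)=u(z)f(z)$ and $P$ the orthogonal projection of $L^2(\Omega,\ell^2;d\sigma)$ onto $\mathcal{B}(\Omega)$. $\mathcal{T}_{L^\infty_{\mathrm{fin}}}$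 is the closure in the operator norm of $\mathcal{L}(\mathcal{B}(\Omega))$ of the set of finite sums of finite products of operators $T_u$ with $u\in L^\infty_{\mathrm{fin}}$. *)

(* Defs.v *)
From HB Require Import structures.
From mathcomp Require Import all_boot all_order all_algebra.
From mathcomp Require Import complex.
From mathcomp Require Import ring lra.
From mathcomp Require Import all_classical all_reals all_analysis.
From mathcomp Require Import measurable_realfun.

Set Implicit Arguments.
Unset Strict Implicit.
Unset Printing Implicit Defensive.

Import Order.TTheory GRing.Theory Num.Theory.
Import numFieldNormedType.Exports.

Local Open Scope classical_set_scope.
Local Open Scope ring_scope.

HB.instance Definition _ (R : rcfType) := NormedModule.copy R[i] R[i]^o.

(* Norms over R[i] take their values in R[i]; [nrm] is the same number in R
   (see nrmE). *)
Definition nrm (R : realType) (X : normedModType R[i]) (x : X) : R :=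
  complex.Re `|x|.

Lemma nrmE (R : realType) (X : normedModType R[i]) (x : X) :
  `|x| = (nrm x)%:C%C.
Proof.
have := normr_ge0 x; rewrite /nrm; case: (`|x|) => a b.
by rewrite lecE /= => /andP[/eqP -> _].
Qed.

Section nrm_theory.
Variables (R : realType) (X : normedModType R[i]).
Implicit Types x y : X.

Lemma nrm_ge0 x : 0 <= nrm x.
Proof. by have := normr_ge0 x; rewrite nrmE ler0c. Qed.

Lemma nrmD x y : nrm (x + y) <= nrm x + nrm y.
Proof. by have := ler_normD x y; rewrite !nrmE -rmorphD lecR. Qed.

Lemma nrmZ (a : R[i]) x : nrm (a *: x) = nrm a * nrm x.
Proof.
have na : `|a| = (nrm a)%:C%C := nrmE a.
by have := normrZ a x; rewrite na !nrmE -rmorphM => /complexI.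
Qed.

Lemma nrm0 : nrm (0 : X) = 0.
Proof. by rewrite /nrm normr0. Qed.

Lemma nrm_eq0 x : nrm x = 0 -> x = 0.
Proof. by move=> x0; apply/eqP; rewrite -normr_eq0 nrmE x0. Qed.

Lemma sqnrmD x y t : 0 < t ->
  nrm (x + y) ^+ 2 <= (1 + t) * nrm x ^+ 2 + (1 + t^-1) * nrm y ^+ 2.
Proof.
move=> t0; have := nrmD x y; have := nrm_ge0 (x + y).
move: (nrm x) (nrm y) (nrm (x + y)) => a b c c0 cab.
have : c ^+ 2 <= (a + b) ^+ 2 by rewrite ler_sqr// nnegrE (le_trans c0).
move=> /le_trans; apply; rewrite -subr_ge0.
rewrite (_ : _ - _ = t^-1 * (t * a - b) ^+ 2).
  by rewrite mulr_ge0 ?sqr_ge0// invr_ge0 ltW.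
by field; rewrite gt_eqF.
Qed.

End nrm_theory.

Section sqrt_triangle.
Variable R : realType.

Lemma sqrt_triangle (p q r : \bar R) : (0 <= p < +oo -> 0 <= q < +oo -> 0 <= r ->
  (forall t : R, (0 < t)%R -> r <= (1 + t)%:E * p + (1 + t^-1)%:E * q) ->
  (Num.sqrt (fine r))%:E <= (Num.sqrt (fine p))%:E + (Num.sqrt (fine q))%:E)%E.
Proof.
case: p => [p| |]//; case: q => [q| |]//; rewrite ?ltxx ?andbF//.
rewrite !lee_fin => /andP[p0 _] /andP[q0 _] r0 H.
have : (r < +oo)%E by apply: le_lt_trans (H 1 ltr01) _; rewrite -!EFinM -EFinD ltry.
case: r r0 H => [r| |]//; rewrite !lee_fin => r0 H _ /=.
apply/ler_addgt0Pr => e0 e00.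
set a := Num.sqrt p; set b := Num.sqrt q.
have a0 : 0 <= a := sqrtr_ge0 _.
have b0 : 0 <= b := sqrtr_ge0 _.
pose e := e0 / 2; have e_gt0 : 0 < e by rewrite divr_gt0.
have ae : 0 < a + e by rewrite ltr_wpDl.
have be : 0 < b + e by rewrite ltr_wpDl.
have t0 : 0 < (b + e) / (a + e) by rewrite divr_gt0.
have := H _ t0; rewrite -!EFinM -EFinD lee_fin -(sqr_sqrtr p0) -(sqr_sqrtr q0).
rewrite -/a -/b => rab.
have -> : a + b + e0 = (a + e) + (b + e) by rewrite /e; field.
rewrite -[X in _ <= X](ger0_norm (ltW (addr_gt0 ae be))) -sqrtr_sqr.
apply: ler_wsqrtr; apply: (le_trans rab).
have -> : ((a + e) + (b + e)) ^+ 2 = (1 + (b + e) / (a + e)) * (a + e) ^+ 2 +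
    (1 + ((b + e) / (a + e))^-1) * (b + e) ^+ 2.
  by field; rewrite !gt_eqF.
apply: lerD; apply: ler_wpM2l.
- by rewrite addr_ge0// ltW.
- by rewrite ler_sqr ?nnegrE ?(ltW ae)// lerDl ltW.
- by rewrite addr_ge0// invr_ge0 ltW.
- by rewrite ler_sqr ?nnegrE ?(ltW be)// lerDl ltW.
Qed.

End sqrt_triangle.

Section sqsum.
Variable R : realType.
Implicit Types x y : nat -> R[i].

Definition sqsum x : \bar R := (\sum_(0 <= k <oo) (nrm (x k) ^+ 2)%:E)%E.

Lemma sqsum_ge0 x : (0 <= sqsum x)%E.
Proof. by apply: nneseries_ge0 => k _ _; rewrite lee_fin sqr_ge0. Qed.

Lemma sqsumZ a x : sqsum (a *: x) = ((nrm a ^+ 2)%:E * sqsum x)%E.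
Proof.
rewrite /sqsum -nneseriesZl; last by move=> *; rewrite lee_fin sqr_ge0.
by apply: eq_eseriesr => k _; rewrite -EFinM -exprMn -nrmZ.
Qed.

Lemma sqsumD x y t : 0 < t ->
  (sqsum (x + y)%R <= (1 + t)%:E * sqsum x + (1 + t^-1)%:E * sqsum y)%E.
Proof.
move=> t0; have t1 : 0 <= 1 + t by rewrite addr_ge0// ltW.
have t2 : 0 <= 1 + t^-1 by rewrite addr_ge0// invr_ge0 ltW.
rewrite /sqsum -!nneseriesZl; try by move=> *; rewrite lee_fin sqr_ge0.
rewrite -nneseriesD; try by move=> *; rewrite -EFinM lee_fin mulr_ge0 ?sqr_ge0.
apply: lee_nneseries => k *; first by rewrite lee_fin sqr_ge0.
by rewrite -!EFinM -EFinD lee_fin sqnrmD.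
Qed.

Lemma sqsum0 : sqsum 0 = 0%E.
Proof. by apply: eseries0 => k _ _; rewrite nrm0 expr0n. Qed.

Definition ell2_pred : {pred nat -> R[i]} := fun x => (sqsum x < +oo)%E.

Lemma ell2_pred_submod : submod_closed ell2_pred.
Proof.
split; first by rewrite unfold_in sqsum0.
move=> a x y; rewrite !unfold_in => xoo yoo.
apply: le_lt_trans (sqsumD _ _ ltr01) _.
by rewrite invr1 lte_add_pinfty ?lte_mul_pinfty ?sqsumZ ?lte_mul_pinfty ?lee_fin
  ?sqr_ge0 ?mule_ge0 ?sqsum_ge0.
Qed.

HB.instance Definition _ :=
  GRing.isSubmodClosed.Build R[i] (nat -> R[i]) ell2_pred ell2_pred_submod.

End sqsum.

Record ell2 (R : realType) : Type :=
  Ell2 { coord :> nat -> R[i]; _ : coord \in @ell2_pred R }.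

HB.instance Definition _ R := [isSub for @coord R].
HB.instance Definition _ R := [Choice of ell2 R by <:].
HB.instance Definition _ R := [SubChoice_isSubLmodule of ell2 R by <:].

Section ell2_norm.
Variable R : realType.
Implicit Types x y : ell2 R.

Definition ell2_norm x : R[i] := (Num.sqrt (fine (sqsum x)))%:C%C.

Lemma ell2_sum_fin x : (0 <= sqsum x < +oo)%E.
Proof. by rewrite sqsum_ge0/=; case: x => x /= xP; exact: xP. Qed.

Lemma ell2_normD x y : ell2_norm (x + y) <= ell2_norm x + ell2_norm y.
Proof.
rewrite -rmorphD lecR -lee_fin EFinD.
by apply: sqrt_triangle => [|||t t0]; rewrite ?ell2_sum_fin ?sqsum_ge0// sqsumD.
Qed.

Lemma ell2_normZ a x : ell2_norm (a *: x) = `|a| * ell2_norm x.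
Proof.
have na : `|a| = (nrm a)%:C%C := nrmE a.
rewrite na -rmorphM /ell2_norm sqsumZ fineM//; last first.
  by rewrite ge0_fin_numE ?sqsum_ge0//; have /andP[] := ell2_sum_fin x.
by rewrite sqrtrM ?sqr_ge0//= sqrtr_sqr ger0_norm ?nrm_ge0.
Qed.

Lemma ell2_norm0_eq0 x : ell2_norm x = 0 -> x = 0.
Proof.
move=> /complexI/eqP; rewrite sqrtr_eq0 => x0.
have s0 : sqsum x = 0%E.
  have /andP[] := ell2_sum_fin x; move: x0; case: (sqsum x) => [r| |]//=.
  by rewrite lee_fin => r0 r0' _; congr (_%:E); apply/le_anti; rewrite r0.
apply/val_inj/funext => k /=; apply: nrm_eq0.
have : ((nrm (x k) ^+ 2)%:E <= sqsum x)%E.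
  apply: le_trans (nneseries_lim_ge k.+1 _) => [|i _ _]; last first.
    by rewrite lee_fin sqr_ge0.
  rewrite big_mkord (bigD1 ord_max)//= leeDl// sume_ge0// => i _.
  by rewrite lee_fin sqr_ge0.
rewrite s0 lee_fin => xk0; apply/eqP; rewrite -sqrf_eq0.
by apply/eqP/le_anti; rewrite xk0 sqr_ge0.
Qed.

HB.instance Definition _ := Lmodule_isNormed.Build R[i] (ell2 R)
  ell2_normD ell2_normZ ell2_norm0_eq0.

Lemma sqnrm_ell2 x : (nrm x ^+ 2)%:E = sqsum x.
Proof.
have /andP[s0 soo] := ell2_sum_fin x.
rewrite /nrm /= sqr_sqrtr ?fine_ge0// fineK// ge0_fin_numE//.
Qed.

End ell2_norm.

Record metric_on (R : realType) (T : Type) (A : set T) : Type := MetricOn {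
  dist :> T -> T -> R;
  distxx : forall x, A x -> dist x x = 0;
  dist_eq0 : forall x y, A x -> A y -> dist x y = 0 -> x = y;
  dist_sym : forall x y, A x -> A y -> dist x y = dist y x;
  dist_triangle : forall y x z, A x -> A y -> A z ->
    dist x z <= dist x y + dist y z }.

(* An alias of the subtype A that carries the topology of d, and not the one
   induced by a topology of T. *)
Definition mspace (R : realType) (T : choiceType) (A : set T)
  (d : metric_on R A) : Type := set_type A.

HB.instance Definition _ (R : realType) (T : choiceType) (A : set T)
  (d : metric_on R A) := Choice.on (mspace d).

Section mspace.
Variables (R : realType) (T : choiceType) (A : set T) (d : metric_on R A).

Definition pt (x : mspace d) : T := \val x.

Lemma ptP (x : mspace d) : A (pt x).
Proof. exact/set_mem/(valP x). Qed.

Let mdist (x y : mspace d) : R := d (pt x) (pt y).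

Let mdistxx x : mdist x x = 0. Proof. exact/distxx/ptP. Qed.

Let mdist_eq0 x y : mdist x y = 0 -> x = y.
Proof. by move=> xy; apply: val_inj; apply: dist_eq0 xy; exact: ptP. Qed.

Let mdist_sym x y : mdist x y = mdist y x.
Proof. by apply: dist_sym; exact: ptP. Qed.

Let mdist_triangle y x z : mdist x z <= mdist x y + mdist y z.
Proof. by apply: dist_triangle; exact: ptP. Qed.

HB.instance Definition _ := isMetric.Build R (mspace d)
  mdistxx mdist_eq0 mdist_sym mdist_triangle.

End mspace.

Definition borelC (R : realType) (n : nat) : Type :=
  g_sigma_algebraType [set A : set 'rV[R[i]]_n.+1 | open A].
HB.instance Definition _ R n := Measurable.on (borelC R n).

Section bergman_functions.
Variables (R : realType) (n : nat).
Local Notation V := 'rV[R[i]]_n.+1.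
Variables (W : set V) (sigma : {finite_measure set (borelC R n) -> \bar R}).

Definition cmeasurable (f : V -> R[i]) : Prop :=
  measurable_fun (W : set (borelC R n)) (fun z => complex.Re (f z)) /\
  measurable_fun (W : set (borelC R n)) (fun z => complex.Im (f z)).

Definition holomorphic (f : V -> R[i]) : Prop :=
  forall z, W z -> differentiable f z.

Definition cint (f : V -> R[i]) : R[i] :=
  ((\int[sigma]_(z in W) complex.Re (f z)) +i*
   (\int[sigma]_(z in W) complex.Im (f z)))%C.

Definition sqint (X : normedModType R[i]) (f : V -> X) : \bar R :=
  (\int[sigma]_(z in W) (nrm (f z) ^+ 2)%:E)%E.

Definition L2nrm (X : normedModType R[i]) (f : V -> X) : R :=
  Num.sqrt (fine (sqint f)).

(* Functions on W are represented by functions on C^(n+1) that vanish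
   outside W; so two of them are equal as soon as they agree on W. *)
Definition sbergman (f : V -> R[i]) : Prop :=
  [/\ holomorphic f, cmeasurable f, (sqint f < +oo)%E &
      forall z, ~ W z -> f z = 0].

Definition vbergman (f : V -> ell2 R) : Prop :=
  [/\ forall k, holomorphic (fun z => f z k),
      forall k, cmeasurable (fun z => f z k), (sqint f < +oo)%E &
      forall z, ~ W z -> f z = 0].

Definition sdot (f g : V -> R[i]) : R[i] :=
  cint (fun z => f z * conjc (g z)).

Definition L2complete (X : normedModType R[i]) (F : (V -> X) -> Prop) : Prop :=
  forall f : nat -> V -> X, (forall k, F (f k)) ->
  (forall e, 0 < e -> \forall j & k \near \oo, L2nrm (f j - f k) < e) ->
  exists2 g, F g & L2nrm (f k - g) @[k --> \oo] --> 0.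

End bergman_functions.

Definition at_infinity (R : realType) (n : nat) (W : set 'rV[R[i]]_n.+1)
    (d : metric_on R W) : set_system 'rV[R[i]]_n.+1 :=
  filter_from [set: R] (fun r => [set z | W z /\ r < d z 0]).

Section lambda.
Variables (R : realType) (n : nat).
Local Notation V := 'rV[R[i]]_n.+1.
Variables (W : set V) (sigma : {finite_measure set (borelC R n) -> \bar R}).
Variable K : V -> V -> R[i].

Definition knrm (z : V) : R := L2nrm W sigma (K z).

Definition kunit (z : V) : V -> R[i] := fun w => K z w / (knrm z)%:C%C.

Definition lambda (E : set V) : \bar R :=
  (\int[sigma]_(z in E) (knrm z ^+ 2)%:E)%E.

(* The factor knrm w ^+ 2 is the density of lambda with respect to sigma. *)
Definition rudin_forelli (r s : R) (z : V) : \bar R :=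
  (\int[sigma]_(w in W)
     (nrm (sdot W sigma (K z) (K w)) `^ ((r + s) / 2) /
      (knrm z `^ s * knrm w `^ r) * knrm w ^+ 2)%:E)%E.

End lambda.

Record bergman_space (R : realType) (n : nat) : Type := BergmanSpace {
  dom : set 'rV[R[i]]_n.+1;
  dom_open : open dom;
  dom_connected : connected dom;
  dom0 : dom 0;
  invol : 'rV[R[i]]_n.+1 -> 'rV[R[i]]_n.+1 -> 'rV[R[i]]_n.+1;
  invol_dom : forall z w, dom z -> dom w -> dom (invol z w);
  invol_holo : forall z w, dom z -> dom w -> differentiable (invol z) w;
  involK : forall z w, dom z -> dom w -> invol z (invol z w) = w;
  invol0 : forall z, dom z -> invol z 0 = z;

  mdis : metric_on R dom;
  mdis_invol : forall z u v, dom z -> dom u -> dom v ->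
    mdis u v = mdis (invol z u) (invol z v);
  mdis_separable : exists2 A : set (mspace mdis), countable A & dense A;
  mdis_compact : forall (x : mspace mdis) (r : R),
    compact [set y : mspace mdis | mdis (pt x) (pt y) <= r];
  (* The topology of mdis is not assumed to be that of C^(n+1), so that the
     sets on which the doubling condition evaluates lambda are required to be
     Borel sets. *)
  dball := fun z (r : R) => [set w | dom w /\ mdis z w < r];
  dball_measurable : forall z r, dom z ->
    measurable (dball z r : set (borelC R n));

  (* A finite Borel measure on dom, extended to C^(n+1); only its values
     inside dom are used. *)
  sigma : {finite_measure set (borelC R n) -> \bar R};
  ker : 'rV[R[i]]_n.+1 -> 'rV[R[i]]_n.+1 -> R[i];
  sbergman_complete : L2complete dom sigma (sbergman dom sigma);
  vbergman_complete : L2complete dom sigma (vbergman dom sigma);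
  ker_sbergman : forall z, dom z -> sbergman dom sigma (ker z);
  ker_repr : forall f z, sbergman dom sigma f -> dom z ->
    f z = cint dom sigma (fun w => conjc (ker z w) * f w);
  ker_vrepr : forall f z k, vbergman dom sigma f -> dom z ->
    f z k = cint dom sigma (fun w => conjc (ker z w) * f w k);
  knrm_continuous :
    continuous (fun z : mspace mdis => knrm dom sigma ker (pt z));

  lambda_invol : forall z (E : set (borelC R n)), dom z -> measurable E ->
    E `<=` dom ->
    lambda dom sigma ker E = lambda dom sigma ker (invol z @` E);
  lambda_doubling : exists2 C : R, 1 < C & forall z r, dom z -> 0 < r ->
    (lambda dom sigma ker (dball z (2 * r)) <=
     C%:E * lambda dom sigma ker (dball z r))%E;

  kunit_invol : forall z w, dom z -> dom w ->
    nrm (sdot dom sigma (kunit dom sigma ker z) (kunit dom sigma ker w)) =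
    (knrm dom sigma ker (invol z w))^-1;

  kappa : R;
  ker_rudin_forelli :
    (0 < kappa < 2 /\
       forall r s : R, kappa < r -> 0 < s < kappa ->
       exists C : R, forall z, dom z ->
         (rudin_forelli dom sigma ker r s z <= C%:E)%E) \/
    (kappa = 0 /\
       forall r : R, 0 < r ->
       exists C : R, forall z, dom z ->
         (rudin_forelli dom sigma ker r r z <= C%:E)%E);

  knrm_infty : knrm dom sigma ker z @[z --> at_infinity mdis] --> +oo
}.

Section bergman_linear.
Variables (R : realType) (n : nat).
Local Notation V := 'rV[R[i]]_n.+1.
Variables (W : set V) (sigma : {finite_measure set (borelC R n) -> \bar R}).
Hypothesis oW : open W.
Implicit Types f g : V -> ell2 R.

Lemma measurable_dom : measurable (W : set (borelC R n)).
Proof. exact: sub_sigma_algebra. Qed.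

Lemma sqnrmC (c : R[i]) : nrm c ^+ 2 = complex.Re c ^+ 2 + complex.Im c ^+ 2.
Proof.
by rewrite /nrm; case: c => a b /=; rewrite sqr_sqrtr// addr_ge0 ?sqr_ge0.
Qed.

Lemma cmeasurable_cst (a : R[i]) : cmeasurable W (fun=> a).
Proof. by split; exact: measurable_cst. Qed.

Lemma cmeasurableD (f g : V -> R[i]) : cmeasurable W f -> cmeasurable W g ->
  cmeasurable W (fun z => f z + g z).
Proof.
move=> [f1 f2] [g1 g2]; split.
- rewrite (_ : (fun _ => _) = (fun z => complex.Re (f z)) \+
    (fun z => complex.Re (g z))); first exact: measurable_funD.
  by apply/funext => z /=; rewrite raddfD.
- rewrite (_ : (fun _ => _) = (fun z => complex.Im (f z)) \+
    (fun z => complex.Im (g z))); first exact: measurable_funD.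
  by apply/funext => z /=; rewrite raddfD.
Qed.

Lemma cmeasurableM (f g : V -> R[i]) : cmeasurable W f -> cmeasurable W g ->
  cmeasurable W (fun z => f z * g z).
Proof.
move=> [f1 f2] [g1 g2]; split.
- rewrite (_ : (fun _ => _) = (fun z => complex.Re (f z)) \*
    (fun z => complex.Re (g z)) \- (fun z => complex.Im (f z)) \*
    (fun z => complex.Im (g z))).
    by apply: measurable_funB; apply: measurable_funM.
  by apply/funext => z /=; case: (f z) => a b; case: (g z).
- rewrite (_ : (fun _ => _) = (fun z => complex.Re (f z)) \*
    (fun z => complex.Im (g z)) \+ (fun z => complex.Im (f z)) \*
    (fun z => complex.Re (g z))).
    by apply: measurable_funD; apply: measurable_funM.
  by apply/funext => z /=; case: (f z) => a b; case: (g z).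
Qed.

Lemma measurable_sqnrm f : (forall k, cmeasurable W (fun z => f z k)) ->
  measurable_fun (W : set (borelC R n)) (fun z => (nrm (f z) ^+ 2)%:E).
Proof.
move=> mf; rewrite (_ : (fun _ => _) =
  (fun z => \sum_(k <oo | k \in predT) (nrm (f z k) ^+ 2)%:E)%E); last first.
  by apply/funext => z; rewrite sqnrm_ell2.
apply: ge0_emeasurable_sum => [k z _ _|k _]; first by rewrite lee_fin sqr_ge0.
apply/measurable_EFinP.
have [m1 m2] := mf k.
rewrite (_ : (fun _ => _) = (fun z => complex.Re (f z k) ^+ 2) \+
  (fun z => complex.Im (f z k) ^+ 2)).
  by apply: measurable_funD; apply: measurable_funX.
by apply/funext => z /=; rewrite sqnrmC.
Qed.

Lemma sqint_ge0 f : (0 <= sqint W sigma f)%E.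
Proof. by apply: integral_ge0 => z _; rewrite lee_fin sqr_ge0. Qed.

Lemma sqintD f g t : 0 < t -> (forall k, cmeasurable W (fun z => f z k)) ->
  (forall k, cmeasurable W (fun z => g z k)) ->
  (sqint W sigma (f + g)%R <=
   (1 + t)%:E * sqint W sigma f + (1 + t^-1)%:E * sqint W sigma g)%E.
Proof.
move=> t0 mf mg; have mW := measurable_dom.
have t1 : 0 <= 1 + t by rewrite addr_ge0// ltW.
have t2 : 0 <= 1 + t^-1 by rewrite addr_ge0// invr_ge0 ltW.
have f0 z : W z -> (0 <= (nrm (f z) ^+ 2)%:E)%E by rewrite lee_fin sqr_ge0.
have g0 z : W z -> (0 <= (nrm (g z) ^+ 2)%:E)%E by rewrite lee_fin sqr_ge0.
have mf2 := measurable_sqnrm mf; have mg2 := measurable_sqnrm mg.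
rewrite /sqint -(ge0_integralZl sigma mW mf2 f0) ?lee_fin//.
rewrite -(ge0_integralZl sigma mW mg2 g0) ?lee_fin//.
have mtf := measurable_funeM (1 + t)%:E mf2.
have mtg := measurable_funeM (1 + t^-1)%:E mg2.
have tf0 z : W z -> (0 <= (1 + t)%:E * (nrm (f z) ^+ 2)%:E)%E.
  by rewrite mule_ge0 ?lee_fin ?sqr_ge0.
have tg0 z : W z -> (0 <= (1 + t^-1)%:E * (nrm (g z) ^+ 2)%:E)%E.
  by rewrite mule_ge0 ?lee_fin ?sqr_ge0.
rewrite -(ge0_integralD sigma mW tf0 mtf tg0 mtg).
apply: ge0_le_integral => //.
- by move=> *; rewrite lee_fin sqr_ge0.
- by apply: measurable_sqnrm => k; exact: cmeasurableD (mf k) (mg k).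
- by apply: emeasurable_funD.
- by move=> *; rewrite -!EFinM -EFinD lee_fin sqnrmD.
Qed.

Lemma sqintZ (a : R[i]) f : (forall k, cmeasurable W (fun z => f z k)) ->
  sqint W sigma (a *: f) = ((nrm a ^+ 2)%:E * sqint W sigma f)%E.
Proof.
move=> mf; have f0 z : W z -> (0 <= (nrm (f z) ^+ 2)%:E)%E.
  by rewrite lee_fin sqr_ge0.
rewrite /sqint -(ge0_integralZl sigma measurable_dom (measurable_sqnrm mf) f0).
  by apply: eq_integral => z _; rewrite -EFinM -exprMn -nrmZ.
by rewrite lee_fin sqr_ge0.
Qed.

Lemma vbergman_submod :
  vbergman W sigma 0 /\
  forall (a : R[i]) f g, vbergman W sigma f -> vbergman W sigma g ->
    vbergman W sigma (a *: f + g).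
Proof.
split.
  split.
  - by move=> k z _; exact: differentiable_cst.
  - by move=> k; exact: cmeasurable_cst.
  - by rewrite /sqint integral0_eq// => z _; rewrite nrm0 expr0n.
  - by [].
move=> a f g [hf mf if_ f0] [hg mg ig g0].
have maf k : cmeasurable W (fun z => (a *: f) z k).
  exact: (cmeasurableM (cmeasurable_cst a) (mf k)).
split.
- move=> k z Wz; apply: differentiableD; last exact: hg.
  exact: (differentiableZ a (hf k z Wz)).
- by move=> k; exact: (cmeasurableD (maf k) (mg k)).
- apply: le_lt_trans (sqintD ltr01 maf mg) _; rewrite sqintZ//.
  by rewrite invr1 lte_add_pinfty ?lte_mul_pinfty ?mule_ge0 ?lee_fin ?sqr_ge0
    ?sqint_ge0.
- move=> z Wz; rewrite [LHS](_ : _ = a *: f z + g z)// (f0 z Wz) (g0 z Wz).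
  by rewrite scaler0 addr0.
Qed.

End bergman_linear.

Definition bergman_pred (R : realType) (n : nat) (S : bergman_space R n) :
    {pred 'rV[R[i]]_n.+1 -> ell2 R} :=
  fun f => `[< vbergman (dom S) (sigma S) f >].

Lemma bergman_pred_submod (R : realType) (n : nat) (S : bergman_space R n) :
  submod_closed (bergman_pred S).
Proof.
have [v0 vD] := vbergman_submod (sigma S) (@dom_open _ _ S).
split; first exact/asboolP.
by move=> a f g /asboolP fS /asboolP gS; apply/asboolP; exact: vD.
Qed.

HB.instance Definition _ (R : realType) (n : nat) (S : bergman_space R n) :=
  GRing.isSubmodClosed.Build R[i] ('rV[R[i]]_n.+1 -> ell2 R) (bergman_pred S)
    (bergman_pred_submod S).

Record bergman (R : realType) (n : nat) (S : bergman_space R n) : Type :=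
  Bergman { bfun :> 'rV[R[i]]_n.+1 -> ell2 R; _ : bfun \in bergman_pred S }.

HB.instance Definition _ R n S := [isSub for @bfun R n S].
HB.instance Definition _ R n S := [Choice of @bergman R n S by <:].
HB.instance Definition _ R n S :=
  [SubChoice_isSubLmodule of @bergman R n S by <:].

Section bergman_norm.
Variables (R : realType) (n : nat) (S : bergman_space R n).
Local Notation W := (dom S).
Local Notation sigma := (sigma S).
Implicit Types f g : bergman S.

Lemma bergmanP f : vbergman W sigma f.
Proof. by case: f => f /= /asboolP. Qed.

Definition bergman_norm f : R[i] := (L2nrm W sigma f)%:C%C.

Lemma sqint_fin f : (0 <= sqint W sigma f < +oo)%E.
Proof. by rewrite sqint_ge0; have [] := bergmanP f. Qed.

Lemma bergman_normD f g :
  bergman_norm (f + g) <= bergman_norm f + bergman_norm g.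
Proof.
rewrite -rmorphD lecR -lee_fin EFinD.
have [_ mf _ _] := bergmanP f; have [_ mg _ _] := bergmanP g.
apply: sqrt_triangle => [|||t t0]; rewrite ?sqint_fin ?sqint_ge0//.
exact: (sqintD _ (@dom_open _ _ S) t0 mf mg).
Qed.

Lemma bergman_normZ a f : bergman_norm (a *: f) = `|a| * bergman_norm f.
Proof.
have na : `|a| = (nrm a)%:C%C := nrmE a.
have [_ mf _ _] := bergmanP f.
rewrite na -rmorphM /bergman_norm /L2nrm.
rewrite [sqint _ _ _](sqintZ _ (@dom_open _ _ S) a mf) fineM//; last first.
  by rewrite ge0_fin_numE ?sqint_ge0//; have /andP[] := sqint_fin f.
by rewrite sqrtrM ?sqr_ge0//= sqrtr_sqr ger0_norm ?nrm_ge0.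
Qed.

Lemma bergman_norm0_eq0 f : bergman_norm f = 0 -> f = 0.
Proof.
move=> /complexI/eqP; rewrite sqrtr_eq0 => f0.
have [hf mf _ fz] := bergmanP f.
have mW := measurable_dom (@dom_open _ _ S).
have i0 : sqint W sigma f = 0%E.
  have /andP[] := sqint_fin f; move: f0; case: (sqint _ _ _) => [r| |]//=.
  by rewrite lee_fin => r0 r0' _; congr (_%:E); apply/le_anti; rewrite r0.
have ae0 : {ae sigma, forall z, W z -> (f : _ -> _) z = 0}.
  have : (\int[sigma]_(z in W) `|(nrm (f z) ^+ 2)%:E| = 0)%E.
    rewrite -[RHS]i0; apply: eq_integral => z _.
    by rewrite gee0_abs// lee_fin sqr_ge0.
  move/(ae_eq_integral_abs sigma mW (measurable_sqnrm mf)).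
  apply: filterS => z /= /[apply] /eqP.
  by rewrite eqe sqrf_eq0 => /eqP/nrm_eq0.
apply/val_inj/funext => z /=.
have [Wz|/fz//] := pselect (W z); apply/val_inj/funext => k /=.
rewrite (ker_vrepr k (bergmanP f) Wz).
have [_ mK _ _] := ker_sbergman Wz.
have mKf : cmeasurable W (fun w => conjc (ker S z w) * f w k).
  apply: cmeasurableM => //; split; case: mK => m1 m2.
    by rewrite (_ : (fun _ => _) = (fun w => complex.Re (ker S z w)))//;
      apply/funext => w; case: (ker S z w).
  rewrite (_ : (fun _ => _) = \- (fun w => complex.Im (ker S z w))).
    exact: measurable_funN.
  by apply/funext => w /=; case: (ker S z w).
case: mKf => m1 m2; rewrite /cint.
have zero (h : R[i] -> R) : h 0 = 0 ->
    measurable_fun (W : set (borelC R n))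
      (fun w => h (conjc (ker S z w) * f w k)) ->
    \int[sigma]_(w in W) h (conjc (ker S z w) * f w k) = 0.
  move=> h0 mh; have aeh : {ae sigma, forall w, W w ->
      (h (conjc (ker S z w) * f w k))%:E = (cst 0%E w : \bar R)}.
    move: ae0; apply: (@filterS _ _ (ae_filter_ringOfSetsType sigma)).
    by move=> w /= /[apply] ->; rewrite mulr0 h0.
  rewrite /Rintegral (ae_eq_integral (cst 0%E) _ _ _ _ aeh) ?integral0//.
  exact/measurable_EFinP.
by rewrite !zero.
Qed.

HB.instance Definition _ := Lmodule_isNormed.Build R[i] (bergman S)
  bergman_normD bergman_normZ bergman_norm0_eq0.

End bergman_norm.

Section unit_vectors.
Variable R : realType.

Lemma ell2_unit_subproof (i : nat) :
  (fun k => (k == i)%:R : R[i]) \in @ell2_pred R.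
Proof.
rewrite unfold_in /sqsum (nneseries_split 0 i.+1); last first.
  by move=> k _; rewrite lee_fin sqr_ge0.
rewrite [X in (_ + X)%E]eseries0 ?adde0; last first.
  by move=> k ik _; rewrite gtn_eqF// nrm0 expr0n.
by rewrite add0n sumEFin ltry.
Qed.

(* The basis of l^2 is indexed from 0. *)
Definition ell2_unit (i : nat) : ell2 R := Ell2 (ell2_unit_subproof i).

Definition ell2_finite (e : ell2 R) : Prop :=
  exists d : nat, forall k, (d <= k)%N -> e k = 0.

(* Both series converge absolutely. *)
Definition ell2_dot (x y : ell2 R) : R[i] :=
  ((limn (series (fun k => complex.Re (x k * conjc (y k))))) +i*
   (limn (series (fun k => complex.Im (x k * conjc (y k))))))%C.

End unit_vectors.

Section operators.
Variables (R : realType) (X : normedModType R[i]).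
Implicit Types T A : X -> X.

Definition opnorm T : \bar R :=
  ereal_sup [set (nrm (T x))%:E | x in [set x : X | nrm x <= 1]].

Definition bounded_op T : Prop := linear T /\ (opnorm T < +oo)%E.

Definition compact_op A : Prop :=
  linear A /\ precompact (A @` [set x : X | nrm x <= 1]).

Definition ess_norm T : \bar R :=
  ereal_inf [set opnorm (T \- A) | A in compact_op].

End operators.

Section toeplitz.
Variables (R : realType) (n : nat) (S : bergman_space R n).
Local Notation V := 'rV[R[i]]_n.+1.
Local Notation W := (dom S).
Local Notation B := (bergman S).

Definition L2dot (F G : V -> ell2 R) : R[i] :=
  cint W (sigma S) (fun z => ell2_dot (F z) (G z)).

(* Only used for functions F that belong to B: the default value 0 plays no
   role. *)
Definition in_bergman (F : V -> ell2 R) : B := insubd (0 : B) F.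

Definition normalized_ker (z : V) : V -> R[i] := kunit W (sigma S) (ker S) z.

Definition kvec (z : V) (e : ell2 R) : B :=
  in_bergman (fun w => normalized_ker z w *: e).

(* For z in W the function below belongs to B whenever f does: the invariance
   of lambda and the formula for |<k_z, k_w>| make U_z an isometry. *)
Definition translation (z : V) (f : B) : B :=
  in_bergman (fun w => normalized_ker z w *: f (invol S z w)).

(* The adjoint of a bounded operator U: U^* g is the unique h with
   <U f, g> = <f, h> for all f. *)
Definition adjoint (U : B -> B) (g : B) : B :=
  xget 0 [set h : B | forall f : B, L2dot (U f) g = L2dot f h].

Definition translate_op (T : B -> B) (z : V) (f : B) : B :=
  translation z (T (adjoint (translation z) f)).

(* The orthogonal projection of L^2(sigma, l^2) onto B: P F is the unique g
   in B with F - g orthogonal to B. *)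
Definition projection (F : V -> ell2 R) : B :=
  xget 0 [set g : B | forall h : B, L2dot (fun z => F z - g z) h = 0].

Definition Linfty_fin (u : V -> ell2 R -> ell2 R) : Prop :=
  [/\ forall z, W z -> bounded_op (u z),
      forall i k, cmeasurable W (fun z => u z (ell2_unit R i) k),
      exists M : R,
        {ae sigma S, forall z, W z -> (opnorm (u z) <= M%:E)%E} &
      exists d : nat, forall z, W z -> forall i k,
        (d <= i)%N || (d <= k)%N -> u z (ell2_unit R i) k = 0].

Definition toeplitz (u : V -> ell2 R -> ell2 R) (f : B) : B :=
  projection (fun z => u z (f z)).

Inductive toeplitz_product : (B -> B) -> Prop :=
| toeplitz_product1 u : Linfty_fin u -> toeplitz_product (toeplitz u)
| toeplitz_productM u T : Linfty_fin u -> toeplitz_product T ->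
    toeplitz_product (toeplitz u \o T).

Inductive toeplitz_sum : (B -> B) -> Prop :=
| toeplitz_sum1 T : toeplitz_product T -> toeplitz_sum T
| toeplitz_sumD T T' : toeplitz_product T -> toeplitz_sum T' ->
    toeplitz_sum (T \+ T').

Definition toeplitz_algebra (T : B -> B) : Prop :=
  bounded_op T /\
  forall e : R, 0 < e ->
    exists2 T', toeplitz_sum T' & (opnorm (T \- T')%R < e%:E)%E.

(* The limit superior as d(z, 0) tends to infinity of a nonnegative function,
   in [0, +oo]; the maximum with 0 gives the value 0 if d is bounded and
   the filter at infinity is trivial. *)
Definition limsup_infinity (g : V -> R) : \bar R :=
  maxe 0%E (limf_esup (EFin \o g) (at_infinity (mdis S))).

End toeplitz.

(* Main.v *)
Require Import Defs.
From HB Require Import structures.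
From mathcomp Require Import all_boot all_order all_algebra.
From mathcomp Require Import complex.
From mathcomp Require Import ring lra.
From mathcomp Require Import all_classical all_reals all_analysis.
From mathcomp Require Import measurable_realfun.

Set Implicit Arguments.
Unset Strict Implicit.
Unset Printing Implicit Defensive.

Import Order.TTheory GRing.Theory Num.Theory.
Import numFieldNormedType.Exports.

Local Open Scope classical_set_scope.
Local Open Scope ring_scope.

(* Cut the domain with Lipschitz functions x_j supported in balls D(a_j, 3r),
   of bounded overlap by the doubling property, such that sum_j x_j^2 >= 1.  By
   (A.6) and a Schur test with weights ||K_w||^t, the commutators of the x_j
   with the projection P satisfy sum_j ||[x_j, P] F||^2 <= c ||F||^2 where c
   tends to 0 as r tends to infinity; hence so do, up to a constant, those with
   a polynomial T in Toeplitz operators.  Up to a small error, ||T f||^2 is thus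
   at most sum_j ||T P (x_j f)||^2.  The translation U_(a_j) moves the support of
   x_j f to a fixed ball around 0, and the projections of the functions of the
   unit ball supported there, with finitely many coordinates, form a totally
   bounded set: for a_j far away T is bounded on them by the supremum in (a),
   and the part of f close to 0 only contributes a compact operator.
   Conversely U_z^* f tends weakly to 0, whence the upper bound.
   For (b), U_z^* maps K_w e_k to a multiple of K_(phi_z(w)) e_k and these
   functions span a dense subspace, so that the supremum in (a) is 0.
   If some K_z vanishes, the space is trivial. *)

(** * The space l^2 *)

(** The metric [mdis] need not induce the topology of C^(n+1), so the measurability of functions
    continuous for [mdis] rests on separability and on balls being Borel sets. Nothing is assumed on
    how phi_z depends on z either: what replaces it is (A.5), which makes ||K_(phi_z(w))|| symmetric
    in z and w. Only sum_j |x_j(z) - x_j(w)|^2 enters the Schur test. It is small for close points,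
    by the Lipschitz constant 1/r, but merely bounded for distant ones; there (A.6) with shifted
    exponents provides an additional factor ||K_(phi_z(w))||^delta, which is large by (A.7). The
    limsup in (a) is taken for one f at a time; a finite net makes it uniform over all the pieces
    x_j f. Such a net exists in finitely many coordinates only, as the unit ball of l^2 is not
    totally bounded: this is where finite symbols enter. The constants must not depend on T. The
    commutator bound does, but r is chosen after T, whereas the overlap of the balls is bounded by
    the same N for all r. *)

Section scalars.
Variable R : realType.
Implicit Types c d : R[i].

Lemma nrmM c d : nrm (c * d) = nrm c * nrm d.
Proof. exact: (nrmZ c (d : R[i]^o)). Qed.

Lemma nrmc_conj c : nrm (conjc c) = nrm c.
Proof.
apply/eqP; rewrite -(eqrXn2 (n:=2)) ?nrm_ge0//; apply/eqP.
by rewrite !sqnrmC; case: c => a b /=; rewrite sqrrN.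
Qed.

Lemma nrmcR (a : R) : nrm (a%:C%C : R[i]) = `|a|.
Proof.
by apply/eqP; rewrite -(eqrXn2 (n:=2)) ?nrm_ge0// sqnrmC/= expr0n addr0 real_normK ?num_real.
Qed.

Lemma nrmci : nrm ('i%C : R[i]) = 1.
Proof.
by apply/eqP; rewrite -(eqrXn2 (n:=2)) ?nrm_ge0// sqnrmC/= expr0n add0r.
Qed.

Lemma nrmcV c : nrm c^-1 = (nrm c)^-1.
Proof.
have [->|c0] := eqVneq c 0; first by rewrite invr0 nrm0 invr0.
have n0 : nrm c != 0 by apply: contra_neq c0; exact: nrm_eq0.
by apply: (mulfI n0); rewrite -nrmM divff// divff// (nrmcR 1) normr1.
Qed.

Lemma Re_le_nrm c : `|complex.Re c| <= nrm c.
Proof.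
rewrite -(ler_pXn2r (n:=2)) ?nnegrE ?nrm_ge0//.
by rewrite sqnrmC real_normK ?num_real// lerDl sqr_ge0.
Qed.

Lemma Im_le_nrm c : `|complex.Im c| <= nrm c.
Proof.
rewrite -(ler_pXn2r (n:=2)) ?nnegrE ?nrm_ge0//.
by rewrite sqnrmC real_normK ?num_real// lerDr sqr_ge0.
Qed.

Lemma nrm_le_ReIm c : nrm c <= `|complex.Re c| + `|complex.Im c|.
Proof.
rewrite -(ler_pXn2r (n:=2)) ?nnegrE ?nrm_ge0 ?addr_ge0//.
rewrite sqnrmC sqrrD !real_normK ?num_real//.
by rewrite -addrA lerD2l lerDr mulrn_wge0// mulr_ge0.
Qed.

Lemma Re_realM (a : R) c : complex.Re (a%:C%C * c) = a * complex.Re c.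
Proof. by case: c => x y /=; rewrite mul0r subr0. Qed.

End scalars.

Section nrm_more.
Variables (R : realType) (X : normedModType R[i]).
Implicit Types x y : X.

Lemma nrmN x : nrm (- x) = nrm x.
Proof. by rewrite -scaleN1r nrmZ -(rmorphN1 (real_complex R)) nrmcR normrN1 mul1r. Qed.

Lemma nrmB x y : nrm (x - y) <= nrm x + nrm y.
Proof. by rewrite -[in leRHS](nrmN y) nrmD. Qed.

Lemma nrmBC x y : nrm (x - y) = nrm (y - x).
Proof. by rewrite -nrmN opprB. Qed.

End nrm_more.

Lemma eq_cvgn (R : realType) (u v : nat -> R) (l : R) :
  (forall n, u n = v n) -> v n @[n --> \oo] --> l -> u n @[n --> \oo] --> l.
Proof. by move=> uv; rewrite (_ : u = v)//; apply/funext. Qed.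

Section ell2_inner.
Variable R : realType.
Implicit Types x y : ell2 R.

Lemma coordD x y k : (x + y) k = x k + y k. Proof. by []. Qed.
Lemma coordZ (a : R[i]) x k : (a *: x) k = a * x k. Proof. by []. Qed.
Lemma coordN x k : (- x) k = - x k. Proof. by []. Qed.
Lemma sqnrm_cvg x : series (fun k => nrm (x k) ^+ 2) n @[n --> \oo] --> nrm x ^+ 2.
Proof.
have h : (\sum_(0 <= k < n) (nrm (x k) ^+ 2)%:E)%E @[n --> \oo] --> (nrm x ^+ 2)%:E.
  rewrite sqnrm_ell2; apply: is_cvg_nneseries => k _ _; by rewrite lee_fin sqr_ge0.
move/fine_cvg : h => /= h.
rewrite (_ : series _ = (fun n => fine (\sum_(0 <= k < n) (nrm (x k) ^+ 2)%:E)%E))//.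
by apply/funext => n; rewrite sumEFin.
Qed.

Arguments sqnrm_cvg : clear implicits.

(** The real part of [ell2_dot]. Norms and orthogonality are handled through it; rotating the second
    argument by i recovers the imaginary part ([ell2_dotE]). *)
Definition rdot_ell2 x y : R := limn (series (fun k => complex.Re (x k * conjc (y k)))).

Lemma Re_mul_conj (c d : R[i]) : complex.Re (c * conjc d) =
  4^-1 * (nrm (c + d) ^+ 2 - nrm (c - d) ^+ 2).
Proof. by rewrite !sqnrmC; case: c => a b; case: d => a' b' /=; field. Qed.

(** Polarization term by term, so that convergence follows from that of the series of squared
    norms. *)
Lemma rd_cvgE x y : series (fun k => complex.Re (x k * conjc (y k))) n @[n --> \oo] -->
   4^-1 * (nrm (x + y) ^+ 2 - nrm (x - y) ^+ 2).
Proof.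
apply: (eq_cvgn _ (cvgM (cvg_cst (4^-1 : R))
  (cvgB (sqnrm_cvg (x + y)) (sqnrm_cvg (x - y))))) => n.
transitivity (4^-1 * (\sum_(0 <= k < n) nrm ((x + y) k) ^+ 2 -
  \sum_(0 <= k < n) nrm ((x - y) k) ^+ 2)) => //; rewrite -sumrB mulr_sumr.
by apply: eq_bigr => k _; rewrite Re_mul_conj.
Qed.

Arguments rd_cvgE : clear implicits.

Lemma rdot_ell2E x y : rdot_ell2 x y = 4^-1 * (nrm (x + y) ^+ 2 - nrm (x - y) ^+ 2).
Proof. by apply/cvg_lim => //; exact: rd_cvgE. Qed.

Lemma rd_cvg x y : series (fun k => complex.Re (x k * conjc (y k))) n @[n --> \oo] --> rdot_ell2
  x y.
Proof. by rewrite rdot_ell2E; exact: rd_cvgE. Qed.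

Arguments rd_cvg : clear implicits.

Lemma rdDl x x' y : rdot_ell2 (x + x') y = rdot_ell2 x y + rdot_ell2 x' y.
Proof.
apply/cvg_lim; first exact: Rhausdorff; apply: (eq_cvgn _ (cvgD (rd_cvg x y) (rd_cvg x' y))) => n.
transitivity (\sum_(0 <= k < n) complex.Re (x k * conjc (y k)) +
  \sum_(0 <= k < n) complex.Re (x' k * conjc (y k))) => //; rewrite -big_split;
    apply: eq_bigr => k _.
by rewrite coordD mulrDl raddfD.
Qed.

Lemma rdZl (a : R) x y : rdot_ell2 (a%:C%C *: x) y = a * rdot_ell2 x y.
Proof.
apply/cvg_lim; first exact: Rhausdorff; apply: (eq_cvgn _ (cvgM (cvg_cst a) (rd_cvg x y))) => n.
transitivity (a * \sum_(0 <= k < n) complex.Re (x k * conjc (y k))) => //.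
rewrite mulr_sumr; apply: eq_bigr => k _.
by rewrite coordZ -mulrA Re_realM.
Qed.

Lemma rdC x y : rdot_ell2 x y = rdot_ell2 y x.
Proof.
rewrite /rdot_ell2; congr (limn _); apply/funext => n; apply: eq_bigr => k _.
by case: (x k) (y k) => a b [c d] /=; ring.
Qed.

Lemma rdii x y : rdot_ell2 ('i%C *: x) ('i%C *: y) = rdot_ell2 x y.
Proof.
rewrite /rdot_ell2; congr (limn _); apply/funext => n; apply: eq_bigr => k _.
by rewrite !coordZ; case: (x k) (y k) => a b [c d] /=; ring.
Qed.

Lemma rdxx x : rdot_ell2 x x = nrm x ^+ 2.
Proof.
apply/cvg_lim; first exact: Rhausdorff; apply: (eq_cvgn _ (sqnrm_cvg x)) => n.
apply: eq_bigr => k _; rewrite sqnrmC; case: (x k) => a b /=; ring.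
Qed.

Lemma ell2_dotE x y : ell2_dot x y = (rdot_ell2 x y +i* rdot_ell2 x ('i%C *: y))%C.
Proof.
rewrite /ell2_dot /rdot_ell2; congr (_ +i* limn _)%C.
apply/funext => n; apply: eq_bigr => k _; rewrite coordZ.
by case: (x k) (y k) => a b [c d] /=; ring.
Qed.

Lemma rd_unit x (c : R[i]) k : rdot_ell2 x (c *: ell2_unit R k) = complex.Re (x k * conjc c).
Proof.
rewrite /rdot_ell2 (_ : (fun _ => _) = fun i => if i == k then
    complex.Re (x k * conjc c) else 0); last first.
  apply/funext => i; have -> : (c *: ell2_unit R k) i = c * (i == k)%:R by [].
  by case: eqP => [->|_]; rewrite ?mulr1// mulr0 conjc0 mulr0.
apply/cvg_lim; first exact: Rhausdorff; apply: cvg_near_cst.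
exists k.+1 => // m km; rewrite /series/= big_mkord (bigD1 (Ordinal km))//= eqxx.
rewrite big1 ?addr0 // => i ik; case: eqP => // E.
by move: ik; rewrite -val_eqE/= E eqxx.
Qed.

Lemma nrm_coord x k : nrm (x k) <= nrm x.
Proof.
rewrite -(ler_pXn2r (n:=2)) ?nnegrE ?nrm_ge0//.
have c := cvgP _ (sqnrm_cvg x); rewrite -(cvg_lim _ (sqnrm_cvg x))//.
apply: le_trans (nondecreasing_cvgn_le _ c k.+1).
  by rewrite /series/= big_nat_recr//= lerDr sumr_ge0// => i _; rewrite sqr_ge0.
by apply/nondecreasing_seqP => m; rewrite /series/= big_nat_recr//= lerDl sqr_ge0.
Qed.

End ell2_inner.

(** * The space L^2 and its inner product *)

Section L2_def.
Variables (R : realType) (n : nat) (Sp : bergman_space R n).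
Local Notation V := 'rV[R[i]]_n.+1.
Local Notation W := (dom Sp).
Local Notation sg := (sigma Sp).
Implicit Types F G : V -> ell2 R.

(** The functions themselves, neither identified almost everywhere nor required to vanish outside
    [W]. Hence [nrmL2] is only a seminorm on [L2], while it is a norm on the Bergman space
    ([nrmL2_eq0]). *)
Definition l2_pred : {pred V -> ell2 R} := fun F =>
  `[< (forall k, cmeasurable W (fun z => F z k)) /\ (sqint W sg F < +oo)%E >].

Lemma l2_pred_submod : submod_closed l2_pred.
Proof.
split.
  apply/asboolP; split; first by move=> k; exact: cmeasurable_cst.
  by rewrite /sqint integral0_eq// => z _; rewrite nrm0 expr0n.
move=> a F G /asboolP[mF iF] /asboolP[mG iG]; apply/asboolP.
have maF k : cmeasurable W (fun z => (a *: F) z k).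
  exact: (cmeasurableM (cmeasurable_cst _ a) (mF k)).
split; first by move=> k; exact: (cmeasurableD (maF k) (mG k)).
apply: le_lt_trans (sqintD _ (@dom_open _ _ Sp) ltr01 maF mG) _.
rewrite (sqintZ _ (@dom_open _ _ Sp))// invr1.
have := sqint_ge0 W sg F; have := sqint_ge0 W sg G; move: iF iG.
move: (sqint _ _ F) (sqint _ _ G) => p q poo qoo q0 p0.
by rewrite lte_add_pinfty ?lte_mul_pinfty ?mule_ge0 ?lee_fin ?sqr_ge0.
Qed.

HB.instance Definition _ :=
  GRing.isSubmodClosed.Build R[i] (V -> ell2 R) l2_pred l2_pred_submod.

End L2_def.

Record L2 (R : realType) (n : nat) (Sp : bergman_space R n) : Type :=
  MkL2 { l2fun :> 'rV[R[i]]_n.+1 -> ell2 R; _ : l2fun \in l2_pred Sp }.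

HB.instance Definition _ R n Sp := [isSub for @l2fun R n Sp].
HB.instance Definition _ R n Sp := [Choice of @L2 R n Sp by <:].
HB.instance Definition _ R n Sp :=
  [SubChoice_isSubLmodule of @L2 R n Sp by <:].

Section L2_theory.
Variables (R : realType) (n : nat) (Sp : bergman_space R n).
Local Notation V := 'rV[R[i]]_n.+1.
Local Notation W := (dom Sp).
Local Notation sg := (sigma Sp).
Local Notation B := (bergman Sp).
Local Notation L2 := (L2 Sp).
Implicit Types F G H : L2.

Lemma mdom : measurable (W : set (borelC R n)).
Proof. exact: measurable_dom (@dom_open _ _ Sp). Qed.

Lemma l2P F : (forall k, cmeasurable W (fun z => F z k)) /\ (sqint W sg F < +oo)%E.
Proof. by case: F => F /= /asboolP. Qed.

Lemma measurable_nrm2 F :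
  measurable_fun (W : set (borelC R n)) (fun z => (nrm (F z) ^+ 2)%R).
Proof.
by apply/measurable_EFinP; apply: measurable_sqnrm => k; have [+ _] := l2P F; exact.
Qed.

Lemma measurable_rd F G :
  measurable_fun (W : set (borelC R n)) (fun z => rdot_ell2 (F z) (G z)).
Proof.
rewrite (_ : (fun _ => _) = (fun z => 4^-1 * (nrm ((F + G) z) ^+ 2 - nrm ((F - G) z) ^+ 2))).
  by apply: measurable_funM => //; apply: measurable_funB; exact: measurable_nrm2.
by apply/funext => z; rewrite rdot_ell2E.
Qed.

Lemma integrable_nrm2 F : sg.-integrable W (fun z => (nrm (F z) ^+ 2)%:E).
Proof.
apply/integrableP; split; first by apply/measurable_EFinP; exact: measurable_nrm2.
have [_] := l2P F; rewrite /sqint.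
under eq_integral do rewrite -(gee0_abs (_ : 0%E <= _%:E)%E) ?lee_fin ?sqr_ge0//.
by [].
Qed.

Lemma rd_le x y : `|rdot_ell2 x y| <= nrm x ^+ 2 + nrm y ^+ 2 :> R.
Proof.
have pos (x' y' : ell2 R) : nrm (x' + y') ^+ 2 <= 2 * nrm x' ^+ 2 + 2 * nrm y' ^+ 2.
  by have := sqnrmD x' y' ltr01; rewrite invr1.
have := pos x y; have := pos x (- y); rewrite nrmN rdot_ell2E ler_norml.
have := sqr_ge0 (nrm (x + y)); have := sqr_ge0 (nrm (x - y)); lra.
Qed.

Lemma integrable_rd F G : sg.-integrable W (fun z => (rdot_ell2 (F z) (G z))%:E).
Proof.
apply: (@le_integrable _ _ _ _ _ mdom _
  (fun z => ((nrm (F z) ^+ 2)%:E + (nrm (G z) ^+ 2)%:E)%E)).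
- by apply/measurable_EFinP; exact: measurable_rd.
- by move=> z _; rewrite -EFinD !abse_EFin lee_fin (le_trans (rd_le _ _))// ler_norm.
- by apply: integrableD; [exact: mdom|exact: integrable_nrm2|exact: integrable_nrm2].
Qed.

Definition rdot F G : R := \int[sg]_(z in W) rdot_ell2 (F z) (G z).

Lemma rdotDl F F' G : rdot (F + F') G = rdot F G + rdot F' G.
Proof.
rewrite /rdot -RintegralD//; first by apply: eq_Rintegral => z _; rewrite rdDl.
- exact: mdom.
- exact: integrable_rd.
- exact: integrable_rd.
Qed.

Lemma rdotZl (a : R) F G : rdot (a%:C%C *: F) G = a * rdot F G.
Proof.
rewrite /rdot -RintegralZl//; first by apply: eq_Rintegral => z _; rewrite rdZl.
- exact: mdom.
- exact: integrable_rd.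
Qed.

Lemma rdotC F G : rdot F G = rdot G F.
Proof. by apply: eq_Rintegral => z _; rewrite rdC. Qed.

Lemma rdotii F G : rdot ('i%C *: F) ('i%C *: G) = rdot F G.
Proof. by apply: eq_Rintegral => z _; rewrite rdii. Qed.

Lemma rdotFF F : rdot F F = fine (sqint W sg F).
Proof. by congr fine; apply: eq_integral => z _; rewrite rdxx. Qed.

Lemma rdot_ge0 F : 0 <= rdot F F.
Proof. by rewrite rdotFF fine_ge0// sqint_ge0. Qed.

Lemma rdotDr F G G' : rdot F (G + G') = rdot F G + rdot F G'.
Proof. by rewrite rdotC rdotDl !(rdotC F). Qed.

Lemma rdotZr (a : R) F G : rdot F (a%:C%C *: G) = a * rdot F G.
Proof. by rewrite rdotC rdotZl rdotC. Qed.

Lemma scaleN1C (X : lmodType R[i]) (x : X) : (-1)%:C%C *: x = - x.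
Proof. by rewrite rmorphN1 scaleN1r. Qed.

Lemma rdotNl F G : rdot (- F) G = - rdot F G.
Proof. by rewrite -scaleN1C rdotZl mulN1r. Qed.

Lemma rdotNr F G : rdot F (- G) = - rdot F G.
Proof. by rewrite rdotC rdotNl rdotC. Qed.

Lemma rdotBl F F' G : rdot (F - F') G = rdot F G - rdot F' G.
Proof. by rewrite rdotDl rdotNl. Qed.

Lemma rdotBr F G G' : rdot F (G - G') = rdot F G - rdot F G'.
Proof. by rewrite rdotDr rdotNr. Qed.

Lemma rdot0l F : rdot 0 F = 0.
Proof. by rewrite -(subrr F) rdotBl subrr. Qed.

Lemma rdot0r F : rdot F 0 = 0.
Proof. by rewrite rdotC rdot0l. Qed.

Lemma rdotiN F G : rdot ('i%C *: F) G = - rdot F ('i%C *: G).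
Proof.
by rewrite -rdotii scalerA -expr2 sqr_i scaleN1r rdotNl.
Qed.

Definition nrmL2 F : R := Num.sqrt (rdot F F).

Lemma nrmL2_ge0 F : 0 <= nrmL2 F. Proof. exact: sqrtr_ge0. Qed.

Lemma nrmL2_sq F : nrmL2 F ^+ 2 = rdot F F.
Proof. by rewrite sqr_sqrtr// rdot_ge0. Qed.

(** The discriminant argument; the case [c = 0] is apart because [rdot] is only positive
    semidefinite. *)
Lemma rdot_le2 F G : rdot F G ^+ 2 <= rdot F F * rdot G G.
Proof.
have h (t : R) : 0 <= rdot F F - 2 * t * rdot F G + t ^+ 2 * rdot G G.
  have := rdot_ge0 (F - t%:C%C *: G).
  rewrite rdotBl !rdotBr !rdotZl !rdotZr (rdotC G F).
  move: (rdot F F) (rdot F G) (rdot G G) => a b c; lra.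
have := rdot_ge0 F; have := rdot_ge0 G; move: h.
move: (rdot F F) (rdot F G) (rdot G G) => a b c h c0 a0.
have [{}c0|cN] := eqVneq c 0; last first.
  have cp : 0 < c by rewrite lt_neqAle eq_sym cN.
  rewrite -subr_ge0 (_ : _ - _ = c * (a - 2 * (b / c) * b + (b / c) ^+ 2 * c)).
    by rewrite mulr_ge0.
  by field.
have [->|b0] := eqVneq b 0; first by rewrite expr0n mulr_ge0// c0.
(* For [c = 0] the form is affine in [t], and this [t] gives it the value - a - 2 < 0. *)
have := h ((a + 1) / b); rewrite c0 mulr0 addr0.
have -> : 2 * ((a + 1) / b) * b = 2 * (a + 1) by field.
lra.
Qed.

Lemma rdot_le F G : `|rdot F G| <= nrmL2 F * nrmL2 G.
Proof.
rewrite -(ler_pXn2r (n:=2)) ?nnegrE ?mulr_ge0 ?nrmL2_ge0//.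
by rewrite real_normK ?num_real// exprMn !nrmL2_sq rdot_le2.
Qed.

Lemma nrmL2D F G : nrmL2 (F + G) <= nrmL2 F + nrmL2 G.
Proof.
rewrite -(ler_pXn2r (n:=2)) ?nnegrE ?addr_ge0 ?nrmL2_ge0//.
rewrite nrmL2_sq rdotDl !rdotDr (rdotC G F) sqrrD !nrmL2_sq.
have := le_trans (ler_norm _) (rdot_le F G).
move: (rdot F F) (rdot F G) (rdot G G) (nrmL2 F * nrmL2 G) => a b c d; lra.
Qed.

Lemma nrmL2Z_real (a : R) F : nrmL2 (a%:C%C *: F) = `|a| * nrmL2 F.
Proof. by rewrite /nrmL2 rdotZl rdotZr mulrA -expr2 sqrtrM ?sqr_ge0// sqrtr_sqr. Qed.

Lemma nrmL2N F : nrmL2 (- F) = nrmL2 F.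
Proof. by rewrite -scaleN1C nrmL2Z_real normrN1 mul1r. Qed.

Lemma nrmL2B F G : nrmL2 (F - G) <= nrmL2 F + nrmL2 G.
Proof. by rewrite -[in leRHS](nrmL2N G) nrmL2D. Qed.

Lemma nrmL2_par F G : nrmL2 (F + G) ^+ 2 + nrmL2 (F - G) ^+ 2 = 2 * nrmL2 F ^+ 2 + 2 * nrmL2 G ^+ 2.
Proof. rewrite (nrmL2_sq (F + G)) (nrmL2_sq (F - G)) (nrmL2_sq F) (nrmL2_sq G) rdotDl rdotDr rdotDr.
rewrite rdotBl rdotBr rdotBr (rdotC G F).
by move: (rdot F F) (rdot F G) (rdot G G) => a b c; ring.
 Qed.

Definition cdot F G : R[i] := (rdot F G +i* rdot F ('i%C *: G))%C.

Lemma cdotDl F F' G : cdot (F + F') G = cdot F G + cdot F' G.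
Proof. by rewrite /cdot !rdotDl. Qed.

Lemma ReImE (c : R[i]) : c = (complex.Re c)%:C%C + (complex.Im c)%:C%C * 'i%C.
Proof. by case: c => a b; congr (_ +i* _)%C; rewrite /=; ring. Qed.

Lemma cdotZl (a : R[i]) F G : cdot (a *: F) G = a * cdot F G.
Proof.
rewrite {1}(ReImE a) scalerDl -scalerA /cdot !rdotDl !rdotZl !rdotiN.
rewrite scalerA -expr2 sqr_i scaleN1r rdotNr.
move: (rdot F G) (rdot F ('i%C *: G)) => u v.
by case: a => x y; congr (_ +i* _)%C; rewrite /=; ring.
Qed.

Lemma cdotC F G : cdot F G = conjc (cdot G F).
Proof. by rewrite /cdot/= rdotC (rdotC F) rdotiN. Qed.

Lemma cdotDr F G G' : cdot F (G + G') = cdot F G + cdot F G'.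
Proof. by rewrite cdotC cdotDl (cdotC F G) (cdotC F G') rmorphD. Qed.

Lemma cdotZr (a : R[i]) F G : cdot F (a *: G) = conjc a * cdot F G.
Proof. by rewrite cdotC cdotZl (cdotC F G) rmorphM. Qed.

Lemma cdotNl F G : cdot (- F) G = - cdot F G.
Proof. by rewrite -scaleN1r cdotZl mulN1r. Qed.

Lemma cdotNr F G : cdot F (- G) = - cdot F G.
Proof. by rewrite cdotC cdotNl (cdotC F G) rmorphN. Qed.

Lemma cdotBl F F' G : cdot (F - F') G = cdot F G - cdot F' G.
Proof. by rewrite cdotDl cdotNl. Qed.

Lemma cdotBr F G G' : cdot F (G - G') = cdot F G - cdot F G'.
Proof. by rewrite cdotDr cdotNr. Qed.

Lemma cdotFF F : cdot F F = (nrmL2 F ^+ 2)%:C%C.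
Proof.
rewrite /cdot nrmL2_sq; congr (_ +i* _)%C; have := rdotiN F F; rewrite rdotC.
by move: (rdot _ _) => u; lra.
Qed.

Lemma nrmL2Z (d : R[i]) F : nrmL2 (d *: F) = nrm d * nrmL2 F.
Proof.
have : (nrmL2 (d *: F) ^+ 2)%:C%C = (nrm d ^+ 2 * nrmL2 F ^+ 2)%:C%C :> R[i].
  rewrite -cdotFF cdotZl cdotZr cdotFF mulrA sqnrmC.
  by move: (nrmL2 F) => u; case: d => x y; congr (_ +i* _)%C; rewrite /=; ring.
move/complexI; rewrite -exprMn => /eqP.
by rewrite eqrXn2 ?mulr_ge0 ?nrmL2_ge0 ?nrm_ge0// => /eqP.
Qed.

(** Multiplying [F] by the conjugate of [c] turns the product into the real number |c|^2, to which
    the real inequality applies. *)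
Lemma cdot_le F G : nrm (cdot F G) <= nrmL2 F * nrmL2 G.
Proof.
set c := cdot F G; have h : rdot (conjc c *: F) G = nrm c ^+ 2.
  transitivity (complex.Re (cdot (conjc c *: F) G)) => //.
  by rewrite cdotZl -/c sqnrmC; case: c => a b /=; ring.
have := rdot_le (conjc c *: F) G; rewrite h nrmL2Z nrmc_conj ger0_norm ?sqr_ge0//.
have [->|c0] := eqVneq (nrm c) 0; first by rewrite mulr_ge0 ?nrmL2_ge0.
by rewrite expr2 -mulrA ler_pM2l// lt_neqAle eq_sym c0 nrm_ge0.
Qed.

Lemma L2dotE F G : L2dot Sp F G = cdot F G.
Proof.
rewrite /L2dot /cint /cdot /rdot; congr (_ +i* _)%C;
  by apply: eq_Rintegral => z _; rewrite ell2_dotE.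
Qed.

Lemma rdot_eqW F F' G G' : (forall z, W z -> F z = F' z) ->
  (forall z, W z -> G z = G' z) -> rdot F G = rdot F' G'.
Proof. by move=> h h'; apply: eq_Rintegral => z /set_mem Wz; rewrite h// h'. Qed.

Lemma L2_ext F G : (forall z, F z = G z) -> F = G.
Proof. by move=> FG; apply/val_inj/funext. Qed.

Lemma B_in_L2 (f : B) : (f : V -> ell2 R) \in l2_pred Sp.
Proof. by apply/asboolP; have [_ mf qf _] := bergmanP f. Qed.

Definition toL2 (f : B) : L2 := MkL2 (B_in_L2 f).

Lemma toL2D f g : toL2 (f + g) = toL2 f + toL2 g. Proof. exact: val_inj. Qed.
Lemma toL2Z (a : R[i]) f : toL2 (a *: f) = a *: toL2 f. Proof. exact: val_inj. Qed.
Lemma toL2B f g : toL2 (f - g) = toL2 f - toL2 g. Proof. exact: val_inj. Qed.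
Lemma toL20 : toL2 0 = 0. Proof. exact: val_inj. Qed.

Lemma nrm_toL2 (f : B) : nrm f = nrmL2 (toL2 f).
Proof. by rewrite /nrmL2 rdotFF. Qed.

Lemma B_ext (f g : B) : (forall z, W z -> forall k, f z k = g z k) -> f = g.
Proof.
move=> fg; apply/val_inj/funext => z /=.
have [Wz|nWz] := pselect (W z); first by apply/val_inj/funext => k; exact: fg.
by have [_ _ _ f0] := bergmanP f; have [_ _ _ g0] := bergmanP g; rewrite f0// g0.
Qed.

Lemma nrmL2_eq0 (f : B) : nrmL2 (toL2 f) = 0 -> f = 0.
Proof. by rewrite -nrm_toL2; exact: nrm_eq0. Qed.

End L2_theory.

(** * Completeness and the orthogonal projection *)

Section riesz.
Variables (R : realType) (n : nat) (Sp : bergman_space R n).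
Local Notation V := 'rV[R[i]]_n.+1.
Local Notation W := (dom Sp).
Local Notation B := (bergman Sp).
Local Notation L2 := (L2 Sp).
Implicit Types (f g h : B) (F G : L2).

Lemma invS_lt (e : R) : 0 < e -> exists N, forall k, (N <= k)%N -> k.+1%:R^-1 < e.
Proof.
move=> e0; have [N _ hN] := near_infty_natSinv_lt (PosNum e0).
by exists N => k Nk; exact: hN.
Qed.

Lemma bergman_complete (u : nat -> B) :
  (forall e : R, 0 < e -> exists N, forall j k, (N <= j)%N -> (N <= k)%N ->
    nrm (u j - u k) < e) ->
  exists g, forall e : R, 0 < e -> exists N, forall k, (N <= k)%N -> nrm (u k - g) < e.
Proof.
move=> uc; have [|e e0|g gB ug] := @vbergman_complete _ _ Sp (fun k => u k : V -> ell2 R).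
- by move=> k; exact: bergmanP.
- have [N hN] := uc e e0; exists ([set j | (N <= j)%N], [set k | (N <= k)%N]).
    by split; exists N.
  by move=> [j k] /= [Nj Nk]; exact: hN.
have gB' : g \in bergman_pred Sp by apply/asboolP.
exists (Bergman gB') => e e0.
move/cvgrPdist_lt : ug => /(_ e e0)[N _ hN].
exists N => k Nk; have := hN k Nk.
by rewrite /= sub0r normrN => /(le_lt_trans (ler_norm _)).
Qed.

Lemma nrm_par f g : nrm (f + g) ^+ 2 + nrm (f - g) ^+ 2 = 2 * nrm f ^+ 2 + 2 * nrm g ^+ 2.
Proof. by have := nrmL2_par (toL2 f) (toL2 g); rewrite -toL2D -toL2B -!nrm_toL2. Qed.

(** Minimizes ||f||^2 - 2 l(f) over the real subspace [M], which need not be closed: a minimizing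
    sequence is Cauchy by the parallelogram law, and the first variation at its limit [g] shows that
    [g] represents [l] on [M]. With [M] the whole space this yields projections and adjoints, with
    [M] the span of the kernels its density. *)
Lemma riesz (M : B -> Prop) (l : B -> R) (C : R) :
  M 0 -> (forall f g, M f -> M g -> M (f + g)) ->
  (forall (a : R) f, M f -> M (a%:C%C *: f)) ->
  (forall f g, l (f + g) = l f + l g) ->
  (forall (a : R) f, l (a%:C%C *: f) = a * l f) ->
  (forall f, `|l f| <= C * nrm f) ->
  exists g, (forall f, M f -> rdot (toL2 f) (toL2 g) = l f) /\
    forall e : R, 0 < e -> exists2 g', M g' & nrm (g - g') < e.
Proof.
move=> M0 MD MZ lD lZ lC; pose J f := nrm f ^+ 2 - 2 * l f.
have JC f : - C ^+ 2 <= J f.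
  have := lC f; rewrite ler_norml => /andP[_]; rewrite /J.
  have := sqr_ge0 (C - nrm f); move: (nrm f) (l f) => a b; nra.
have lJ : has_inf [set J f | f in M].
  split; first by exists (J 0), 0.
  by exists (- C ^+ 2) => _ [f _ <-].
pose m := inf [set J f | f in M].
have mJ f : M f -> m <= J f by move=> Mf; apply: ge_inf; [exact: lJ.2|exists f].
have /choice[u uP] (k : nat) : exists f, M f /\ J f < m + k.+1%:R^-1.
  have [|_ [f Mf <-] fm] := @inf_adherent _ _ k.+1%:R^-1 _ lJ; first by [].
  by exists f.
clearbody m.
(* The midpoint of [u j] and [u k] lies in [M], where [J] is at least [m]. *)
have upar j k : nrm (u j - u k) ^+ 2 <= 2 * (j.+1%:R^-1 + k.+1%:R^-1).
  have [Mj hj] := uP j; have [Mk hk] := uP k.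
  have := mJ _ (MZ 2^-1 _ (MD _ _ Mj Mk)).
  have := nrm_par (u j) (u k).
  rewrite /J lZ lD nrmZ nrmcR ger0_norm ?invr_ge0// exprMn.
  move: hj hk; rewrite /J; move: (j.+1%:R^-1) (k.+1%:R^-1) => a b.
  have -> : (2^-1 : R) ^+ 2 = 4^-1 by field.
  move: (nrm (u j)) (nrm (u k)) (l (u j)) (l (u k)) (nrm (_ - _)) (nrm (_ + _)).
  by move=> *; lra.
have [|g ug] := bergman_complete (u := u).
  move=> e e0; have e4 : 0 < e ^+ 2 / 4 by rewrite divr_gt0 ?exprn_gt0.
  have [N hN] := invS_lt e4.
  exists N => j k Nj Nk; rewrite -(ltr_pXn2r (n:=2)) ?nnegrE ?nrm_ge0 ?ltW//.
  apply: le_lt_trans (upar j k) _; have := hN _ Nj; have := hN _ Nk.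
  by move: (j.+1%:R^-1) (k.+1%:R^-1) => x y; lra.
exists g; split; last first.
  move=> e e0; have [N hN] := ug e e0; exists (u N); first exact: (uP N).1.
  by rewrite nrmBC hN.
move=> f Mf; rewrite rdotC.
pose a := nrm f ^+ 2; pose b := rdot (toL2 g) (toL2 f) - l f.
(* First variation at the limit: [J] is at least [m] at u_k + t f, and J(u_k) exceeds [m] by less
   than 1/(k+1). *)
have ab (t : R) : 0 <= t ^+ 2 * a + 2 * t * b.
  apply/ler_addgt0Pr => e e0.
  (* [d] bounds both the excess of J(u_k) over [m] and the distance from u_k to [g]; together they
     cost d (1 + 2 |t| ||f||) = e / 2. *)
  pose d := e / (2 * (1 + 2 * `|t| * nrm f)).
  have q1 : 1 <= 1 + 2 * `|t| * nrm f by rewrite lerDl mulr_ge0 ?nrm_ge0// mulr_ge0.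
  have q0 := lt_le_trans ltr01 q1.
  have d0 : 0 < d by rewrite divr_gt0// mulr_gt0.
  have dE : d * (1 + 2 * `|t| * nrm f) = e / 2 by rewrite /d; field; rewrite gt_eqF.
  have [N1 h1] := ug d d0; have [N2 h2] := invS_lt d0.
  have {h1} := h1 (maxn N1 N2) (leq_maxl _ _); have {h2} := h2 (maxn N1 N2) (leq_maxr _ _).
  move: (maxn _ _) => k h2 h1; have [Mk hk] := uP k.
  have := mJ _ (MD _ _ Mk (MZ t _ Mf)).
  have JE : J (u k + t%:C%C *: f) = J (u k) + 2 * t * rdot (toL2 (u k)) (toL2 f) +
      t ^+ 2 * a - 2 * t * l f.
    rewrite /J lD lZ /a !nrm_toL2 !nrmL2_sq toL2D toL2Z rdotDl !rdotDr !rdotZl !rdotZr.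
    rewrite (rdotC (toL2 f)); move: (rdot (toL2 (u k)) (toL2 (u k))) => x.
    by move: (rdot _ _) (rdot _ _) (l f) (l (u k)) => y z v w; ring.
  rewrite JE => h4.
  have := rdot_le (toL2 (u k - g)) (toL2 f); rewrite -2!nrm_toL2 toL2B rdotBl => h3.
  have h6 : `|t * (rdot (toL2 (u k)) (toL2 f) - rdot (toL2 g) (toL2 f))| <= `|t| * (d * nrm f).
    by rewrite normrM ler_wpM2l// (le_trans h3)// ler_wpM2r ?nrm_ge0 ?ltW.
  have h7 : d + 2 * `|t| * (d * nrm f) = e / 2 by rewrite -dE; ring.
  move: h6; rewrite ler_norml mulrBr => /andP[_ h6].
  have {hk} hk := lt_trans hk (_ : m + k.+1%:R^-1 < m + d).
  move: hk; rewrite ltrD2l => /(_ h2) hk.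
  have -> : t ^+ 2 * a + 2 * t * b + e =
     t ^+ 2 * a + 2 * (t * rdot (toL2 g) (toL2 f)) - 2 * t * l f + e by rewrite /b; ring.
  move: hk h4 h6 h7 e0; rewrite -[2 * t * rdot _ _]mulrA.
  move: (t * rdot _ _) (t * rdot _ _) (2 * t * l f) (t ^+ 2 * a) (J _).
  rewrite -[2 * _ * _]mulrA; move: (`|t| * (d * nrm f)); clear; move=> *; lra.
have a0 : 0 <= a by exact: sqr_ge0.
suff : b = 0 by rewrite /b; move/eqP; rewrite subr_eq0 => /eqP.
(* Nearly the minimizer -b/a of the quadratic, with [a + 1] because [a] may be 0. *)
have := ab (- (b / (a + 1))).
have -> : (- (b / (a + 1))) ^+ 2 * a + 2 * - (b / (a + 1)) * b =
   - (b ^+ 2 * ((a + 2) / (a + 1) ^+ 2)) by field; rewrite gt_eqF// ltr_wpDl.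
rewrite oppr_ge0 => h; apply/eqP; rewrite -sqrf_eq0; apply/eqP/le_anti.
rewrite sqr_ge0 andbT -(pmulr_lle0 _ (_ : 0 < (a + 2) / (a + 1) ^+ 2))//.
by rewrite divr_gt0// ?exprn_gt0 ?ltr_wpDl.
Qed.

Lemma riesz_full (l : B -> R) (C : R) :
  (forall f g, l (f + g) = l f + l g) ->
  (forall (a : R) f, l (a%:C%C *: f) = a * l f) ->
  (forall f, `|l f| <= C * nrm f) ->
  exists g, forall f, rdot (toL2 f) (toL2 g) = l f.
Proof.
move=> lD lZ lC; have [g [gP _]] := @riesz (fun=> True) l C I (fun _ _ _ _ => I)
  (fun _ _ _ => I) lD lZ lC.
by exists g => f; exact: gP.
Qed.

Lemma proj_ex F : exists g, forall f, rdot (toL2 f) (toL2 g) = rdot (toL2 f) F.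
Proof.
apply: (@riesz_full _ (nrmL2 F)).
- by move=> f g; rewrite toL2D rdotDl.
- by move=> a f; rewrite toL2Z rdotZl.
- by move=> f; rewrite nrm_toL2 mulrC rdot_le.
Qed.

Definition proj F : B := projT1 (cid (proj_ex F)).

Lemma rdot_proj f F : rdot (toL2 f) (toL2 (proj F)) = rdot (toL2 f) F.
Proof. exact: (projT2 (cid (proj_ex F))). Qed.

Lemma rdot_projl f F : rdot (toL2 (proj F)) (toL2 f) = rdot F (toL2 f).
Proof. by rewrite rdotC rdot_proj rdotC. Qed.

Lemma cdot_proj f F : cdot (toL2 f) (toL2 (proj F)) = cdot (toL2 f) F.
Proof.
rewrite cdotC [RHS]cdotC; congr (conjc _).
by rewrite /cdot -toL2Z !rdot_projl.
Qed.

Lemma cdot_projl f F : cdot (toL2 (proj F)) (toL2 f) = cdot F (toL2 f).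
Proof. by rewrite cdotC cdot_proj -cdotC. Qed.

Lemma rdot_inj f g : (forall h, rdot (toL2 h) (toL2 f) = rdot (toL2 h) (toL2 g)) -> f = g.
Proof.
move=> fg; apply/eqP; rewrite -subr_eq0; apply/eqP/nrmL2_eq0.
by rewrite /nrmL2 {2}toL2B rdotBr fg subrr sqrtr0.
Qed.

Lemma cdot_inj f g : (forall h, cdot (toL2 h) (toL2 f) = cdot (toL2 h) (toL2 g)) -> f = g.
Proof. by move=> fg; apply: rdot_inj => h; have [] := fg h. Qed.

Lemma projD F G : proj (F + G) = proj F + proj G.
Proof. by apply: rdot_inj => h; rewrite toL2D rdotDr !rdot_proj rdotDr. Qed.

Lemma projZ (a : R[i]) F : proj (a *: F) = a *: proj F.
Proof. by apply: cdot_inj => h; rewrite toL2Z cdotZr !cdot_proj cdotZr. Qed.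

Lemma projN F : proj (- F) = - proj F.
Proof. by rewrite -scaleN1r projZ scaleN1r. Qed.

Lemma projB F G : proj (F - G) = proj F - proj G.
Proof. by rewrite projD projN. Qed.

Lemma proj0 : proj 0 = 0.
Proof. by rewrite -(subrr 0) projB subrr. Qed.

Lemma proj_toL2 f : proj (toL2 f) = f.
Proof. by apply: rdot_inj => h; rewrite rdot_proj. Qed.

Lemma nrm_proj F : nrm (proj F) <= nrmL2 F.
Proof.
rewrite nrm_toL2; have := rdot_le (toL2 (proj F)) F; rewrite -rdot_proj -nrmL2_sq.
rewrite ger0_norm ?sqr_ge0// expr2.
have [->|] := eqVneq (nrmL2 (toL2 (proj F))) 0; first by rewrite nrmL2_ge0.
by move=> h; rewrite ler_pM2l// lt_neqAle eq_sym h nrmL2_ge0.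
Qed.

Lemma proj_eqW F G : (forall z, W z -> F z = G z) -> proj F = proj G.
Proof. by move=> FG; apply: rdot_inj => h; rewrite !rdot_proj; exact: rdot_eqW. Qed.

(** The orthogonality to the Bergman space determines the element, so [xget] selects the one given
    by the Riesz representation. *)
Lemma projectionE F : projection Sp (F : V -> ell2 R) = proj F.
Proof.
have key g : (forall h, L2dot Sp (fun z => F z - g z) h = 0) <->
    (forall h, cdot (F - toL2 g) (toL2 h) = 0).
  by split=> H h; have := H h; rewrite -L2dotE.
apply: xget_unique => /=.
  by apply/key => h; rewrite cdotBl -cdot_projl subrr.
move=> g /key H; apply: cdot_inj => h; rewrite cdotC [RHS]cdotC; congr conjc.
by apply/eqP; rewrite cdot_projl eq_sym -subr_eq0 -cdotBl H.
Qed.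

(** Only the real part of the pairing is represented; the imaginary part follows by evaluation at i
    f. *)
Lemma adjoint_ex (A : B -> B) (C : R) h : linear A -> (forall f, nrm (A f) <= C * nrm f) ->
  exists g, forall f, cdot (toL2 (A f)) (toL2 h) = cdot (toL2 f) (toL2 g).
Proof.
move=> lA AC; have AD f g : A (f + g) = A f + A g.
  by rewrite -[f]scale1r lA !scale1r.
have A0 : A 0 = 0.
  by have := lA (-1) 0 0; rewrite scaler0 addr0 scaleN1r addNr.
have AZ a f : A (a *: f) = a *: A f by rewrite -[a *: f]addr0 lA A0 addr0.
have [|||g gP] := @riesz_full (fun f => rdot (toL2 (A f)) (toL2 h)) (C * nrm h).
- by move=> f g; rewrite AD toL2D rdotDl.
- by move=> a f; rewrite AZ toL2Z rdotZl.
- move=> f; apply: le_trans (rdot_le _ _) _; rewrite -!nrm_toL2 mulrAC.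
  by rewrite ler_wpM2r ?nrm_ge0.
exists g => f; rewrite /cdot -gP; congr (_ +i* _)%C.
have := gP ('i%C *: f); rewrite AZ !toL2Z !rdotiN; lra.
Qed.

End riesz.

(** * Reproducing kernels *)

Section kernels.
Variables (R : realType) (n : nat) (Sp : bergman_space R n).
Local Notation V := 'rV[R[i]]_n.+1.
Local Notation W := (dom Sp).
Local Notation sg := (sigma Sp).
Local Notation K := (ker Sp).
Local Notation kn := (knrm W sg K).
Local Notation B := (bergman Sp).
Local Notation L2 := (L2 Sp).
Implicit Types (f g h : B) (F G : L2) (z w : V).

Lemma nrm_unit k : nrm (ell2_unit R k) = 1.
Proof.
apply/eqP; rewrite -(eqrXn2 (n:=2)) ?nrm_ge0// expr1n -rdxx.
have E : ell2_unit R k k = 1 by rewrite /= eqxx.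
by rewrite -[X in rdot_ell2 _ X]scale1r rd_unit E mul1r.
Qed.

Lemma ell2_dot_unit (x : ell2 R) (c : R[i]) k :
  ell2_dot x (c *: ell2_unit R k) = x k * conjc c.
Proof.
rewrite ell2_dotE scalerA !rd_unit.
by case: (x k) c => a b [c d] /=; congr (_ +i* _)%C; ring.
Qed.

Lemma in_bergmanE (F : V -> ell2 R) : vbergman W sg F ->
  (in_bergman Sp F : V -> ell2 R) = F.
Proof. by move=> vF; rewrite /in_bergman val_insubd (_ : F \in _)//; apply/asboolP. Qed.

Lemma vbergman_unit (f : V -> R[i]) k : sbergman W sg f ->
  vbergman W sg (fun w => f w *: ell2_unit R k).
Proof.
move=> [hf mf qf f0]; split.
- move=> j z Wz.
  rewrite (_ : (fun _ => _) = (ell2_unit R k j) \*: f).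
    by apply: differentiableZ; exact: hf.
  by apply/funext => w; rewrite coordZ mulrC.
- by move=> j; exact: (cmeasurableM mf (cmeasurable_cst _ _)).
- move: qf; rewrite /sqint; under [X in _ -> (X < _)%E]eq_integral do
    rewrite nrmZ nrm_unit mulr1.
  by [].
- by move=> z Wz; rewrite f0// scale0r.
Qed.

(** The function K_z e_k. Its inner product with [f] is the coordinate [f z k], and all point
    evaluations go through it. *)
Definition kerv z k : B := in_bergman Sp (fun w => K z w *: ell2_unit R k).

Lemma kervE z k w : W z -> kerv z k w = K z w *: ell2_unit R k.
Proof.
move=> Wz; have h := in_bergmanE (vbergman_unit k (ker_sbergman Wz)).
by rewrite /kerv h.
Qed.

Lemma cdot_kerv f z k : W z -> cdot (toL2 f) (toL2 (kerv z k)) = f z k.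
Proof.
move=> Wz; rewrite -L2dotE (ker_vrepr k (bergmanP f) Wz) /L2dot; congr cint.
by apply/funext => w; rewrite /= kervE// ell2_dot_unit mulrC.
Qed.

Lemma cdot_proj_kerv F z k : W z -> proj F z k = cdot F (toL2 (kerv z k)).
Proof. by move=> Wz; rewrite -cdot_kerv// cdot_projl. Qed.

Lemma nrmL2_kerv z k : W z -> nrmL2 (toL2 (kerv z k)) = kn z.
Proof.
move=> Wz; rewrite /nrmL2 rdotFF /knrm /L2nrm; congr (Num.sqrt (fine _)).
by apply: eq_integral => w _; rewrite /= kervE// nrmZ nrm_unit mulr1.
Qed.

Lemma kn_ge0 z : 0 <= kn z. Proof. exact: sqrtr_ge0. Qed.

Lemma kerv_coord z w k : W z -> kerv z k w k = K z w.
Proof. by move=> Wz; rewrite kervE// coordZ/= eqxx mulr1. Qed.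

Lemma KC z w : W z -> W w -> K z w = conjc (K w z).
Proof.
by move=> Wz Ww; rewrite -(kerv_coord w 0 Wz) -cdot_kerv// cdotC cdot_kerv// kerv_coord.
Qed.

Lemma Kzz z : W z -> K z z = (kn z ^+ 2)%:C%C.
Proof. by move=> Wz; rewrite -(kerv_coord z 0 Wz) -cdot_kerv// cdotFF nrmL2_kerv. Qed.

Lemma sdot_K z w : W z -> W w -> sdot W sg (K z) (K w) = K z w.
Proof.
move=> Wz Ww; rewrite (ker_repr (ker_sbergman Wz) Ww) /sdot; congr cint.
by apply/funext => v; rewrite mulrC.
Qed.

Lemma nrm_coord_le f z k : W z -> nrm (f z k) <= nrm f * kn z.
Proof. by move=> Wz; rewrite -cdot_kerv// (le_trans (cdot_le _ _))// nrmL2_kerv// nrm_toL2. Qed.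

(** (A.5) in terms of K. With the convention 1/0 = 0 it also covers vanishing kernels, which
    [kn_degenerate] exploits. *)
Lemma kunit_sdot z w : W z -> W w ->
  nrm (K z w) / (kn z * kn w) = (kn (invol Sp z w))^-1.
Proof.
move=> Wz Ww; rewrite -(kunit_invol Wz Ww).
have cE v u : W v -> kunit W sg K v u *: ell2_unit R 0 =
    (((kn v)^-1)%:C%C *: kerv v 0) u.
  move=> Wv; rewrite [RHS](_ : _ = ((kn v)^-1)%:C%C *: kerv v 0 u)// kervE// scalerA.
  by congr (_ *: _); rewrite /kunit mulrC fmorphV.
have -> : sdot W sg (kunit W sg K z) (kunit W sg K w) =
    cdot (toL2 (((kn z)^-1)%:C%C *: kerv z 0)) (toL2 (((kn w)^-1)%:C%C *: kerv w 0)).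
  rewrite -L2dotE /sdot /L2dot; congr cint; apply/funext => u.
  rewrite [toL2 _ u](esym (cE z u Wz)) [X in ell2_dot _ X](esym (cE w u Ww)).
  by rewrite ell2_dot_unit coordZ /= mulr1.
rewrite !toL2Z cdotZl cdotZr cdot_kerv// kerv_coord// !nrmM nrmc_conj !nrmcR.
by rewrite !ger0_norm ?invr_ge0 ?kn_ge0// invfM; ring.
Qed.

(** If K_w vanishes then, by (A.5), so does the kernel at phi_z(w) for all z. Taking z = w gives K_0
    = 0, and then phi_z(0) = z gives K_z = 0. *)
Lemma kn_degenerate w : W w -> kn w = 0 -> forall f, f = 0.
Proof.
move=> Ww kw0.
have h z v : W z -> W v -> kn v = 0 -> kn (invol Sp z v) = 0.
  move=> Wz Wv kv; have := kunit_sdot Wz Wv.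
  (* Both sides are inverses of norms with 1/0 = 0: the left one is 0, hence so is the norm on the
     right. *)
  by rewrite kv mulr0 invr0 mulr0 => /esym/eqP; rewrite invr_eq0 => /eqP.
have k0 : kn 0 = 0.
  have := h w w Ww Ww kw0; rewrite -{2}(invol0 Ww) involK//; exact: dom0.
move=> f; apply: B_ext => z Wz k; apply: nrm_eq0; apply/le_anti.
rewrite nrm_ge0 andbT (le_trans (nrm_coord_le f k Wz))//.
by have := h z 0 Wz (@dom0 _ _ Sp) k0; rewrite invol0// => ->; rewrite mulr0.
Qed.

Inductive kspan : B -> Prop :=
| kspan0 : kspan 0
| kspanD c z k f : W z -> kspan f -> kspan (c *: kerv z k + f).

(** Representing the pairing with [f] on the span yields [g] in its closure with the same inner
    products with all K_z e_k, that is, with the same values as [f]. *)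
Lemma kspan_dense f (e : R) : 0 < e -> exists2 g, kspan g & nrm (f - g) < e.
Proof.
have sD h1 h2 : kspan h1 -> kspan h2 -> kspan (h1 + h2).
  elim=> [|c z k h' Wz _ IH] k2; first by rewrite add0r.
  by rewrite -addrA; apply: kspanD => //; exact: IH.
have sZ (a : R[i]) h1 : kspan h1 -> kspan (a *: h1).
  elim=> [|c z k h' Wz _ IH]; first by rewrite scaler0; exact: kspan0.
  by rewrite scalerDr scalerA; exact: kspanD.
have lD h1 h2 : rdot (toL2 (h1 + h2)) (toL2 f) = rdot (toL2 h1) (toL2 f) + rdot (toL2 h2) (toL2 f).
  by rewrite toL2D rdotDl.
have lZ (a : R) h : rdot (toL2 (a%:C%C *: h)) (toL2 f) = a * rdot (toL2 h) (toL2 f).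
  by rewrite toL2Z rdotZl.
have lC h : `|rdot (toL2 h) (toL2 f)| <= nrm f * nrm h.
  by rewrite mulrC (nrm_toL2 h) (nrm_toL2 f) rdot_le.
have [g [gP ga]] := @riesz _ _ _ kspan _ _ kspan0 sD (fun a h => sZ _ h) lD lZ lC.
suff -> : f = g by exact: ga.
apply: B_ext => z Wz k; rewrite -!cdot_kerv// cdotC [RHS]cdotC; congr conjc.
have kk : kspan (kerv z k) by rewrite -[kerv z k]addr0 -[kerv z k]scale1r; apply: kspanD => //;
  exact: kspan0.
rewrite /cdot gP//; congr (_ +i* _)%C; have := gP _ (sZ 'i%C _ kk).
rewrite toL2Z !rdotiN; lra.
Qed.

End kernels.

(** * The metric *)

Section metric.
Variables (R : realType) (n : nat) (Sp : bergman_space R n).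
Local Notation V := 'rV[R[i]]_n.+1.
Local Notation bV := (borelC R n).
Local Notation W := (dom Sp).
Local Notation sg := (sigma Sp).
Local Notation K := (ker Sp).
Local Notation kn := (knrm W sg K).
Local Notation d := (mdis Sp).
Local Notation inv := (invol Sp).
Implicit Types z w u v : V.

Lemma d_sym u v : W u -> W v -> d u v = d v u.
Proof. exact: dist_sym. Qed.

Lemma d_tri v u w : W u -> W v -> W w -> d u w <= d u v + d v w.
Proof. exact: dist_triangle. Qed.

Lemma d_xx u : W u -> d u u = 0.
Proof. exact: distxx. Qed.

Lemma d_ge0 u v : W u -> W v -> 0 <= d u v.
Proof.
move=> Wu Wv; have := d_tri Wu Wv Wu; rewrite d_xx// (d_sym Wv Wu).
by rewrite -mulr2n pmulrn_lge0.
Qed.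

Lemma d_inv z u v : W z -> W u -> W v -> d (inv z u) v = d u (inv z v).
Proof.
move=> Wz Wu Wv; rewrite (mdis_invol Wz)//; last exact: invol_dom.
by rewrite involK.
Qed.

Lemma inv_z z : W z -> inv z z = 0.
Proof. by move=> Wz; rewrite -{2}(invol0 Wz) involK//; exact: dom0. Qed.

Lemma d_inv0 z u : W z -> W u -> d (inv z u) 0 = d u z.
Proof. by move=> Wz Wu; rewrite d_inv// ?invol0//; exact: dom0. Qed.

(** Continuity on [W] for the metric [mdis], in terms of points of C^(n+1) rather than of [mspace],
    so that it can be combined with measurability there. *)
Definition mcont (h : V -> R) := forall w, W w -> forall e : R, 0 < e ->
  exists2 r, 0 < r & forall w', W w' -> d w w' < r -> `|h w - h w'| < e.

Definition mkpt w (Ww : W w) : mspace d := exist _ w (mem_set Ww).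

Lemma mcontP (h : V -> R) : continuous (fun x : mspace d => h (pt x)) -> mcont h.
Proof.
move=> ch w Ww e e0; have := ch (mkpt Ww).
move=> /cvgrPdist_lt /(_ e e0); rewrite near_nbhs => /nbhs_ballP[r /= r0 rP].
exists r => // w' Ww' dw; apply: (rP (mkpt Ww')).
by rewrite ballEmdist.
Qed.

Lemma mcont_inv (h : V -> R) z : W z -> mcont h -> mcont (fun w => h (inv z w)).
Proof.
move=> Wz ch w Ww e e0; have [r r0 rP] := ch _ (invol_dom Wz Ww) e e0.
by exists r => // w' Ww' dw; apply: rP; [exact: invol_dom|rewrite -mdis_invol].
Qed.

Lemma mcont_kn : mcont kn.
Proof. by apply: mcontP; exact: knrm_continuous. Qed.

Lemma d_sep : exists a : nat -> V, (forall i, W (a i)) /\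
  forall w (e : R), W w -> 0 < e -> exists i, d w (a i) < e.
Proof.
have [A /countable_injP[f finj] dA] := mdis_separable Sp.
(* The inverse of an injection of the dense set into nat; indices outside its range yield the
   origin. *)
pose a i := xget (mkpt (@dom0 _ _ Sp)) [set x | A x /\ f x = i].
exists (fun i => pt (a i)); split=> [i|w e Ww e0]; first exact: ptP.
have [] := dA [set y | d w (pt y) < e].
- by exists (mkpt Ww); rewrite /= d_xx.
- rewrite openE => y /= wy; apply/nbhs_ballP; exists (e - d w (pt y)) => /=.
    by rewrite subr_gt0.
  move=> x; rewrite ballEmdist /= => yx.
  apply: le_lt_trans (d_tri Ww (ptP y) (ptP x)) _.
  by rewrite -ltrBrDl.
move=> x [/= wx Ax]; exists (f x).
suff -> : a (f x) = x by [].
apply: xget_unique => // y [Ay fy]; apply: finj => //; exact/mem_set.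
Qed.

HB.instance Definition _ := isPointed.Build (mspace d) (mkpt (@dom0 _ _ Sp)).

Lemma d_cover (rho : R) (r : V -> R) : (forall v, W v -> 0 < r v) -> exists s : seq V,
  (forall v, v \in s -> W v) /\
  forall w, W w -> d 0 w <= rho -> exists2 v, v \in s & d v w < r v.
Proof.
move=> r0; have := @mdis_compact _ _ Sp (mkpt (@dom0 _ _ Sp)) rho.
rewrite (@compact_cover (mspace d)) => cc.
have := cc _ setT (fun x : mspace d => [set y : mspace d | d (pt x) (pt y) < r (pt x)]).
case.
- move=> x _; rewrite openE => y /= wy; apply/nbhs_ballP.
  exists (r (pt x) - d (pt x) (pt y)) => /=; first by rewrite subr_gt0.
  move=> y'; rewrite ballEmdist /= => yx.
  apply: le_lt_trans (d_tri (ptP x) (ptP y) (ptP y')) _.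
  by rewrite -ltrBrDl.
- by move=> y _; exists y => //=; rewrite d_xx ?r0//; exact: ptP.
move=> D _ cD; exists [seq pt x | x <- finmap.enum_fset D]; split.
  by move=> v /mapP[x _ ->]; exact: ptP.
move=> w Ww wr; have [|x xD xw] := cD (mkpt Ww); first exact: wr.
by exists (pt x) => //; apply: map_f.
Qed.

(** Closed balls are compact: finitely many balls on which [kn] varies by less than 1 cover, and the
    sum of the values at the centers stands in for their maximum. *)
Lemma kn_bounded (rho : R) : exists M, forall w, W w -> d 0 w <= rho -> kn w <= M.
Proof.
have h v : exists r, 0 < r /\ (W v -> forall w, W w -> d v w < r -> `|kn v - kn w| < 1).
  have [Wv|nWv] := pselect (W v); last by exists 1.
  by have [r r0 rP] := mcont_kn Wv ltr01; exists r.
have [r rP] := choice h.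
have [s [sW sP]] := @d_cover rho r (fun v _ => (rP v).1).
exists (\sum_(v <- s) kn v + 1) => w Ww wr.
have [v vs vw] := sP w Ww wr; have := (rP v).2 (sW v vs) w Ww vw.
rewrite ltr_norml => /andP[+ _]; rewrite ltrBrDr => h1.
have : kn v <= \sum_(v <- s) kn v.
  rewrite (big_rem v)//= lerDl sumr_ge0// => *; exact: kn_ge0.
move: (\sum_(v <- s) _) (kn v) (kn w) h1 => *; lra.
Qed.

Lemma measurable_ballW z (r : R) : W z ->
  measurable ([set w | W w /\ d z w < r] : set bV).
Proof. by move=> Wz; have := @dball_measurable _ _ Sp z r Wz. Qed.

(** Replacing [w] by a_i, for the first i with d(w, a_i) < 1/(m+1), yields functions that are
    measurable on countably many measurable pieces; they converge to [h] by its continuity in [w].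
    Of the metric this uses only that it is separable and that its balls are Borel sets. *)
Lemma measurable_caratheodory (h : V -> V -> R) :
  (forall z, W z -> mcont (h z)) ->
  (forall w, W w -> measurable_fun (W : set bV) (h^~ w)) ->
  measurable_fun ((W `*` W) : set (bV * bV)) (fun p => h p.1 p.2).
Proof.
move=> hc hm; have [a [Wa aP]] := d_sep.
have mW := mdom Sp.
pose F m i := [set w | W w /\ d w (a i) < m.+1%:R^-1] `\`
   \bigcup_(j in [set j | (j < i)%N]) [set w | W w /\ d w (a j) < m.+1%:R^-1].
have mball m i : measurable ([set w | W w /\ d w (a i) < m.+1%:R^-1] : set bV).
  rewrite (_ : [set w | _] = [set w | W w /\ d (a i) w < m.+1%:R^-1]).
    exact: measurable_ballW.
  by apply/seteqP; split=> w /= [Ww]; rewrite d_sym//; split.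
have mF m i : measurable (F m i : set bV).
  by apply: measurableD => //; apply: bigcup_measurable.
have FW m w : W w -> exists i, F m i w.
  move=> Ww; have ex : exists i, d w (a i) < m.+1%:R^-1 by exact: aP.
  exists (ex_minn ex); case: ex_minnP => i iP imin; split => //.
  move=> [j /= ji [_ dj]]; have := imin _ dj; by rewrite leqNgt ji.
have Flt m w i j : (i < j)%N -> F m i w -> ~ F m j w.
  by move=> ij [wi _] [_ nj]; apply: nj; exists i.
have Funiq m w i j : F m i w -> F m j w -> i = j.
  move=> wi wj; case: (ltngtP i j) => // ij.
    by have := Flt m w _ _ ij wi wj.
  by have := Flt m w _ _ ij wj wi.
pose idx m w := xget 0%N [set i | F m i w].
have idxP m w : W w -> F m (idx m w) w.
  by move=> Ww; have [i Fi] := FW m w Ww;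
    exact: (@xgetPex _ 0%N [set i | F m i w] (ex_intro _ i Fi)).
apply: (@measurable_fun_cvg _ (bV * bV)%type R (W `*` W) (fun m p => h p.1 (a (idx m p.2)))).

  move=> m _ Y mY.
  rewrite (_ : _ `&` _ = \bigcup_i ((W `&` (h^~ (a i)) @^-1` Y) `*` F m i)).
    apply: bigcup_measurable => i _; apply: measurableX => //.
    by apply: hm => //; exact: Wa.
  apply/seteqP; split=> [[z w] [[/= Wz Ww] Yh]|[z w] [i _ [[/= Wz Yh] Fi]]].
    by exists (idx m w) => //; split=> //=; exact: idxP.
  have Ww : W w by case: Fi => [[]].
  by split=> //=; rewrite (Funiq m w _ _ (idxP m w Ww) Fi).
move=> [z w] [/= Wz Ww]; apply/cvgrPdist_lt => e e0.
have [r r0 rP] := hc z Wz w Ww e e0.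
have [N NP] := invS_lt r0.
exists N => // m /= Nm; apply: rP => //.
by have [[_ /lt_trans h1] _] := idxP m w Ww; apply: h1; exact: NP.
Qed.

(** The preceding lemma for a function that ignores its first variable, pulled back along the
    diagonal. *)
Lemma measurable_mcont (h : V -> R) : mcont h -> measurable_fun (W : set bV) h.
Proof.
move=> ch.
have mj := @measurable_caratheodory (fun _ => h) (fun _ _ => ch)
  (fun w _ => measurable_cst (h w)).
have mWW : measurable ((W `*` W) : set (bV * bV)) by apply: measurableX; exact: mdom.
have mdg : measurable_fun (W : set bV) (fun w : bV => (w, w)).
  apply: measurable_funTS; apply/measurable_fun_pairP; split; exact: measurable_id.
apply: (measurable_comp mWW _ mj mdg).
by move=> _ [w Ww <-].
Qed.

Lemma measurable_kn : measurable_fun (W : set bV) kn.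
Proof. by apply: measurable_mcont; exact: mcont_kn. Qed.

Lemma kn_inv_sym z w : W z -> W w -> kn (inv z w) = kn (inv w z).
Proof.
move=> Wz Ww; apply: invr_inj; rewrite -!kunit_sdot//.
by rewrite (KC Wz Ww) nrmc_conj (mulrC (kn z)).
Qed.

(** Continuity in [w] holds because phi_z is an isometry. Measurability in [z], on which phi_z may
    depend arbitrarily, comes from the symmetry [kn_inv_sym]. *)
Lemma measurable_kn_inv :
  measurable_fun ((W `*` W) : set (bV * bV)) (fun p => kn (inv p.1 p.2)).
Proof.
apply: (@measurable_caratheodory (fun z w => kn (inv z w))).
  by move=> z Wz; apply: mcont_inv => //; exact: mcont_kn.
move=> w Ww.
have h : measurable_fun (W : set bV) (fun z => kn (inv w z)).
  by apply: measurable_mcont; apply: mcont_inv => //; exact: mcont_kn.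
by apply: eq_measurable_fun h => z /set_mem Wz; rewrite kn_inv_sym.
Qed.

End metric.

(** * The Schur test for commutators *)

Section nondegenerate.
Variables (R : realType) (n : nat) (Sp : bergman_space R n).
Local Notation V := 'rV[R[i]]_n.+1.
Local Notation bV := (borelC R n).
Local Notation W := (dom Sp).
Local Notation sg := (sigma Sp).
Local Notation K := (ker Sp).
Local Notation kn := (knrm W sg K).
Local Notation inv := (invol Sp).
Implicit Types z w u v : V.
Hypothesis nd : forall z, W z -> kn z != 0.

Lemma kn_gt0 z : W z -> 0 < kn z.
Proof. by move=> Wz; rewrite lt_neqAle eq_sym nd//= kn_ge0. Qed.

Lemma q_gt0 z w : W z -> W w -> 0 < kn (inv z w).
Proof. by move=> Wz Ww; apply: kn_gt0; exact: invol_dom. Qed.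

Lemma nrmK z w : W z -> W w -> nrm (K z w) = kn z * kn w / kn (inv z w).
Proof.
move=> Wz Ww; rewrite -kunit_sdot// mulrC -mulrA mulVf ?mulr1//.
by rewrite mulf_neq0// nd.
Qed.

Lemma nrmKV z w : W z -> W w -> nrm (K z w) = kn z * kn w * kn (inv z w) `^ (-1).
Proof. by move=> Wz Ww; rewrite nrmK// powR_inv1// kn_ge0. Qed.

(** (A.5) at z = w = 0, where phi_0(0) = 0, reads ||K_0||^2 = ||K_0||^2 / ||K_0||. *)
Lemma kn_0 : kn 0 = 1.
Proof.
have W0 := @dom0 _ _ Sp; have := nrmK W0 W0; rewrite invol0// Kzz//.
rewrite nrmcR ger0_norm ?sqr_ge0// -mulrA divff ?nd// mulr1 expr2.
by move=> h; apply: (mulfI (nd W0)); rewrite mulr1.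
Qed.

Lemma measurable_q z : W z -> measurable_fun (W : set bV) (fun w => kn (inv z w)).
Proof. by move=> Wz; apply: measurable_mcont; apply: mcont_inv => //; exact: mcont_kn. Qed.

Lemma measurable_powRW (D : set bV) (f : bV -> R) (r : R) : measurable_fun D f ->
  measurable_fun D (fun w => f w `^ r).
Proof. by move=> mf; apply: (measurableT_comp (measurable_powR r) mf). Qed.

Lemma measurable_nrmK z : W z -> measurable_fun (W : set bV) (fun w => nrm (K z w)).
Proof.
move=> Wz.
have h : measurable_fun (W : set bV) (fun w => kn z * kn w * kn (inv z w) `^ (-1)).
  apply: measurable_funM; first by apply: measurable_funM => //; exact: measurable_kn.
  by apply: measurable_powRW; exact: measurable_q.
by apply: eq_measurable_fun h => w /set_mem Ww; rewrite nrmKV.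
Qed.

Lemma expR_powR (x r : R) : expR x `^ r = expR (r * x).
Proof. by rewrite /powR gt_eqF ?expR_gt0// expRK. Qed.

Section schur.
Hypothesis kappa_gt0 : 0 < kappa Sp.

(** By (A.5), the integrand of (A.6) for r = 2 - e - t and s = t - e is ||K_z||^(-t) times |K_z(w)|
    ||K_(phi_z(w))||^e ||K_w||^t. The choice e = 0 gives the usual Schur bound, e = t / 2 the second
    one, whose additional factor grows away from the diagonal. *)
Lemma schur_constants : exists t delta C : R, [/\ 0 < delta, 0 < C &
  forall z, W z ->
  ((\int[sg]_(w in W) (nrm (K z w) * kn w `^ t)%:E) <= (C * kn z `^ t)%:E)%E /\
  ((\int[sg]_(w in W) (nrm (K z w) * kn (inv z w) `^ delta * kn w `^ t)%:E)
     <= (C * kn z `^ t)%:E)%E].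
Proof.
have [[/andP[_ k2] RF]|[k0 _]] := ker_rudin_forelli Sp; last first.
  by move: kappa_gt0; rewrite k0 ltxx.
(* With 2 t at most kappa and 2 - kappa, and 2 e <= t, the exponents satisfy r > kappa > s > 0. *)
pose t := Num.min (kappa Sp) (2 - kappa Sp) / 2.
have t0 : 0 < t by rewrite divr_gt0// lt_min kappa_gt0 subr_gt0.
have tk : 2 * t <= kappa Sp by rewrite /t mulrC divfK// ge_min lexx.
have tk2 : 2 * t <= 2 - kappa Sp by rewrite /t mulrC divfK// ge_min lexx orbT.
have key (e : R) : 0 <= e -> 2 * e <= t -> exists2 C : R, 0 < C & forall z, W z ->
    ((\int[sg]_(w in W) (nrm (K z w) * kn (inv z w) `^ e * kn w `^ t)%:E)
       <= (C * kn z `^ t)%:E)%E.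
  move=> e0 et.
  have [||C CP] := RF (2 - e - t) (t - e); [lra|lra|].
  exists (`|C| + 1) => [|z Wz]; first by rewrite ltr_wpDl.
  have := CP z Wz; rewrite /rudin_forelli.
  have E w : W w -> nrm (sdot W sg (K z) (K w)) `^ ((2 - e - t + (t - e)) / 2) /
      (kn z `^ (t - e) * kn w `^ (2 - e - t)) * kn w ^+ 2 =
      kn z `^ (- t) * (nrm (K z w) * kn (inv z w) `^ e * kn w `^ t).
    move=> Ww; rewrite sdot_K// nrmK//.
    (* Writing the norms as exponentials turns the identity between powers into a linear one between
       exponents. *)
    have lnP (x : R) : 0 < x -> exists l, x = expR l.
      by move=> x0; exists (ln x); rewrite lnK.
    have [x ->] := lnP _ (kn_gt0 Wz); have [y ->] := lnP _ (kn_gt0 Ww).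
    have [p ->] := lnP _ (q_gt0 Wz Ww).
    rewrite -(expRN p) -!expRD !expR_powR -!expRD -expRN -expRM_natl -!expRD.
    by congr expR; rewrite mulr2n; field.
  under eq_integral => w /set_mem Ww do rewrite E// EFinM.
  rewrite ge0_integralZl_EFin ?powR_ge0//; last 3 first.
  - exact: mdom.
  - move=> w _; rewrite lee_fin !mulr_ge0 ?powR_ge0 ?nrm_ge0//.
  - apply/measurable_EFinP; apply: measurable_funM; last first.
      by apply: measurable_powRW; exact: measurable_kn.
    apply: measurable_funM; first exact: measurable_nrmK.
    by apply: measurable_powRW; exact: measurable_q.
  move=> h; have {h} := lee_wpmul2l (_ : 0 <= (kn z `^ t)%:E)%E h.
  rewrite lee_fin powR_ge0 => /(_ isT); rewrite muleA -EFinM -powRD; last first.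
    by rewrite nd ?implybT.
  rewrite subrr powRr0 mul1e => /le_trans; apply.
  rewrite -EFinM lee_fin mulrC ler_wpM2r ?powR_ge0//.
  by rewrite (le_trans (ler_norm C))// lerDl.
have t1 : 2 * 0 <= t by lra.
have t2 : 0 <= t / 2 by lra.
have t3 : 2 * (t / 2) <= t by lra.
have [C1 C10 h1] := key 0 (lexx _) t1.
have [C2 C20 h2] := key (t / 2) t2 t3.
have t4 : 0 < t / 2 by lra.
have C3 : 0 < C1 + C2 by lra.
exists t, (t / 2), (C1 + C2); split=> //.
move=> z Wz; split.
  have := h1 z Wz; under eq_integral do rewrite powRr0 mulr1.
  by move/le_trans; apply; rewrite lee_fin ler_wpM2r ?powR_ge0//; lra.
by apply: le_trans (h2 z Wz) _; rewrite lee_fin ler_wpM2r ?powR_ge0//; lra.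
Qed.

End schur.

(** Extension by 0 reduces this to the whole product space. The measurability of the inner integral
    is kept for later comparisons of integrals. *)
Lemma tonelli_dom (G : V -> V -> R) : (forall z w, W z -> W w -> 0 <= G z w) ->
  measurable_fun ((W `*` W) : set (bV * bV)) (fun p => G p.1 p.2) ->
  measurable_fun (W : set bV) (fun z => \int[sg]_(w in W) (G z w)%:E)%E /\
  (\int[sg]_(z in W) \int[sg]_(w in W) (G z w)%:E =
   \int[sg]_(w in W) \int[sg]_(z in W) (G z w)%:E)%E.
Proof.
move=> G0 mG; have mW := mdom Sp.
have mWW : measurable ((W `*` W) : set (bV * bV)) by exact: measurableX.
pose f : bV * bV -> \bar R := (fun p => (G p.1 p.2)%:E) \_ (W `*` W).
have mf : measurable_fun setT f.
  by apply/(measurable_restrictT _ mWW)/measurable_EFinP.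
have f0 p : (0 <= f p)%E.
  rewrite /f patchE; case: ifPn => // /set_mem[]; case: p => z w /= Wz Ww.
  by rewrite lee_fin G0.
have fz z : (\int[sg]_w f (z, w) =
    ((fun z => \int[sg]_(w in W) (G z w)%:E) \_ W) z)%E.
  rewrite patchE; case: ifPn => [/set_mem Wz|nWz].
    rewrite [RHS]integral_mkcond; apply: eq_integral => w _.
    rewrite /f !patchE; case: ifPn => [/set_mem[/= _ Ww]|h].
      by rewrite mem_set.
    case: ifPn => // /set_mem Ww; exfalso.
    by move/negP: h; apply; apply: mem_set.
  apply: integral0_eq => w _; rewrite /f patchE; case: ifPn => // /set_mem[/= Wz _].
  by move/negP: nWz; case; exact: mem_set.
have fw w : (\int[sg]_z f (z, w) =
    ((fun w => \int[sg]_(z in W) (G z w)%:E) \_ W) w)%E.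
  rewrite patchE; case: ifPn => [/set_mem Ww|nWw].
    rewrite [RHS]integral_mkcond; apply: eq_integral => z _.
    rewrite /f !patchE; case: ifPn => [/set_mem[/= Wz _]|h].
      by rewrite mem_set.
    case: ifPn => // /set_mem Wz; exfalso.
    by move/negP: h; apply; apply: mem_set.
  apply: integral0_eq => z _; rewrite /f patchE; case: ifPn => // /set_mem[/= _ Ww].
  by move/negP: nWw; case; exact: mem_set.
split.
  have h : measurable_fun setT (fubini_F sg f) by exact: measurable_fun_fubini_tonelli_F.
  apply/(measurable_restrictT _ mW).
  by apply: eq_measurable_fun h => z _; rewrite -fz.
have := fubini_tonelli (m1 := sg) (m2 := sg) f mf f0.
under eq_integral do rewrite fz.
under [in RHS]eq_integral do rewrite fw.
by rewrite -!integral_mkcond.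
Qed.

End nondegenerate.

(** * Bounded multipliers on L^2 *)

Section multiplication.
Variables (R : realType) (n : nat) (Sp : bergman_space R n).
Local Notation V := 'rV[R[i]]_n.+1.
Local Notation bV := (borelC R n).
Local Notation W := (dom Sp).
Local Notation sg := (sigma Sp).
Local Notation K := (ker Sp).
Local Notation L2 := (L2 Sp).
Implicit Types (z w u v : V) (F G : L2).

Lemma nrmL2_sqE F : ((nrmL2 F ^+ 2)%:E = sqint W sg F)%E.
Proof.
rewrite nrmL2_sq rdotFF fineK// ge0_fin_numE ?sqint_ge0//.
by have [_] := l2P F.
Qed.

Fact L2of_key : unit. Proof. by []. Qed.
Definition L2of (F : V -> ell2 R) : L2 := locked_with L2of_key (insubd (0 : L2) F).

Lemma L2ofE (F : V -> ell2 R) : F \in l2_pred Sp -> (L2of F : V -> ell2 R) = F.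
Proof. by move=> vF; rewrite /L2of unlock val_insubd vF. Qed.

(** The domination is asked almost everywhere only, because symbols are essentially bounded. *)
Lemma l2_dom (F : V -> ell2 R) G (C : R) : 0 <= C ->
  (forall k, cmeasurable W (fun z => F z k)) ->
  {ae sg, forall z, W z -> nrm (F z) <= C * nrm (G z)} ->
  F \in l2_pred Sp /\ nrmL2 (L2of F) <= C * nrmL2 G.
Proof.
move=> C0 mF FG.
have h : (sqint W sg F <= (C ^+ 2)%:E * sqint W sg G)%E.
  rewrite /sqint -ge0_integralZl_EFin ?sqr_ge0//; last 3 first.
  - exact: mdom.
  - by move=> *; rewrite lee_fin sqr_ge0.
  - by apply/measurable_EFinP; exact: measurable_nrm2.
  apply: ae_ge0_le_integral => //.
  - exact: mdom.
  - by move=> *; rewrite lee_fin sqr_ge0.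
  - by apply: measurable_sqnrm.
  - by move=> *; rewrite -EFinM lee_fin mulr_ge0 ?sqr_ge0.
  - apply/measurable_EFinP; apply: measurable_funM => //; exact: measurable_nrm2.
  move: FG; apply: (@filterS _ _ (ae_filter_ringOfSetsType sg)) => z FG Wz;
    rewrite -EFinM lee_fin -exprMn.
  rewrite ler_pXn2r ?nnegrE ?mulr_ge0 ?nrm_ge0//; exact: FG.
have lF : F \in l2_pred Sp.
  apply/asboolP; split => //; apply: le_lt_trans h _.
  by rewrite -nrmL2_sqE -EFinM ltry.
split=> //; rewrite -(ler_pXn2r (n:=2)) ?nnegrE ?mulr_ge0 ?nrmL2_ge0//.
by rewrite -lee_fin nrmL2_sqE L2ofE// exprMn EFinM nrmL2_sqE.
Qed.

Definition bmfun (x : V -> R) := measurable_fun (W : set bV) x /\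
  exists M, forall z, W z -> `|x z| <= M.

Definition mulx (x : V -> R) F : L2 := L2of (fun z => (x z)%:C%C *: F z).

Lemma cmeasurable_real (x : V -> R) : measurable_fun (W : set bV) x ->
  cmeasurable W (fun z => (x z)%:C%C).
Proof. by move=> mx; split => //=; exact: measurable_cst. Qed.

Lemma mulx_l2 (x : V -> R) F (M : R) : measurable_fun (W : set bV) x ->
  (forall z, W z -> `|x z| <= M) -> 0 <= M ->
  (fun z => (x z)%:C%C *: F z) \in l2_pred Sp /\ nrmL2 (mulx x F) <= M * nrmL2 F.
Proof.
move=> mx xM M0; apply: l2_dom => //.
  move=> k; have [mF _] := l2P F.
  exact: (cmeasurableM (cmeasurable_real mx) (mF k)).
apply: aeW => z Wz; rewrite nrmZ nrmcR ler_wpM2r ?nrm_ge0//; exact: xM.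
Qed.

Lemma mulxE (x : V -> R) F z : bmfun x -> mulx x F z = (x z)%:C%C *: F z.
Proof.
move=> [mx [M xM]].
have M' w : W w -> `|x w| <= `|M|.
  by move=> Ww; rewrite (le_trans (xM w Ww))// ler_norm.
by have [h _] := mulx_l2 F mx M' (normr_ge0 M); rewrite /mulx L2ofE.
Qed.

Lemma nrmL2_mulx (x : V -> R) F (M : R) : bmfun x -> 0 <= M ->
  (forall z, W z -> `|x z| <= M) -> nrmL2 (mulx x F) <= M * nrmL2 F.
Proof. by move=> [mx _] M0 xM; have [] := mulx_l2 F mx xM M0. Qed.

Lemma L2ED F G z : (F + G) z = F z + G z. Proof. by []. Qed.
Lemma L2EN F z : (- F) z = - F z. Proof. by []. Qed.
Lemma L2EZ (a : R[i]) F z : (a *: F) z = a *: F z. Proof. by []. Qed.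

Lemma mulxD x F G : bmfun x -> mulx x (F + G) = mulx x F + mulx x G.
Proof.
move=> bx; apply: L2_ext => z.
have E : (x z)%:C%C *: (F + G) z = (x z)%:C%C *: F z + (x z)%:C%C *: G z.
  by rewrite -scalerDr.
apply: (etrans (mulxE (F + G) z bx)); apply: (etrans E); apply: esym.
exact: (f_equal2 +%R (mulxE F z bx) (mulxE G z bx)).
Qed.

End multiplication.

(** * Weighted Cauchy-Schwarz inequalities *)

Section commutator.
Variables (R : realType) (n : nat) (Sp : bergman_space R n).
Local Notation V := 'rV[R[i]]_n.+1.
Local Notation bV := (borelC R n).
Local Notation W := (dom Sp).
Local Notation sg := (sigma Sp).
Local Notation K := (ker Sp).
Local Notation L2 := (L2 Sp).
Implicit Types (z w u v : V) (F G : L2).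

(** Pointwise |<F, G>| <= (s a + b / s) / 2 for every s > 0. Integrating first and optimizing [s]
    afterwards avoids the square root of a b. *)
Lemma rdot_cs F G (a b : V -> R) (A : R) : 0 < A ->
  (forall w, W w -> 0 <= a w) -> (forall w, W w -> 0 <= b w) ->
  measurable_fun (W : set bV) a -> measurable_fun (W : set bV) b ->
  (forall w, W w -> rdot_ell2 (F w) (G w) ^+ 2 <= a w * b w) ->
  (\int[sg]_(w in W) (a w)%:E <= A%:E)%E ->
  ((rdot F G ^+ 2)%:E <= A%:E * \int[sg]_(w in W) (b w)%:E)%E.
Proof.
move=> A0 a0 b0 ma mb ab aA; have mW := mdom Sp.
have ib0 : (0 <= \int[sg]_(w in W) (b w)%:E)%E by apply: integral_ge0 => w Ww; rewrite lee_fin b0.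
move bE : (\int[sg]_(w in W) (b w)%:E)%E ib0 => ib; case: ib bE => [b'| |]//; last first.
  by move=> _ _; rewrite gt0_muley ?lte_fin// leey.
rewrite lee_fin => bE b'0; rewrite -EFinM lee_fin.
have key (s : R) : 0 < s -> `|rdot F G| <= 2^-1 * (s * A + b' / s).
  move=> s0; rewrite -lee_fin.
  have -> : (`|rdot F G|%:E = `| \int[sg]_(w in W) (rdot_ell2 (F w) (G w))%:E |)%E.
    rewrite /rdot /Rintegral -[in RHS](fineK (integrable_fin_num mW (integrable_rd F G))).
    by [].
  apply: le_trans (le_abse_integral _ mW _) _.
    by apply/measurable_EFinP; exact: measurable_rd.
  apply: (@le_trans _ _ (\int[sg]_(w in W) ((2^-1 * s)%:E * (a w)%:E +
    (2^-1 / s)%:E * (b w)%:E)))%E.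
    apply: ge0_le_integral => //.
    - apply: measurableT_comp => //; apply/measurable_EFinP; exact: measurable_rd.
    - apply/measurable_EFinP; apply: measurable_funD; exact: measurable_funM.
    move=> w Ww; rewrite -!EFinM -EFinD abse_EFin lee_fin.
    have h0 : 0 <= 2^-1 * s * a w + 2^-1 / s * b w.
      by rewrite addr_ge0// mulr_ge0 ?a0 ?b0// ?mulr_ge0 ?invr_ge0 ?ltW.
    rewrite -(ler_pXn2r (n:=2)) ?nnegrE// real_normK ?num_real//.
    apply: le_trans (ab w Ww) _.
    rewrite -subr_ge0 (_ : _ - _ = (2^-1 * s * a w - 2^-1 / s * b w) ^+ 2) ?sqr_ge0//.
    by field; rewrite gt_eqF.
  rewrite ge0_integralD//.
  - rewrite (ge0_integralZl_EFin _ mW (f1 := fun w => (a w)%:E))//; last 2 first.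
      exact/measurable_EFinP.
      by rewrite mulr_ge0 ?invr_ge0// ltW.
    rewrite (ge0_integralZl_EFin _ mW (f1 := fun w => (b w)%:E))//; last 2 first.
      exact/measurable_EFinP.
      by rewrite mulr_ge0 ?invr_ge0// ltW.
    rewrite bE -(EFinM _ b') mulrDr EFinD mulrA.
    rewrite (_ : 2^-1 / s * b' = 2^-1 * (b' / s)) ?leeD2r//; last by ring.
    by rewrite (EFinM _ A) lee_wpmul2l// lee_fin mulr_ge0 ?invr_ge0 ?ltW.
  - by move=> w Ww; rewrite mule_ge0 ?lee_fin ?a0 ?mulr_ge0 ?invr_ge0 ?(ltW s0).
  - by apply/measurable_EFinP; exact: measurable_funM.
  - by move=> w Ww; rewrite mule_ge0 ?lee_fin ?b0 ?mulr_ge0 ?invr_ge0 ?(ltW s0).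
  - by apply/measurable_EFinP; exact: measurable_funM.
rewrite -[_ ^+ 2]real_normK ?num_real//.
move: key; have := normr_ge0 (rdot F G); move: `|rdot F G| => x x0 key.
have [->|xN] := eqVneq x 0; first by rewrite expr0n mulr_ge0// ltW.
have xp : 0 < x by rewrite lt_neqAle eq_sym xN.
(* This [s] gives x <= (x + A b' / x) / 2, that is, x^2 <= A b'. *)
have := key (x / A) (divr_gt0 xp A0).
rewrite divfK ?gt_eqF// (_ : b' / (x / A) = A * b' / x); last by field; rewrite !gt_eqF.
move=> h; have {}h : x <= A * b' / x by lra.
by rewrite expr2 -ler_pdivlMr.
Qed.

(** The factor 2 comes from adding the bounds of the real and the imaginary part. *)
Lemma cdot_cs F G (a b : V -> R) (A : R) : 0 < A ->
  (forall w, W w -> 0 <= a w) -> (forall w, W w -> 0 <= b w) ->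
  measurable_fun (W : set bV) a -> measurable_fun (W : set bV) b ->
  (forall w, W w -> rdot_ell2 (F w) (G w) ^+ 2 <= a w * b w) ->
  (forall w, W w -> rdot_ell2 (F w) ('i%C *: G w) ^+ 2 <= a w * b w) ->
  (\int[sg]_(w in W) (a w)%:E <= A%:E)%E ->
  ((nrm (cdot F G) ^+ 2)%:E <= (2 * A)%:E * \int[sg]_(w in W) (b w)%:E)%E.
Proof.
move=> A0 a0 b0 ma mb h1 h2 aA; rewrite sqnrmC EFinD.
apply: le_trans (leeD (rdot_cs A0 a0 b0 ma mb h1 aA)
  (@rdot_cs F ('i%C *: G) _ _ _ A0 a0 b0 ma mb h2 aA)) _.
have -> : ((2 * A)%:E = A%:E + A%:E)%E by rewrite -EFinD mulr_natl mulr2n.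
by rewrite ge0_muleDl ?lee_fin ?(ltW A0).
Qed.

End commutator.

(** * Square sums of commutators with the projection *)

Section schur_commutator.
Variables (R : realType) (n : nat) (Sp : bergman_space R n).
Local Notation V := 'rV[R[i]]_n.+1.
Local Notation bV := (borelC R n).
Local Notation W := (dom Sp).
Local Notation sg := (sigma Sp).
Local Notation K := (ker Sp).
Local Notation kn := (knrm W sg K).
Local Notation inv := (invol Sp).
Local Notation L2 := (L2 Sp).
Implicit Types (z w u v : V) (F G : L2).
Hypothesis nd : forall z, W z -> kn z != 0.

Lemma measurable_sndW (f : V -> R) : measurable_fun (W : set bV) f ->
  measurable_fun ((W `*` W) : set (bV * bV)) (fun p => f p.2).
Proof.
move=> mf; apply: (measurable_comp (mdom Sp) _ mf).
  by move=> _ [[z w] [_ Ww] <-].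
by apply: measurable_funTS; exact: measurable_snd.
Qed.

Lemma measurable_fstW (f : V -> R) : measurable_fun (W : set bV) f ->
  measurable_fun ((W `*` W) : set (bV * bV)) (fun p => f p.1).
Proof.
move=> mf; apply: (measurable_comp (mdom Sp) _ mf).
  by move=> _ [[z w] [Wz _] <-].
by apply: measurable_funTS; exact: measurable_fst.
Qed.

Variables (t delta C : R).
Hypotheses (C_gt0 : 0 < C)
  (schur : forall z, W z ->
  ((\int[sg]_(w in W) (nrm (K z w) * kn w `^ t)%:E) <= (C * kn z `^ t)%:E)%E /\
  ((\int[sg]_(w in W) (nrm (K z w) * kn (inv z w) `^ delta * kn w `^ t)%:E)
     <= (C * kn z `^ t)%:E)%E).

Let comm (x : V -> R) F : L2 := mulx x (toL2 (proj F)) - toL2 (proj (mulx x F)).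

Let measurable_knt (r : R) : measurable_fun (W : set bV) (fun w => kn w `^ r).
Proof. by apply: measurable_powRW; exact: measurable_kn. Qed.

Lemma measurable_coord2 F k : measurable_fun (W : set bV) (fun w => nrm (F w k) ^+ 2).
Proof.
have h : measurable_fun (W : set bV) (fun w => complex.Re (F w k) ^+ 2 + complex.Im (F w k) ^+ 2).
  have [mF _] := l2P F; have [h1 h2] := mF k.
  by apply: measurable_funD; apply: measurable_funX.
by apply: eq_measurable_fun h => w _; rewrite sqnrmC.
Qed.

Lemma measurable_diff2 (y : V -> R) (a : R) : measurable_fun (W : set bV) y ->
  measurable_fun (W : set bV) (fun w => (a - y w) ^+ 2).
Proof. by move=> my; apply: measurable_funX; apply: measurable_funB. Qed.

(** The coordinate is an integral of F_k against a kernel of modulus |x(z) - x(w)| |K_z(w)|.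
    Cauchy-Schwarz splits it into |K_z(w)| ||K_w||^t, whose integral the Schur bound controls, and
    |K_z(w)| (x(z) - x(w))^2 ||K_w||^(-t) |F_k(w)|^2. *)
Lemma comm_coord (x : V -> R) F z k : bmfun Sp x -> W z ->
  ((nrm (comm x F z k) ^+ 2)%:E <= (2 * (C * kn z `^ t))%:E *
   \int[sg]_(w in W) (nrm (K z w) * (x z - x w) ^+ 2 * kn w `^ (- t) * nrm (F w k) ^+ 2)%:E)%E.
Proof.
move=> bx Wz.
have -> : comm x F z k = cdot ((x z)%:C%C *: F - mulx x F) (toL2 (kerv Sp z k)).
  rewrite cdotBl cdotZl -!cdot_proj_kerv//.
  by rewrite /comm (L2ED (mulx x (toL2 (proj F)))) L2EN coordD coordN (mulxE _ _ bx) coordZ.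
have xF w : ((x z)%:C%C *: F - mulx x F) w = ((x z - x w)%:C)%C *: F w.
  by rewrite (L2ED (_ *: F)) L2EN L2EZ (mulxE _ _ bx) -scalerBl rmorphB.
have key w (c : R[i]) : W w -> nrm c = nrm (K z w) ->
    rdot_ell2 (((x z)%:C%C *: F - mulx x F) w) (c *: ell2_unit R k) ^+ 2 <=
    nrm (K z w) * kn w `^ t *
    (nrm (K z w) * (x z - x w) ^+ 2 * kn w `^ (- t) * nrm (F w k) ^+ 2).
  move=> Ww cK; rewrite xF rd_unit.
  have -> : nrm (K z w) * kn w `^ t *
    (nrm (K z w) * (x z - x w) ^+ 2 * kn w `^ (- t) * nrm (F w k) ^+ 2) =
    (kn w `^ t * kn w `^ (- t)) *
     (nrm (K z w) ^+ 2 * (x z - x w) ^+ 2 * nrm (F w k) ^+ 2) by ring.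
  rewrite -powRD ?nd ?implybT// subrr powRr0 mul1r.
  rewrite -real_normK ?num_real//.
  have -> : nrm (K z w) ^+ 2 * (x z - x w) ^+ 2 * nrm (F w k) ^+ 2 =
    (nrm (K z w) * `|x z - x w| * nrm (F w k)) ^+ 2.
    by rewrite !exprMn real_normK ?num_real.
  rewrite ler_pXn2r ?nnegrE ?mulr_ge0 ?nrm_ge0//.
  apply: le_trans (Re_le_nrm _) _.
  by rewrite coordZ !nrmM nrmc_conj nrmcR cK mulrC mulrA.
have [mF _] := l2P F.
apply: (@cdot_cs _ _ _ _ _ (fun w => nrm (K z w) * kn w `^ t)).
- by rewrite mulr_gt0// powR_gt0// kn_gt0.
- by move=> w Ww; rewrite mulr_ge0 ?nrm_ge0 ?powR_ge0.
- by move=> w Ww; rewrite mulr_ge0 ?sqr_ge0// mulr_ge0 ?powR_ge0// mulr_ge0 ?sqr_ge0 ?nrm_ge0.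
- by apply: measurable_funM; [exact: measurable_nrmK|exact: measurable_knt].
- apply: measurable_funM; last first.
    exact: measurable_coord2.
  apply: measurable_funM; last exact: measurable_knt.
  apply: measurable_funM; first exact: measurable_nrmK.
  exact: (measurable_diff2 _ bx.1).
- by move=> w Ww; rewrite [toL2 _ w]kervE//; exact: key.
- move=> w Ww; rewrite [toL2 _ w]kervE// scalerA; apply: key => //.
  by rewrite nrmM nrmci mul1r.
- by have [] := schur Wz.
Qed.

Let cw (x : V -> R) F z w := 2 * (C * kn z `^ t) *
  (nrm (K z w) * (x z - x w) ^+ 2 * kn w `^ (- t) * nrm (F w) ^+ 2).

Let cw_ge0 x F z w : 0 <= cw x F z w.
Proof.
rewrite mulr_ge0//; first by rewrite !mulr_ge0 ?powR_ge0// ltW.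
by rewrite mulr_ge0 ?sqr_ge0// mulr_ge0 ?powR_ge0// mulr_ge0 ?sqr_ge0 ?nrm_ge0.
Qed.

Let measurable_cw x F z : measurable_fun (W : set bV) x -> W z ->
  measurable_fun (W : set bV) (cw x F z).
Proof.
move=> mx Wz; apply: measurable_funM; first exact: measurable_cst.
apply: measurable_funM; last exact: measurable_nrm2.
apply: measurable_funM; last exact: measurable_knt.
apply: measurable_funM; first exact: measurable_nrmK.
exact: measurable_diff2.
Qed.

(** The constant of the coordinate bound does not depend on k, so the bounds can be summed under the
    integral sign. *)
Lemma comm_point (x : V -> R) F z : bmfun Sp x -> W z ->
  ((nrm (comm x F z) ^+ 2)%:E <=
   \int[sg]_(w in W) (cw x F z w)%:E)%E.
Proof.
move=> bx Wz; rewrite /cw; have [mF _] := l2P F; have mW := mdom Sp.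
have mH : measurable_fun (W : set bV) (fun w => nrm (K z w) * (x z - x w) ^+ 2 * kn w `^ (- t)).
  apply: measurable_funM; last exact: measurable_knt.
  apply: measurable_funM; first exact: measurable_nrmK.
  exact: (measurable_diff2 _ bx.1).
have H0 w : 0 <= nrm (K z w) * (x z - x w) ^+ 2 * kn w `^ (- t).
  by rewrite mulr_ge0 ?powR_ge0// mulr_ge0 ?sqr_ge0 ?nrm_ge0.
have c0 : 0 <= 2 * (C * kn z `^ t) by rewrite !mulr_ge0 ?powR_ge0// ltW.
have mFk k := measurable_coord2 F k.
under eq_integral do rewrite EFinM.
rewrite ge0_integralZl_EFin//; last 2 first.
- by move=> w _; rewrite lee_fin mulr_ge0// sqr_ge0.
- by apply/measurable_EFinP; apply: measurable_funM => //; exact: measurable_nrm2.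
have -> : (\int[sg]_(w in W) (nrm (K z w) * (x z - x w) ^+ 2 * kn w `^ (- t) * nrm (F w) ^+ 2)%:E =
   \sum_(k <oo) \int[sg]_(w in W) (nrm (K z w) * (x z - x w) ^+ 2 * kn w `^ (- t) * nrm (F w k)
     ^+ 2)%:E)%E.
  rewrite -integral_nneseries//.
  - apply: eq_integral => w _; rewrite EFinM sqnrm_ell2 /sqsum -nneseriesZl.
      by apply: eq_eseriesr => k _; rewrite -EFinM.
    by move=> k _; rewrite lee_fin sqr_ge0.
  - by move=> k; apply/measurable_EFinP; exact: measurable_funM.
  - by move=> k w _; rewrite lee_fin mulr_ge0// sqr_ge0.
rewrite sqnrm_ell2 /sqsum -nneseriesZl; last first.
  by move=> k _; apply: integral_ge0 => w _; rewrite lee_fin mulr_ge0// sqr_ge0.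
apply: lee_nneseries => k _; first by rewrite lee_fin sqr_ge0.
exact: comm_coord.
Qed.

Let cC_ge0 z : 0 <= 2 * (C * kn z `^ t).
Proof. by rewrite !mulr_ge0 ?powR_ge0// ltW. Qed.

Let sum_weight (m : nat) (a k p f S : R) (s : 'I_m -> R) :
  0 <= a -> 0 <= k -> 0 <= p -> 0 <= f -> \sum_(j < m) s j <= S ->
  \sum_(j < m) a * (k * s j * p * f) <= a * (k * S * p * f).
Proof.
move=> a0 k0 p0 f0 sS; rewrite -mulr_sumr ler_wpM2l//.
by rewrite -2!mulr_suml -mulr_sumr ler_wpM2r// ler_wpM2r// ler_wpM2l.
Qed.

(** Majorant of the sum over j of [cw (x j)], once sum_j (x_j(z) - x_j(w))^2 is bounded by c (1 +
    ||K_(phi_z(w))||^delta). *)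
Let G (c : R) F z w := 2 * (C * kn z `^ t) *
  (nrm (K z w) * (c * (1 + kn (inv z w) `^ delta)) * kn w `^ (- t) * nrm (F w) ^+ 2).

Let G_ge0 c F z w : 0 <= c -> 0 <= G c F z w.
Proof.
by move=> c0; rewrite !mulr_ge0 ?powR_ge0 ?nrm_ge0 ?sqr_ge0 ?addr_ge0 ?powR_ge0// ltW.
Qed.

Let measurable_G c F :
  measurable_fun ((W `*` W) : set (bV * bV)) (fun p => G c F p.1 p.2).
Proof.
have mq (r : R) : measurable_fun ((W `*` W) : set (bV * bV)) (fun p => kn (inv p.1 p.2) `^ r).
  by apply: (measurableT_comp (measurable_powR r)); exact: measurable_kn_inv.
have mk1 := @measurable_fstW (fun w => kn w) (@measurable_kn _ _ Sp).
have mk2 := @measurable_sndW (fun w => kn w) (@measurable_kn _ _ Sp).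
have h : measurable_fun ((W `*` W) : set (bV * bV)) (fun p => 2 * (C * kn p.1 `^ t) *
   ((kn p.1 * kn p.2 * kn (inv p.1 p.2) `^ (-1)) * (c * (1 + kn (inv p.1 p.2) `^ delta)) *
 kn p.2 `^ (- t) * nrm (F p.2) ^+ 2)).
  apply: measurable_funM.
    apply: measurable_funM => //; apply: measurable_funM => //.
    exact: (measurable_fstW (measurable_knt t)).
  apply: measurable_funM; last exact: (measurable_sndW (measurable_nrm2 F)).
  apply: measurable_funM; last exact: (measurable_sndW (measurable_knt _)).
  apply: measurable_funM; last by apply: measurable_funM => //; exact: measurable_funD.
  apply: measurable_funM; last exact: mq.
  by apply: measurable_funM; [exact: mk1|exact: mk2].
apply: eq_measurable_fun h => -[z w] /set_mem[/= Wz Ww].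
by rewrite /G/= nrmKV.
Qed.

Let measurable_G' c F :
  measurable_fun ((W `*` W) : set (bV * bV)) (fun p => G c F p.2 p.1).
Proof.
have mWW : measurable ((W `*` W) : set (bV * bV)) by apply: measurableX; exact: mdom.
have msw : measurable_fun ((W `*` W) : set (bV * bV)) (fun p : bV * bV => (p.2, p.1)).
  by apply: measurable_funTS; apply: measurable_swap.
apply: (measurable_comp mWW _ (measurable_G c F) msw).
by move=> _ [[z w] [Wz Ww] <-].
Qed.

(** Both |K_z(w)| and ||K_(phi_z(w))|| are symmetric, so the Schur bounds also hold for integration
    in [z]; the resulting ||K_w||^t cancels the weight ||K_w||^(-t). *)
Let integral_G c F w : 0 <= c -> W w ->
  (\int[sg]_(z in W) (G c F z w)%:E <= (c * (2 * C) ^+ 2)%:E * (nrm (F w) ^+ 2)%:E)%E.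
Proof.
clear cw_ge0 G_ge0 cC_ge0 sum_weight; move=> c0 Ww; have mW := mdom Sp.
have E z : W z -> G c F z w = 2 * C * c * kn w `^ (- t) * nrm (F w) ^+ 2 *
   (nrm (K w z) * kn z `^ t + nrm (K w z) * kn (inv w z) `^ delta * kn z `^ t).
  move=> Wz; rewrite /G (KC Wz Ww) nrmc_conj (kn_inv_sym Wz Ww).
  move: (nrm (K w z)) (kn (inv w z) `^ delta) (kn z `^ t) (kn w `^ (- t)) (nrm (F w)).
  by clear; move=> *; ring.
have c1 : 0 <= 2 * C * c * kn w `^ (- t) * nrm (F w) ^+ 2.
  by rewrite !mulr_ge0 ?powR_ge0 ?nrm_ge0// ltW.
have m1 : measurable_fun (W : set bV) (fun z => nrm (K w z) * kn z `^ t).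
  by apply: measurable_funM; [exact: measurable_nrmK|exact: measurable_knt].
have m2 : measurable_fun (W : set bV)
    (fun z => nrm (K w z) * kn (inv w z) `^ delta * kn z `^ t).
  apply: measurable_funM; last exact: measurable_knt.
  apply: measurable_funM; first exact: measurable_nrmK.
  by apply: measurable_powRW; exact: measurable_q.
have p1 z : 0 <= nrm (K w z) * kn z `^ t by rewrite mulr_ge0 ?nrm_ge0 ?powR_ge0.
have p2 z : 0 <= nrm (K w z) * kn (inv w z) `^ delta * kn z `^ t.
  by rewrite !mulr_ge0 ?nrm_ge0 ?powR_ge0.
under eq_integral => z /set_mem Wz do rewrite E// EFinM.
rewrite ge0_integralZl_EFin//; last 2 first.
- by move=> z _; rewrite lee_fin addr_ge0.
- by apply/measurable_EFinP; exact: measurable_funD.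
under eq_integral do rewrite EFinD.
rewrite ge0_integralD//; last 4 first.
- by move=> z _; rewrite lee_fin.
- exact/measurable_EFinP.
- by move=> z _; rewrite lee_fin.
- exact/measurable_EFinP.
have [s1 s2] := schur Ww.
apply: le_trans (lee_wpmul2l _ (leeD s1 s2)) _; first by rewrite lee_fin.
rewrite -EFinD -!EFinM lee_fin.
have E2 a b f : 2 * C * c * a * f * (C * b + C * b) = a * b * (c * (2 * C) ^+ 2 * f).
  by ring.
rewrite E2 -powRD; last by rewrite (nd Ww) implybT.
by rewrite addNr powRr0 mul1r.
Qed.

(* Schur test with weight kn ^ t, applied to the kernel K z w * (x z - x w) of
   the commutator. *)
Let schur_comm (m : nat) (x : nat -> V -> R) (c : R) F :
  (forall j, bmfun Sp (x j)) -> 0 <= c ->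
  (forall z w, W z -> W w ->
    \sum_(j < m) (x j z - x j w) ^+ 2 <= c * (1 + kn (inv z w) `^ delta)) ->
  \sum_(j < m) nrmL2 (comm (x j) F) ^+ 2 <= c * (2 * C) ^+ 2 * nrmL2 F ^+ 2.
Proof.
move=> bx c0 /inhabits xc; have mW := mdom Sp.
have [mGz GE] := tonelli_dom (fun z w _ _ => G_ge0 F z w c0) (measurable_G c F).
have [mGw _] := tonelli_dom (fun w z _ _ => G_ge0 F z w c0) (measurable_G' c F).
have step1 : ((\sum_(j < m) nrmL2 (comm (x j) F) ^+ 2)%:E <=
    \int[sg]_(z in W) \int[sg]_(w in W) (G c F z w)%:E)%E.
  have -> : ((\sum_(j < m) nrmL2 (comm (x j) F) ^+ 2)%:E =
      \int[sg]_(z in W) \sum_(j < m) (nrm (comm (x j) F z) ^+ 2)%:E)%E.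
    rewrite ge0_integral_sum; first by rewrite -sumEFin; apply: eq_bigr => j _; exact: nrmL2_sqE.
    - exact: mW.
    - by move=> j; apply/measurable_EFinP; exact: measurable_nrm2.
    - by move=> j z _; rewrite lee_fin sqr_ge0.
  apply: ge0_le_integral.
  - exact: mW.
  - by move=> z _; apply: sume_ge0 => j _; rewrite lee_fin sqr_ge0.
  - by apply: emeasurable_sum => j; apply/measurable_EFinP; exact: measurable_nrm2.
  - exact: mGz.
  move=> z Wz.
  apply: (@le_trans _ _ (\sum_(j < m) \int[sg]_(w in W) (cw (x j) F z w)%:E))%E.
    by apply: lee_sum => j _; exact: comm_point.
  have mI j := measurable_cw F (bx j).1 Wz.
  have I0 j w : 0 <= cw (x j) F z w := cw_ge0 _ _ _ _.
  rewrite -(@ge0_integral_sum _ _ _ sg W mW _ (fun (j : 'I_m) w => (cw (x j) F z w)%:E));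
    last 2 first.
  - by move=> j; apply/measurable_EFinP; exact: mI.
  - by move=> j w _; rewrite lee_fin; exact: I0.
  apply: ge0_le_integral.
  - exact: mW.
  - by move=> w _; apply: sume_ge0 => j _; rewrite lee_fin; exact: I0.
  - by apply: emeasurable_sum => j; apply/measurable_EFinP; exact: mI.
  - apply/measurable_EFinP.
    apply: measurable_funM; first exact: measurable_cst.
    apply: measurable_funM; last exact: measurable_nrm2.
    apply: measurable_funM; last exact: measurable_knt.
    apply: measurable_funM; first exact: measurable_nrmK.
    apply: measurable_funM; first exact: measurable_cst.
    apply: measurable_funD; first exact: measurable_cst.
    by apply: measurable_powRW; exact: measurable_q.
  move=> w Ww; rewrite sumEFin lee_fin; case: xc => xc.
  exact: (sum_weight (cC_ge0 z) (nrm_ge0 _) (powR_ge0 _ _) (sqr_ge0 _) (xc z w Wz Ww)).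
have step2 : (\int[sg]_(w in W) \int[sg]_(z in W) (G c F z w)%:E <=
   \int[sg]_(w in W) ((c * (2 * C) ^+ 2)%:E * (nrm (F w) ^+ 2)%:E))%E.
  apply: ge0_le_integral.
  - exact: mW.
  - by move=> w _; apply: integral_ge0 => z _; rewrite lee_fin; exact: G_ge0.
  - exact: mGw.
  - apply/measurable_EFinP; apply: measurable_funM; first exact: measurable_cst.
    exact: measurable_nrm2.
  - by move=> w Ww; exact: integral_G.
rewrite -lee_fin; apply: le_trans step1 _; rewrite GE; apply: le_trans step2 _.
rewrite ge0_integralZl_EFin.
- by rewrite [X in (_ <= X)%E]EFinM nrmL2_sqE.
- exact: mW.
- by move=> w _; rewrite lee_fin sqr_ge0.
- by apply/measurable_EFinP; exact: measurable_nrm2.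
- exact: mulr_ge0 c0 (sqr_ge0 _).
Qed.

Lemma schur_commutator (m : nat) (x : nat -> V -> R) (c : R) F :
  (forall j, bmfun Sp (x j)) -> 0 <= c ->
  (forall z w, W z -> W w ->
    \sum_(j < m) (x j z - x j w) ^+ 2 <= c * (1 + kn (inv z w) `^ delta)) ->
  \sum_(j < m) nrmL2 (mulx (x j) (toL2 (proj F)) - toL2 (proj (mulx (x j) F))) ^+ 2 <=
    c * (2 * C) ^+ 2 * nrmL2 F ^+ 2.
Proof. exact: schur_comm. Qed.

End schur_commutator.

(** * Bounded overlap and cutoff functions *)

Section cutoffs.
Variables (R : realType) (n : nat) (Sp : bergman_space R n).
Local Notation V := 'rV[R[i]]_n.+1.
Local Notation bV := (borelC R n).
Local Notation W := (dom Sp).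
Local Notation sg := (sigma Sp).
Local Notation K := (ker Sp).
Local Notation kn := (knrm W sg K).
Local Notation inv := (invol Sp).
Local Notation d := (mdis Sp).
Implicit Types (z w u v : V).
Hypothesis nd : forall z, W z -> kn z != 0.

(** |K_z(0)| = 1 by (A.5), and it is at most ||K_z|| ||K_0|| = ||K_z||. *)
Lemma kn_ge1 z : W z -> 1 <= kn z.
Proof.
move=> Wz; have W0 := @dom0 _ _ Sp.
have := nrm_coord_le (kerv Sp z 0) 0 W0.
rewrite kerv_coord// nrmK// invol0// (kn_0 nd) !mulr1 divff ?nd//.
by rewrite nrm_toL2 nrmL2_kerv.
Qed.

Definition mball z (r : R) : set V := [set w : V | W w /\ d z w < r].

Lemma measurable_mball z r : W z -> measurable (mball z r : set bV).
Proof. exact: measurable_ballW. Qed.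

Lemma ball_image z r : W z ->
  inv z @` (mball 0 r) = (mball z r).
Proof.
move=> Wz; have W0 := @dom0 _ _ Sp.
rewrite /mball; apply/seteqP; split=> [_ [w [Ww wr] <-]|w [Ww wr]] /=.
  by split; [exact: invol_dom|rewrite -d_inv// inv_z].
exists (inv z w); last exact: involK.
by split; [exact: invol_dom|rewrite -d_inv// invol0].
Qed.

Lemma lam_ball z r : W z ->
  lambda W sg K (mball z r) = lambda W sg K (mball 0 r).
Proof.
move=> Wz; rewrite -ball_image// -lambda_invol//.
  by apply: measurable_mball; exact: dom0.
by move=> w [].
Qed.

Lemma lam_ball_fin r : (lambda W sg K (mball 0 r) < +oo)%E.
Proof.
have W0 := @dom0 _ _ Sp; have mD := measurable_mball r W0.
have [M MP] := kn_bounded Sp r.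
apply: (@le_lt_trans _ _ (\int[sg]_(z in (mball 0 r)) (M ^+ 2)%:E)%E).
  apply: ge0_le_integral.
  - exact: mD.
  - by move=> z _; rewrite lee_fin sqr_ge0.
  - apply/measurable_EFinP; apply: measurable_funX.
    by apply: measurable_funS (@measurable_kn _ _ Sp); [exact: mdom|move=> w []].
  - exact: measurable_cst.
  move=> z [Wz zr]; rewrite lee_fin ler_pXn2r ?nnegrE ?kn_ge0//.
    exact: MP (ltW zr).
  by apply: le_trans (kn_ge0 _ z) _; exact: MP (ltW zr).
rewrite integral_cst; last exact: mD.
rewrite lte_mul_pinfty ?lee_fin ?sqr_ge0//.
by rewrite ltey_eq fin_num_measure.
Qed.

(** Otherwise all balls of radius r are null for lambda, hence for sigma because [kn] is at least 1.
    Countably many of them cover [W], so sigma vanishes on [W], contradicting ||K_0|| = 1. *)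
Lemma lam_ball_gt0 r : 0 < r -> (0 < lambda W sg K (mball 0 r))%E.
Proof.
move=> r0; have W0 := @dom0 _ _ Sp.
rewrite lt_neqAle integral_ge0 ?andbT; last by move=> z _; rewrite lee_fin sqr_ge0.
apply/eqP => l0.
have [a [Wa aP]] := d_sep Sp.
have s0 i : sg (mball (a i) r) = 0%E.
  apply/eqP; rewrite eq_le measure_ge0 andbT.
  rewrite [X in (_ <= X)%E]l0 -(lam_ball r (Wa i)).
  have mD := measurable_mball r (Wa i).
  rewrite -[leLHS]mul1e -integral_cst; last exact: mD.
  apply: ge0_le_integral.
  - exact: mD.
  - by [].
  - exact: measurable_cst.
  - apply/measurable_EFinP; apply: measurable_funX.
    by apply: measurable_funS (@measurable_kn _ _ Sp); [exact: mdom|move=> w []].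
  - by move=> z [Wz _]; rewrite lee_fin expr_ge1 ?kn_ge1// kn_ge0.
have sW : sg W = 0%E.
  apply: measure_negligible; first exact: mdom.
  have h : sg.-negligible (\bigcup_i (mball (a i) r : set bV)).
    apply: negligible_bigcup => i; apply/negligibleP; last exact: s0.
    exact: measurable_mball.
  apply: negligibleS h => w Ww; have [i wi] := aP w r Ww r0.
  by exists i => //; split; rewrite 1?d_sym.
have := kn_0 nd; rewrite -(nrmL2_kerv 0 W0) /nrmL2 rdotFF /sqint null_set_integral.
- by rewrite sqrtr0 => /esym/eqP; rewrite oner_eq0.
- exact: mdom.
- by apply/measurable_EFinP; exact: measurable_nrm2.
- exact: sW.
Qed.

(** The balls of radius r / 2 around the [a i] are disjoint, lie in the ball of radius 4 r around
    [z], and all balls of the same radius have the same measure. Three doublings lead from r / 2 to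
    4 r, whence a bound C^3 independent of r. *)
Lemma packing : exists2 N : R, 0 < N & forall (r : R) (a : nat -> V) (s : seq nat) z,
  0 < r -> W z -> (forall i, W (a i)) -> uniq s ->
  (forall i, i \in s -> d (a i) z < 3 * r) ->
  (forall i j, i \in s -> j \in s -> i != j -> r <= d (a i) (a j)) ->
  (size s)%:R <= N.
Proof.
have W0 := @dom0 _ _ Sp.
have [C C1 dbl] := lambda_doubling Sp.
have C0 : 0 < C by exact: lt_trans C1.
exists (C ^+ 3); first by rewrite exprn_gt0.
move=> r a s z r0 Wz Wa us sz sep.
pose v (t : R) := fine (lambda W sg K (mball 0 t)).
have vE t : lambda W sg K (mball 0 t) = (v t)%:E.
  rewrite /v fineK// ge0_fin_numE ?lam_ball_fin//.
  by apply: integral_ge0 => w _; rewrite lee_fin sqr_ge0.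
have v2 t : 0 < t -> v (2 * t) <= C * v t.
  by move=> t0; rewrite -lee_fin EFinM -!vE; exact: (dbl 0 t W0 t0).
have r2 : 0 < r / 2 by rewrite divr_gt0.
have v8 : v (4 * r) <= C ^+ 3 * v (r / 2).
  have -> : 4 * r = 2 * (2 * (2 * (r / 2))) by field.
  apply: le_trans (v2 _ _) _; first by rewrite !mulr_gt0.
  rewrite !exprS expr0 mulr1 -!mulrA ler_wpM2l ?(ltW C0)//.
  apply: le_trans (v2 _ _) _; first by rewrite !mulr_gt0.
  by rewrite ler_wpM2l ?(ltW C0)// v2.
have vp : 0 < v (r / 2) by rewrite -lte_fin -vE lam_ball_gt0.
rewrite -(ler_pM2r vp); apply: le_trans v8.
rewrite -lee_fin -vE -(lam_ball _ Wz).
pose F i := mball (a i) (r / 2).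
have mF i : measurable (F i : set bV) by exact: measurable_mball.
have tF : trivIset [set` s] F.
  apply/trivIsetP => i j si sj ij; apply/seteqP; split => // w [[Ww wi] [_ wj]].
  have := sep _ _ si sj ij; have := d_tri (Wa i) Ww (Wa j).
  rewrite (d_sym Ww (Wa j)); move: (d (a i) (a j)) wi wj.
  by move: (d (a i) w) (d (a j) w) => x y t; lra.
have mkE (A : set bV) : A `<=` W -> measurable_fun A (fun w => (kn w ^+ 2)%:E).
  move=> AW; apply/measurable_EFinP; apply: measurable_funX.
  by apply: measurable_funS (@measurable_kn _ _ Sp); [exact: mdom|].
have FW : \big[setU/set0]_(i <- s) F i `<=` W.
  by rewrite -bigcup_seq => w [i _ []].
have := @ge0_integral_bigsetU _ _ _ sg _ F (fun w => (kn w ^+ 2)%:E) s mF us tF (mkE _ FW).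
have f0 w : (\big[setU/set0]_(i <- s) F i) w -> (0 <= (kn w ^+ 2)%:E)%E.
  by rewrite lee_fin sqr_ge0.
move=> /(_ f0) E.
have -> : ((size s)%:R * v (r / 2))%:E = (\sum_(i <- s) \int[sg]_(w in F i) (kn w ^+ 2)%:E)%E.
  rewrite (eq_bigr (fun=> (v (r / 2))%:E)).
    by rewrite sumEFin big_const_seq count_predT iter_addr_0 mulr_natl.
  by move=> i _; rewrite -vE -(lam_ball _ (Wa i)).
rewrite -E; apply: ge0_subset_integral.
- by apply: bigsetU_measurable => i _; exact: mF.
- exact: measurable_mball.
- by apply: mkE => w [].
- by move=> w _; rewrite lee_fin sqr_ge0.
move=> w; rewrite -bigcup_seq => -[i /= si [Ww wi]]; split => //.
have := d_tri Wz (Wa i) Ww; rewrite (d_sym Wz (Wa i)); have := sz i si.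
move: (d (a i) z) (d (a i) w) (d z w) wi r0 => *; lra.
Qed.

(** * Cutoff functions on a maximal separated set *)

Section greedy.
Variables (a : nat -> V) (r : R).
Hypotheses (Wa : forall i, W (a i)) (r0 : 0 < r)
  (aP : forall w (e : R), W w -> 0 < e -> exists i, d w (a i) < e).

(* Greedy choice of a maximal r-separated subset of {a 0, ..., a (j - 1)}. *)
Fixpoint greedy (j : nat) : seq nat :=
  if j is i.+1 then
    if all (fun k => r <= d (a k) (a i)) (greedy i) then i :: greedy i else greedy i
  else [::].

Lemma greedy_lt j i : i \in greedy j -> (i < j)%N.
Proof.
elim: j => //= j IH; case: ifP => _; rewrite ?inE.
  by case/orP => [/eqP ->//|/IH /ltnW].
by move/IH => /ltnW.
Qed.

Lemma greedy_sep j i k : i \in greedy j -> k \in greedy j -> i != k -> r <= d (a i) (a k).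
Proof.
elim: j => //= j IH; case: ifP => [/allP h|_]; last exact: IH.
rewrite !inE => /orP[/eqP ->|ij] /orP[/eqP ->|kj] ik.
- by rewrite eqxx in ik.
- by rewrite d_sym// h.
- exact: h.
- exact: IH.
Qed.

Lemma greedy_max j : exists2 i, i \in greedy j.+1 & d (a i) (a j) < r.
Proof.
rewrite /=; case: ifP => [_|/negbT/allPn[i ij]].
  by exists j; rewrite ?inE ?eqxx// d_xx.
by rewrite -ltNge => h; exists i.
Qed.

Lemma greedy_mono j m : (j <= m)%N -> {subset greedy j <= greedy m}.
Proof.
elim: m => [|m IH]; first by rewrite leqn0 => /eqP ->.
rewrite leq_eqVlt => /orP[/eqP ->//|jm] i ij /=.
have im := IH jm i ij; by case: ifP => // _; rewrite inE im orbT.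
Qed.

Lemma greedy_mem j m : (j < m)%N -> (j \in greedy m) = (j \in greedy j.+1).
Proof.
move=> jm; apply/idP/idP; last exact: (greedy_mono jm).
elim: m jm => // m IH; rewrite ltnS leq_eqVlt => /orP[/eqP ->//|jm] /=.
case: ifP => _; last exact: IH.
by rewrite inE ltn_eqF//=; exact: IH.
Qed.

(** For a selected j, at least 1 on the ball of radius 2 r around a_j, 0 outside the ball of radius
    3 r, and Lipschitz with constant 1 / r. The other indices carry the function 0, so that the
    family stays indexed by nat. *)
Definition hat (j : nat) z : R :=
  if j \in greedy j.+1 then Num.max 0 (3 - d (a j) z / r) else 0.

Lemma hat_ge0 j z : 0 <= hat j z.
Proof. by rewrite /hat; case: ifP => // _; rewrite le_max lexx. Qed.

Lemma hat_le3 j z : W z -> hat j z <= 3.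
Proof.
move=> Wz; rewrite /hat; case: ifP => // _; rewrite ge_max ler0n/=.
by rewrite gerBl divr_ge0 ?d_ge0// ltW.
Qed.

Lemma hat_supp j z : 3 * r <= d (a j) z -> hat j z = 0.
Proof.
move=> h; rewrite /hat; case: ifP => // _; apply/max_idPl.
by rewrite subr_le0 ler_pdivlMr.
Qed.

Lemma hat_lip j z w : W z -> W w -> `|hat j z - hat j w| <= d z w / r.
Proof.
move=> Wz Ww; have dr : 0 <= d z w / r by rewrite divr_ge0 ?d_ge0// ltW.
rewrite /hat; case: ifP => _; last by rewrite subrr normr0.
have h1 : d (a j) z / r <= d (a j) w / r + d z w / r.
  by rewrite -mulrDl ler_wpM2r ?invr_ge0 ?(ltW r0)// (d_sym Wz Ww) d_tri.
have h2 : d (a j) w / r <= d (a j) z / r + d z w / r.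
  by rewrite -mulrDl ler_wpM2r ?invr_ge0 ?(ltW r0)// d_tri.
move: (d (a j) z / r) (d (a j) w / r) (d z w / r) h1 h2 dr => x y t h1 h2 t0.
by rewrite ler_norml !maxEle; do 2 case: ifP => ?; apply/andP; split; lra.
Qed.

Lemma measurable_hat j : measurable_fun (W : set bV) (hat j).
Proof.
apply: measurable_mcont => w Ww e e0; exists (e * r); first by rewrite mulr_gt0.
move=> w' Ww' h; apply: le_lt_trans (hat_lip j Ww Ww') _.
by rewrite ltr_pdivrMr.
Qed.

(** [z] is within r of some a_j, and a_j within r of a selected a_i: hence the radius 2 r inside
    which a hat is at least 1. *)
Lemma hat_cover z : W z -> exists m0, forall m, (m0 <= m)%N -> 1 <= \sum_(j < m) hat j z ^+ 2.
Proof.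
move=> Wz; have [j zj] := aP Wz r0; have [i ij dij] := greedy_max j.
exists j.+1 => m jm; have im : (i < m)%N by apply: leq_trans jm; exact: greedy_lt ij.
rewrite (bigD1 (Ordinal im))//= -[leLHS]addr0 lerD//; last first.
  by rewrite sumr_ge0// => k _; rewrite sqr_ge0.
rewrite expr_ge1 ?hat_ge0// /hat -(greedy_mem (greedy_lt ij)) ij.
rewrite le_max; apply/orP; right.
have h : d (a i) z < 2 * r.
  by have := d_tri (Wa i) (Wa j) Wz; rewrite (d_sym (Wa j) Wz);
    move: (d (a i) z) (d (a i) (a j)) (d z (a j)) zj dij => *; lra.
have : d (a i) z / r <= 2 by rewrite ler_pdivrMr// ltW.
by move: (d (a i) z / r) => *; lra.
Qed.

Variable N : R.
Hypothesis packN : forall (s : seq nat) z, W z -> uniq s ->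
  (forall i, i \in s -> d (a i) z < 3 * r) ->
  (forall i j, i \in s -> j \in s -> i != j -> r <= d (a i) (a j)) ->
  (size s)%:R <= N.

Lemma hat_count m z : W z ->
  \sum_(j < m) (hat j z != 0)%:R <= N.
Proof.
move=> Wz; pose s := [seq j <- iota 0 m | hat j z != 0].
have sg1 i : i \in s -> (i \in greedy m) && (d (a i) z < 3 * r).
  rewrite mem_filter mem_iota/= add0n => /andP[h im].
  rewrite greedy_mem//; apply/andP; split.
    by move: h; rewrite /hat; case: ifP => //; rewrite eqxx.
  by rewrite ltNge; apply: contra h => h; rewrite hat_supp.
apply: le_trans (packN (s := s) Wz _ _ _).
- rewrite -(big_mkord xpredT (fun j => (hat j z != 0)%:R)) /= size_filter.
  rewrite -sum1_count natr_sum /index_iota subn0 [leRHS]big_mkcond/=.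
  by apply: ler_sum => j _; case: ifP.
- by rewrite filter_uniq// iota_uniq.
- by move=> i /sg1/andP[].
- by move=> i j /sg1/andP[ig _] /sg1/andP[jg _]; exact: greedy_sep ig jg.
Qed.

Lemma hat_sum m z : W z -> \sum_(j < m) hat j z ^+ 2 <= 9 * N.
Proof.
move=> Wz; apply: le_trans (_ : _ <= \sum_(j < m) 9 * (hat j z != 0)%:R) _.
  apply: ler_sum => j _; case: eqP => [->|_]; first by rewrite expr0n mulr0.
  rewrite mulr1; have := hat_le3 j Wz; have := hat_ge0 j z.
  by move: (hat j z) => x x0 x3; nra.
by rewrite -mulr_sumr ler_wpM2l// hat_count.
Qed.

(** Only indices whose hat is nonzero at [z] or at [w] contribute, and there are at most [N] of them
    for each of the two points. *)
Lemma hat_diff m z w (e : R) : W z -> W w -> 0 <= e ->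
  (forall j, `|hat j z - hat j w| <= e) ->
  \sum_(j < m) (hat j z - hat j w) ^+ 2 <= 2 * N * e ^+ 2.
Proof.
move=> Wz Ww e0 he.
apply: le_trans (_ : _ <= \sum_(j < m)
  ((hat j z != 0)%:R + (hat j w != 0)%:R) * e ^+ 2) _.
  apply: ler_sum => j _.
  have h : (hat j z - hat j w) ^+ 2 <= e ^+ 2.
    by rewrite -real_normK ?num_real// ler_pXn2r ?nnegrE.
  case: (eqVneq (hat j z) 0) => z0; case: (eqVneq (hat j w) 0) => w0 /=.
  - by rewrite z0 w0 subrr expr0n/= addr0 mul0r.
  - by rewrite add0r mul1r.
  - by rewrite addr0 mul1r.
  - by apply: le_trans h _; rewrite ler_peMl ?sqr_ge0// lerDl.
rewrite -mulr_suml ler_wpM2r ?sqr_ge0// big_split/=.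
by have := hat_count m Wz; have := hat_count m Ww; move: (\sum_(j < m) _) (\sum_(j < m) _) => *;
  lra.
Qed.

End greedy.

End cutoffs.

(** * Translations *)

Section change_of_variables.
Variables (R : realType) (n : nat) (Sp : bergman_space R n).
Local Notation V := 'rV[R[i]]_n.+1.
Local Notation bV := (borelC R n).
Local Notation W := (dom Sp).
Local Notation sg := (sigma Sp).
Local Notation K := (ker Sp).
Local Notation kn := (knrm W sg K).
Local Notation inv := (invol Sp).
Implicit Types (z w u v y : V).

(** phi_y is holomorphic, hence continuous for the topology that generates the Borel sets. *)
Lemma measurable_inv y : W y ->
  measurable_fun (W : set bV) (inv y : bV -> bV).
Proof.
move=> Wy.
apply: (@measurability _ _ bV bV W (inv y) [set A : set V | open A]) => //.
move=> _ [A oA <-]; apply: sub_sigma_algebra => /=.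
rewrite openE => w [Ww Aw]; rewrite /interior.
apply: filterI; first exact: (open_nbhs_nbhs (conj (@dom_open _ _ Sp) Ww)).
have := differentiable_continuous (invol_holo Wy Ww); apply.
exact: open_nbhs_nbhs.
Qed.

Lemma measurable_comp_inv y (p : V -> R) : W y -> measurable_fun (W : set bV) p ->
  measurable_fun (W : set bV) (fun w => p (inv y w)).
Proof.
move=> Wy mp; apply: (measurable_comp (mdom Sp) _ mp (measurable_inv Wy)).
by move=> _ [w Ww <-]; exact: invol_dom.
Qed.

Let measurable_kn2 : measurable_fun (W : set bV) (fun w => kn w ^+ 2).
Proof. by apply: measurable_funX; exact: measurable_kn. Qed.

(** The invariance of lambda: images under an involution of [W] are preimages. *)
Lemma cov_indic y (A : set bV) : W y -> measurable A ->
  (\int[sg]_(w in W) (\1_A (inv y w) * kn w ^+ 2)%:E =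
   \int[sg]_(w in W) (\1_A w * kn w ^+ 2)%:E)%E.
Proof.
move=> Wy mA; have mW := mdom Sp.
have E (C : set bV) : measurable C -> (\int[sg]_(w in W) (\1_C w * kn w ^+ 2)%:E =
    lambda W sg K (W `&` C))%E.
  move=> mC; rewrite /lambda [RHS]integral_mkcondr; apply: eq_integral => w Ww.
  rewrite patchE indicE; case: ifPn => wC; first by rewrite mul1r.
  by rewrite mul0r.
rewrite (E A mA).
have mWA : measurable (W `&` A : set bV) by exact: measurableI.
have WAW : W `&` A `<=` W by move=> w [].
rewrite (lambda_invol Wy mWA WAW).
have -> : inv y @` (W `&` A) = W `&` ((inv y) @^-1` A).
  apply/seteqP; split=> [_ [w [Ww Aw] <-]|w [Ww Aw]].
    by split; [exact: invol_dom|rewrite /= involK].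
  exists (inv y w); last exact: involK.
  by split; [exact: invol_dom|].
have mC : measurable (W `&` ((inv y) @^-1` A) : set bV) by exact: measurable_inv.
rewrite (_ : W `&` (inv y) @^-1` A = W `&` (W `&` (inv y) @^-1` A)); last first.
  by rewrite setIA setIid.
rewrite -(E _ mC); apply: eq_integral => w /set_mem Ww.
congr ((_ * _)%:E); rewrite !indicE; congr ((nat_of_bool _)%:R).
by apply/idP/idP => [/set_mem h|/set_mem [_ h]]; apply/mem_set.
Qed.

Import HBNNSimple.

Lemma cov_nnsfun y (g : {nnsfun bV >-> R}) : W y ->
  (\int[sg]_(w in W) (g (inv y w) * kn w ^+ 2)%:E =
   \int[sg]_(w in W) (g w * kn w ^+ 2)%:E)%E.
Proof.
move=> Wy; have mW := mdom Sp.
have fr : finite_set (range g) by exact: fimfunP.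
(* The values [r] of g are nonnegative anyway; the maximum makes the coefficients nonnegative for
   every real [r], as termwise integration asks. *)
have gE v : g v = \sum_(r \in range g) (Num.max r 0 * \1_(g @^-1` [set r]) v).
  rewrite {1}(fimfunE g v); apply: eq_fsbigr => r /set_mem [v' _ <-].
  by congr (_ * _); apply/esym/max_idPl.
have E (f : V -> V) : (forall w, W w -> W (f w)) ->
   (forall (p : V -> R), measurable_fun (W : set bV) p ->
     measurable_fun (W : set bV) (fun w => p (f w))) ->
   (\int[sg]_(w in W) (g (f w) * kn w ^+ 2)%:E =
   \sum_(r \in range g) ((Num.max r 0)%:E *
     \int[sg]_(w in W) (\1_(g @^-1` [set r]) (f w) * kn w ^+ 2)%:E))%E.
  move=> fW mf.
  have mi r : measurable_fun (W : set bV)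
      (fun w => \1_(g @^-1` [set r]) (f w) * kn w ^+ 2 : R).
    apply: measurable_funM; last exact: measurable_kn2.
    apply: mf; apply: measurable_funTS; apply: measurable_indic.
    by apply: measurable_funPTI.
  have i0 r w : (0 <= (\1_(g @^-1` [set r]) (f w) * kn w ^+ 2)%:E)%E.
    by rewrite lee_fin mulr_ge0 ?sqr_ge0// indicE.
  have m0 r : 0 <= Num.max r 0 :> R by rewrite le_max lexx orbT.
  transitivity (\int[sg]_(w in W) \sum_(r \in range g) ((Num.max r 0)%:E *
     (\1_(g @^-1` [set r]) (f w) * kn w ^+ 2)%:E))%E.
    apply: eq_integral => w _; rewrite gE mulr_fsuml// -fsumEFin//.
    by apply: eq_fsbigr => r _; rewrite -EFinM -mulrA.
  rewrite ge0_integral_fsum//.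
  - apply: eq_fsbigr => r _; rewrite ge0_integralZl_EFin//.
    by apply/measurable_EFinP; exact: mi.
  - by move=> r; apply/measurable_EFinP; apply: measurable_funM => //; exact: mi.
  - by move=> r w _; apply: mule_ge0; [rewrite lee_fin|exact: i0].
rewrite (E (inv y)); last 2 first.
- by move=> w; exact: invol_dom.
- by move=> p; exact: measurable_comp_inv.
rewrite (E id)//; apply: eq_fsbigr => r _; congr (_ * _)%E.
by apply: cov_indic => //; exact: measurable_funPTI.
Qed.

Lemma change_of_variables y (p : V -> R) : W y -> measurable_fun (W : set bV) p ->
  (forall w, W w -> 0 <= p w) ->
  (\int[sg]_(w in W) (p (inv y w) * kn w ^+ 2)%:E =
   \int[sg]_(w in W) (p w * kn w ^+ 2)%:E)%E.
Proof.
move=> Wy mp p0; have mW := mdom Sp.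
have mpE : measurable_fun (W : set bV) (EFin \o p) by apply/measurable_EFinP.
pose g := nnsfun_approx mW mpE.
(* One limit formula for both sides, with [f] equal to phi_y or to the identity. *)
have E (f : V -> V) : (forall w, W w -> W (f w)) ->
   (forall (q : V -> R), measurable_fun (W : set bV) q ->
     measurable_fun (W : set bV) (fun w => q (f w))) ->
   (\int[sg]_(w in W) (p (f w) * kn w ^+ 2)%:E =
    limn (fun m => \int[sg]_(w in W) (g m (f w) * kn w ^+ 2)%:E))%E.
  move=> fW mf.
  rewrite -monotone_convergence//.
  - apply: eq_integral => w /set_mem Ww; apply/esym/cvg_lim => //.
    have h := cvg_nnsfun_approx mW mpE (fun t Dt => p0 t Dt) (fW w Ww).
    have := cvgeZr (_ : (kn w ^+ 2)%:E \is a fin_num) h.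
    by move=> /(_ isT); under eq_fun do rewrite /= -EFinM.
  - move=> m; apply/measurable_EFinP; apply: measurable_funM; last exact: measurable_kn2.
    by apply: mf; exact: measurable_funTS.
  - by move=> m w _; rewrite lee_fin mulr_ge0 ?sqr_ge0.
  - move=> w _ a b ab; rewrite lee_fin ler_wpM2r ?sqr_ge0//.
    by have /lefP := nd_nnsfun_approx mW mpE ab; exact.
rewrite (E (inv y)); last 2 first.
- by move=> w; exact: invol_dom.
- by move=> q; exact: measurable_comp_inv.
rewrite (E id)//; congr (limn _); apply/funext => m; exact: cov_nnsfun.
Qed.

End change_of_variables.

(** * Translations are unitary and tend weakly to 0 *)

Section translations.
Variables (R : realType) (n : nat) (Sp : bergman_space R n).
Local Notation V := 'rV[R[i]]_n.+1.
Local Notation bV := (borelC R n).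
Local Notation W := (dom Sp).
Local Notation sg := (sigma Sp).
Local Notation K := (ker Sp).
Local Notation kn := (knrm W sg K).
Local Notation inv := (invol Sp).
Local Notation d := (mdis Sp).
Local Notation ku := (kunit W sg K).
Local Notation L2 := (L2 Sp).
Local Notation B := (bergman Sp).
Implicit Types (z w u v y : V) (f g h : B) (F G : L2).
Hypothesis nd : forall z, W z -> kn z != 0.

Lemma nrm_ku y w : W y -> W w -> nrm (ku y w) = kn w / kn (inv y w).
Proof.
move=> Wy Ww; rewrite /kunit nrmM nrmcV nrmcR ger0_norm ?kn_ge0// nrmK//.
have := nd Wy; have := nd (invol_dom Wy Ww).
move: (kn y) (kn w) (kn (inv y w)); clear => a b c c0 a0.
by field; rewrite a0 c0.
Qed.

Definition translL2 y F : L2 := L2of Sp (fun w => ku y w *: F (inv y w)).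

Lemma cmeasurable_comp_inv y (f : V -> R[i]) : W y -> cmeasurable W f ->
  cmeasurable W (fun w => f (inv y w)).
Proof.
move=> Wy [m1 m2]; split.
  exact: (@measurable_comp_inv _ _ _ _ (fun z => complex.Re (f z))).
exact: (@measurable_comp_inv _ _ _ _ (fun z => complex.Im (f z))).
Qed.

Lemma cmeasurable_ku y : W y -> cmeasurable W (ku y).
Proof.
move=> Wy; have [_ mK _ _] := ker_sbergman Wy.
exact: (cmeasurableM mK (cmeasurable_cst _ _)).
Qed.

(** Since |k_y(w)| = ||K_w|| / ||K_(phi_y(w))||, the integrand is the function |F|^2 / ||K||^2
    composed with phi_y, times the density ||K_w||^2 of lambda. *)
Lemma translL2_sqint y F : W y ->
  (sqint W sg (fun w => (ku y w *: F (inv y w))%R) = sqint W sg F)%E.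
Proof.
move=> Wy; pose p w := nrm (F w) ^+ 2 * kn w `^ (- 2).
have mp : measurable_fun (W : set bV) p.
  apply: measurable_funM; first exact: measurable_nrm2.
  by apply: measurable_powRW; exact: measurable_kn.
have p0 w : W w -> 0 <= p w by move=> _; rewrite mulr_ge0 ?sqr_ge0 ?powR_ge0.
have pE (w x : V) : W x -> p x = nrm (F x) ^+ 2 / kn x ^+ 2.
  by move=> Wx; rewrite /p powRN powR_mulrn ?kn_ge0.
transitivity (\int[sg]_(w in W) (p (inv y w) * kn w ^+ 2)%:E)%E.
  apply: eq_integral => w /set_mem Ww; congr (_%:E).
  rewrite (pE w); last exact: invol_dom.
  rewrite nrmZ nrm_ku//; have := nd (invol_dom Wy Ww).
  move: (kn (inv y w)) (kn w) (nrm (F (inv y w))); clear => a b c a0.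
  by field.
rewrite change_of_variables//; apply: eq_integral => w /set_mem Ww; congr (_%:E).
by rewrite (pE w)// divfK// expf_neq0// nd.
Qed.

Lemma translL2_l2 y F : W y -> (fun w => ku y w *: F (inv y w)) \in l2_pred Sp.
Proof.
move=> Wy; have [mF qF] := l2P F; apply/asboolP; split.
  move=> k; apply: (cmeasurableM (cmeasurable_ku Wy)).
  exact: (@cmeasurable_comp_inv y (fun z => F z k)).
by rewrite translL2_sqint.
Qed.

Lemma translL2E y F w : W y -> translL2 y F w = ku y w *: F (inv y w).
Proof. by move=> Wy; rewrite /translL2 L2ofE//; exact: translL2_l2. Qed.

Lemma nrmL2_translL2 y F : W y -> nrmL2 (translL2 y F) = nrmL2 F.
Proof.
move=> Wy; rewrite /nrmL2 !rdotFF; congr (Num.sqrt (fine _)).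
rewrite -(translL2_sqint F Wy); apply: eq_integral => w _.
by rewrite (translL2E F w Wy).
Qed.

Lemma translL2D y F G : W y -> translL2 y (F + G) = translL2 y F + translL2 y G.
Proof.
move=> Wy; apply: L2_ext => w.
have E : ku y w *: (F + G) (inv y w) = ku y w *: F (inv y w) + ku y w *: G (inv y w).
  by rewrite -scalerDr.
apply: (etrans (translL2E (F + G) w Wy)); apply: (etrans E); apply: esym.
exact: (f_equal2 +%R (translL2E F w Wy) (translL2E G w Wy)).
Qed.

Lemma translL2Z y (a : R[i]) F : W y -> translL2 y (a *: F) = a *: translL2 y F.
Proof.
move=> Wy; apply: L2_ext => w.
have E : ku y w *: (a *: F) (inv y w) = a *: (ku y w *: F (inv y w)).
  by rewrite (L2EZ a F) !scalerA [in RHS]mulrC.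
apply: (etrans (translL2E (a *: F) w Wy)); apply: (etrans E); apply: esym.
exact: (f_equal ( *:%R a) (translL2E F w Wy)).
Qed.

Lemma rdot_polar F G : rdot F G = 2^-1 * (nrmL2 (F + G) ^+ 2 - nrmL2 F ^+ 2 - nrmL2 G ^+ 2).
Proof.
rewrite (nrmL2_sq (F + G)) (nrmL2_sq F) (nrmL2_sq G) rdotDl rdotDr rdotDr (rdotC G F).
by move: (rdot F F) (rdot F G) (rdot G G) => a b c; field.
Qed.

Lemma rdot_translL2 y F G : W y -> rdot (translL2 y F) (translL2 y G) = rdot F G.
Proof.
move=> Wy; have E1 : nrmL2 (translL2 y F + translL2 y G) = nrmL2 (F + G).
  exact: (etrans (f_equal (@nrmL2 _ _ Sp) (esym (translL2D F G Wy))) (nrmL2_translL2 (F + G) Wy)).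
have E (a b c a' b' c' : R) : a = a' -> b = b' -> c = c' ->
    2^-1 * (a ^+ 2 - b ^+ 2 - c ^+ 2) = 2^-1 * (a' ^+ 2 - b' ^+ 2 - c' ^+ 2).
  by move=> -> -> ->.
apply: (etrans (rdot_polar _ _)); apply: (etrans _ (esym (rdot_polar F G))).
exact: (E _ _ _ _ _ _ E1 (nrmL2_translL2 F Wy) (nrmL2_translL2 G Wy)).
Qed.

Lemma cdot_translL2 y F G : W y -> cdot (translL2 y F) (translL2 y G) = cdot F G.
Proof. move=> Wy; rewrite /cdot (rdot_translL2 F G Wy); congr (_ +i* _)%C.
exact: (etrans (f_equal (rdot (translL2 y F)) (esym (translL2Z 'i%C G Wy))) (rdot_translL2 F
  ('i%C *: G) Wy)). Qed.

Local Notation U := (translation (S := Sp)).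

Lemma translation_vbergman y f : W y ->
  vbergman W sg (fun w => normalized_ker Sp y w *: f (inv y w)).
Proof.
move=> Wy; have [hf mf qf f0] := bergmanP f; have [hK _ _ K0] := ker_sbergman Wy.
split.
- move=> k z Wz.
  have h1 : differentiable (ku y) z.
    by apply: differentiableM; [exact: hK|exact: differentiable_cst].
  have h2 : differentiable (fun w => f (inv y w) k) z.
    apply: (@differentiable_comp _ _ _ _ (inv y) (fun w => f w k)).
      exact: invol_holo.
    by apply: hf; exact: invol_dom.
  exact: (differentiableM h1 h2).
- by have [h _] := l2P (translL2 y (toL2 f)); move=> k;
  have := translL2_l2 (toL2 f) Wy => /asboolP[]; exact.
- by have /asboolP[_] := translL2_l2 (toL2 f) Wy.
- by move=> w nW; rewrite /normalized_ker /kunit K0// mul0r scale0r.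
Qed.

Lemma translationE y f w : W y -> U y f w = ku y w *: f (inv y w).
Proof. by move=> Wy; have h := in_bergmanE (translation_vbergman f Wy); rewrite /translation h. Qed.

Lemma toL2_translation y f : W y -> toL2 (U y f) = translL2 y (toL2 f).
Proof. by move=> Wy; apply: L2_ext => w; rewrite (translL2E (toL2 f) w Wy);
  exact: translationE. Qed.

Lemma translationD y f g : W y -> U y (f + g) = U y f + U y g.
Proof.
move=> Wy; apply: rdot_inj => h; congr (rdot _ _).
by rewrite (toL2_translation (f +
  g) Wy) !toL2D (toL2_translation f Wy) (toL2_translation g Wy) translL2D.
Qed.

Lemma translationZ y (a : R[i]) f : W y -> U y (a *: f) = a *: U y f.
Proof.
move=> Wy; apply: rdot_inj => h; congr (rdot _ _).
by rewrite (toL2_translation (a *: f) Wy) !toL2Z (toL2_translation f Wy) translL2Z.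
Qed.

Lemma cdot_translation y f g : W y -> cdot (toL2 (U y f)) (toL2 (U y g)) = cdot (toL2 f) (toL2 g).
Proof. by move=> Wy; rewrite (toL2_translation f Wy) (toL2_translation g Wy) cdot_translL2. Qed.

Lemma nrm_translation y f : W y -> nrm (U y f) = nrm f.
Proof. by move=> Wy; rewrite !nrm_toL2 (toL2_translation f Wy) nrmL2_translL2. Qed.

Definition Uadj y g : B := adjoint (U y) g.

Lemma cdot_Uadj y f g : W y ->
  cdot (toL2 (U y f)) (toL2 g) = cdot (toL2 f) (toL2 (Uadj y g)).
Proof.
move=> Wy; have lU : linear (U y) by move=> a f' g'; rewrite translationD// translationZ.
have UC f' : nrm (U y f') <= 1 * nrm f' by rewrite mul1r nrm_translation.
have [h hP] := adjoint_ex g lU UC.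
have ex : exists h, (forall f : B, L2dot Sp (U y f) g = L2dot Sp f h).
  by exists h => f'; have := hP f'; rewrite -!L2dotE.
have := @xgetPex _ (0 : B) [set h : B | forall f : B, L2dot Sp (U y f) g = L2dot Sp f h] ex f.
by move=> h'; rewrite -!L2dotE; exact: h'.
Qed.

Lemma UadjK y f : W y -> Uadj y (U y f) = f.
Proof. by move=> Wy; apply: cdot_inj => h; rewrite -cdot_Uadj// cdot_translation. Qed.

Lemma UadjD y f g : W y -> Uadj y (f + g) = Uadj y f + Uadj y g.
Proof.
move=> Wy; apply: cdot_inj => h; rewrite -(cdot_Uadj h (f + g) Wy) (toL2D f g).
by rewrite (toL2D (Uadj y f)) cdotDr cdotDr (cdot_Uadj h f Wy) (cdot_Uadj h g Wy).
Qed.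

Lemma UadjZ y (a : R[i]) f : W y -> Uadj y (a *: f) = a *: Uadj y f.
Proof.
move=> Wy; apply: cdot_inj => h; rewrite -(cdot_Uadj h (a *: f) Wy) (toL2Z a f).
by rewrite (toL2Z a (Uadj y f)) cdotZr cdotZr (cdot_Uadj h f Wy).
Qed.

Lemma Uadj0 y : W y -> Uadj y 0 = 0.
Proof. by move=> Wy; have := UadjZ 0 0 Wy; rewrite !scale0r. Qed.

Lemma Uadj_kerv y w k : W y -> W w ->
  Uadj y (kerv Sp w k) = conjc (ku y w) *: kerv Sp (inv y w) k.
Proof.
move=> Wy Ww; have Wi := invol_dom Wy Ww.
apply: cdot_inj => h; rewrite -cdot_Uadj// cdot_kerv// toL2Z cdotZr conjcK cdot_kerv//.
by rewrite translationE.
Qed.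

Lemma nrm_Uadj_kerv y w k : W y -> W w -> nrm (Uadj y (kerv Sp w k)) = kn w.
Proof.
move=> Wy Ww; have Wi := invol_dom Wy Ww.
rewrite Uadj_kerv// nrmZ nrmc_conj nrm_ku// nrm_toL2 nrmL2_kerv//.
by rewrite divfK// nd.
Qed.

(** Surjectivity of the isometry, tested on kernels: ||U U^* K - K||^2 = ||K||^2 - ||U^* K||^2, and
    the two norms agree by [nrm_Uadj_kerv]. *)
Lemma translation_adj_kerv y w k : W y -> W w -> U y (Uadj y (kerv Sp w k)) = kerv Sp w k.
Proof.
move=> Wy Ww; apply/eqP; rewrite -subr_eq0; apply/eqP/nrmL2_eq0.
apply/eqP; rewrite -sqrf_eq0; apply/eqP.
apply: complexI; rewrite -cdotFF toL2B cdotBl !cdotBr.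
rewrite cdot_translation// (cdotC (toL2 (kerv Sp w k)) (toL2 (U _ _))) cdot_Uadj// !cdotFF
  -!nrm_toL2.
rewrite nrm_Uadj_kerv// (nrm_toL2 (kerv Sp w k)) nrmL2_kerv// conjc_real.
by rewrite !subrr.
Qed.

Lemma translation_adjK y g : W y -> U y (Uadj y g) = g.
Proof.
move=> Wy; apply: B_ext => z Wz k; rewrite -!cdot_kerv//.
by rewrite (cdot_Uadj _ _ Wy) cdotC -(cdot_Uadj _ _ Wy) (translation_adj_kerv k Wy
  Wz) -cdotC.
Qed.

Lemma nrm_Uadj y g : W y -> nrm (Uadj y g) = nrm g.
Proof. by move=> Wy; rewrite -[in RHS](translation_adjK g Wy) nrm_translation. Qed.

(** The pairing of [h] with [G] equals that of the translates, and the translate of [h] is in the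
    Bergman space, so the projection may be inserted. *)
Lemma proj_Uadj y G : W y -> proj G = Uadj y (proj (translL2 y G)).
Proof.
move=> Wy; apply: cdot_inj => h; apply: (etrans (cdot_proj h G)); apply: esym.
apply: (etrans (esym (cdot_Uadj h _ Wy))); apply: (etrans (cdot_proj (U y h) (translL2 y G))).
exact: (etrans (f_equal (fun F => cdot F _) (toL2_translation h Wy)) (cdot_translL2 (toL2 h) G Wy)).
Qed.

Lemma translate_op_nrm (T : B -> B) z f : W z ->
  nrm (translate_op T z f) = nrm (T (Uadj z f)).
Proof. by move=> Wz; rewrite /translate_op nrm_translation. Qed.

Lemma kn_large (M : R) : exists r, forall u, W u -> r < d u 0 -> M <= kn u.
Proof.
have [|r _ rP] := knrm_infty Sp (_ : nbhs +oo [set x | M <= x]).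
  by exists M; split; [exact: num_real|move=> x /ltW].
by exists r => u Wu ur; exact: rP.
Qed.

Lemma cdot_approx F F' G G' :
  nrm (cdot F G) <= nrm (cdot F' G') + nrmL2 (F - F') * nrmL2 G' + nrmL2 F * nrmL2 (G - G').
Proof.
have -> : cdot F G = cdot F' G' + cdot (F - F') G' + cdot F (G - G').
  rewrite (cdotBl F F' G') (cdotBr F G G').
  by move: (cdot F G) (cdot F' G') (cdot F G'); clear => a b c; ring.
apply: le_trans (nrmD _ _) _; apply: lerD; last exact: cdot_le.
by apply: le_trans (nrmD _ _) _; apply: lerD; [exact: lexx|exact: cdot_le].
Qed.

Let approx_arith (a b x y y' A A' e : R) : 0 <= a -> 0 <= b -> 0 <= x -> 0 <= y ->
  y' <= y + 1 -> A <= A' + a * y' + x * b -> A' < e / 3 ->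
  a < e / (3 * (x + y + 2)) -> b < e / (3 * (x + y + 2)) -> A < e.
Proof.
move=> a0 b0 x0 y0 yy h1 h2; have p : 0 < 3 * (x + y + 2) by lra.
rewrite !ltr_pdivlMr// => h3 h4.
have h5 : a * y' <= a * (y + 1) by rewrite ler_wpM2l.
have h6 : 0 <= a * x by rewrite mulr_ge0.
have h7 : 0 <= b * y by rewrite mulr_ge0.
nra.
Qed.

Let span_arith (c a b e : R) : 0 <= c -> 0 <= a -> b < e / 2 ->
  a < e / (2 * (c + 1)) -> c * a + b < e.
Proof.
move=> c0 a0 be; have p : 0 < 2 * (c + 1) by lra.
by rewrite ltr_pdivlMr// => h; nra.
Qed.

Let vanishes f g := forall e : R, 0 < e -> exists r, forall z, W z -> r < d z 0 ->
  nrm (cdot (toL2 (Uadj z f)) (toL2 g)) < e.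

(** The modulus is at most ||K_u|| ||K_v|| / ||K_q|| with q = phi_(phi_z(u))(v), and d(q, 0) >= d(z,
    0) - d(u, 0) - d(v, 0). *)
Lemma vanishes_kerv u k v l : W u -> W v -> vanishes (kerv Sp u k) (kerv Sp v l).
Proof.
move=> Wu Wv e e0.
have c0 : 0 < kn u * kn v by rewrite mulr_gt0 ?kn_gt0.
have [r rP] := kn_large (kn u * kn v / e + 1).
exists (r + d u 0 + d v 0) => z Wz rz.
have Wzu := invol_dom Wz Wu.
have W0 := @dom0 _ _ Sp.
have Wvz := invol_dom Wzu Wv.
rewrite Uadj_kerv// toL2Z cdotZl cdot_kerv// kervE// coordZ !nrmM nrmc_conj nrm_ku// nrmK//.
have h1 : kn u * kn v / e + 1 <= kn (inv (inv z u) v).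
  apply: rP => //; rewrite d_inv0//.
  have := d_tri Wz Wu W0; have := d_tri Wzu Wv W0; rewrite d_inv0//.
  rewrite (d_sym Wzu Wv) (d_sym Wz Wu).
  by move: (d z 0) (d u 0) (d v 0) (d u z) (d v (inv z u)) rz; clear => *; lra.
have n1 : nrm (ell2_unit R k l) <= 1.
  by rewrite -(nrm_unit R k) nrm_coord.
have q0 := kn_gt0 nd Wvz.
apply: (@le_lt_trans _ _ (kn u * kn v / kn (inv (inv z u) v))).
  have -> : kn u / kn (inv z u) * (kn (inv z u) * kn v / kn (inv (inv z u) v) *
    nrm (ell2_unit R k l)) = kn u * kn v / kn (inv (inv z u) v) * nrm (ell2_unit R k l).
    have := nd Wzu; have := nd Wvz.
    move: (kn u) (kn v) (kn (inv z u)) (kn (inv (inv z u) v)) (nrm _); clear.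
    by move=> a b c d' x d0 c0; field; rewrite c0 d0.
  by rewrite ler_piMr// divr_ge0 ?ltW.
rewrite ltr_pdivrMr// [ltRHS]mulrC -ltr_pdivrMr//.
by apply: lt_le_trans h1; rewrite ltrDl.
Qed.

(** Every U_z^* is an isometry, so approximating [f] and [g] costs the same for all z. *)
Lemma vanishes_limit f g : (forall e : R, 0 < e -> exists f' g',
   [/\ vanishes f' g', nrm (f - f') < e, nrm (g - g') < e & nrm g' <= nrm g + 1]) ->
  vanishes f g.
Proof.
move=> H e e0.
have Mp : 0 < 3 * (nrm f + nrm g + 2) by rewrite mulr_gt0// ltr_wpDl// addr_ge0 ?nrm_ge0.
have [f' [g' [v hf hg hg']]] := H (e / (3 * (nrm f + nrm g + 2))) (divr_gt0 e0 Mp).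
have e3 : 0 < e / 3 by rewrite divr_gt0.
have [r rP] := v (e / 3) e3; exists r => z Wz rz; have := rP z Wz rz.
have hV : nrmL2 (toL2 (Uadj z f) - toL2 (Uadj z f')) = nrm (f - f').
  rewrite -(toL2B (Uadj z f)) -nrm_toL2 -(nrm_Uadj (f - f') Wz); congr nrm.
  by rewrite (UadjD f (- f') Wz) -(scaleN1r f') (UadjZ _ f' Wz) scaleN1r.
have hG : nrmL2 (toL2 g - toL2 g') = nrm (g - g').
  exact: etrans (f_equal (@nrmL2 _ _ Sp) (esym (toL2B g g'))) (esym (nrm_toL2 (g - g'))).
have := cdot_approx (toL2 (Uadj z f)) (toL2 (Uadj z f')) (toL2 g) (toL2 g').
rewrite hV hG -(nrm_toL2 (Uadj z f)) (nrm_Uadj f Wz) -(nrm_toL2 g') => h1 h2.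
exact: (approx_arith (nrm_ge0 _) (nrm_ge0 _) (nrm_ge0 _) (nrm_ge0 _) hg' h1 h2 hf hg).
Qed.

Lemma vanishes_all f g : vanishes f g.
Proof.
have kk u k h : W u -> kspan h -> vanishes (kerv Sp u k) h.
  move=> Wu; elim=> [|c v l h' Wv _ IH] e e0.
    by exists 0 => z Wz _; rewrite toL20 /cdot scaler0 !rdot0r (_ : (0 +i* 0)%C = 0)// nrm0.
  have cp : 0 < 2 * (nrm c + 1) by rewrite mulr_gt0// ltr_wpDl ?nrm_ge0.
  have e2 : 0 < e / 2 by rewrite divr_gt0.
  have [r1 h1] := vanishes_kerv k l Wu Wv (divr_gt0 e0 cp); have [r2 h2] := IH _ e2.
  exists (Num.max r1 r2) => z Wz; rewrite gt_max => /andP[z1 z2].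
  rewrite toL2D toL2Z cdotDr cdotZr; apply: le_lt_trans (nrmD _ _) _.
  rewrite nrmM nrmc_conj.
  exact: (span_arith (nrm_ge0 c) (nrm_ge0 _) (h2 z Wz z2) (h1 z Wz z1)).
have ks f' h : kspan f' -> kspan h -> vanishes f' h.
  move=> + sh; elim=> [|c v l f'' Wv _ IH] e e0.
    exists 0 => z Wz _.
    by rewrite (Uadj0 Wz) toL20 /cdot !rdot0l (_ : (0 +i* 0)%C = 0)// nrm0.
  have cp : 0 < 2 * (nrm c + 1) by rewrite mulr_gt0// ltr_wpDl ?nrm_ge0.
  have e2 : 0 < e / 2 by rewrite divr_gt0.
  have [r1 h1] := kk v l h Wv sh _ (divr_gt0 e0 cp); have [r2 h2] := IH _ e2.
  exists (Num.max r1 r2) => z Wz; rewrite gt_max => /andP[z1 z2].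
  rewrite UadjD// UadjZ// toL2D toL2Z cdotDl cdotZl; apply: le_lt_trans (nrmD _ _) _.
  rewrite nrmM.
  exact: (span_arith (nrm_ge0 c) (nrm_ge0 _) (h2 z Wz z2) (h1 z Wz z1)).
apply: vanishes_limit => e e0.
have m0 : 0 < Num.min e 1.
  by clear kk ks; rewrite lt_min e0 ltr01.
have [f' sf hf] := kspan_dense f m0; have [g' sg' hg] := kspan_dense g m0.
have me : Num.min e 1 <= e by rewrite ge_min lexx.
have m1 : Num.min e 1 <= 1 by rewrite ge_min lexx orbT.
exists f', g'; split.
- exact: ks.
- exact: lt_le_trans hf me.
- exact: lt_le_trans hg me.
have h1 := lt_le_trans hg m1; have := nrmD (g' - g) g; rewrite subrK nrmBC.
by move: h1; move: (nrm (g - g')) (nrm g) (nrm g'); clear => *; lra.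
Qed.

Lemma weakly_null f g (e : R) : 0 < e -> exists r, forall z, W z -> r < d z 0 ->
  nrm (cdot (toL2 (Uadj z f)) (toL2 g)) < e.
Proof. exact: vanishes_all. Qed.

End translations.

(** * Total boundedness *)

Section truncation_ell2.
Variable R : realType.
Implicit Types x y : ell2 R.

Lemma rd0l y : rdot_ell2 0 y = 0.
Proof. by have := rdZl 0 0 y; rewrite rmorph0 scale0r mul0r. Qed.

Lemma trunc_subproof (m : nat) x :
  (fun k => if (k < m)%N then x k else 0) \in @ell2_pred R.
Proof.
have : sqsum x \is a fin_num.
  by have /andP[h1 h2] := ell2_sum_fin x; rewrite ge0_fin_numE.
rewrite ge0_fin_numE ?sqsum_ge0// unfold_in; apply: le_lt_trans.
apply: lee_nneseries => k _; first by rewrite lee_fin sqr_ge0.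
by rewrite /=; case: ifP => _; rewrite ?nrm0 ?expr0n lee_fin ?sqr_ge0.
Qed.

Definition trunc m x : ell2 R := Ell2 (trunc_subproof m x).

Lemma truncE m x k : trunc m x k = if (k < m)%N then x k else 0.
Proof. by []. Qed.

Lemma truncD m x y : trunc m (x + y) = trunc m x + trunc m y.
Proof.
apply/val_inj/funext => k.
rewrite [LHS]truncE [RHS](coordD (trunc m x) (trunc m y)) !truncE coordD.
by case: ifP => // _; rewrite addr0.
Qed.

Lemma truncZ m (a : R[i]) x : trunc m (a *: x) = a *: trunc m x.
Proof.
apply/val_inj/funext => k.
rewrite [LHS]truncE [RHS](coordZ a (trunc m x)) !truncE coordZ.
by case: ifP => // _; rewrite mulr0.
Qed.

Lemma truncK m x : trunc m (trunc m x) = trunc m x.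
Proof. by apply/val_inj/funext => k /=; case: (k < m)%N. Qed.

Lemma trunc_le m m' x : (m <= m')%N -> trunc m (trunc m' x) = trunc m x.
Proof.
move=> mm; apply/val_inj/funext => k /=; case: ifP => // km.
by rewrite (leq_trans km mm).
Qed.

Lemma rd_trunc m x y : rdot_ell2 (trunc m x) y = rdot_ell2 x (trunc m y).
Proof.
rewrite /rdot_ell2; congr (limn _); apply/funext => N; apply: eq_bigr => k _.
by rewrite !truncE; case: ifP => // _; rewrite conjc0 mul0r mulr0.
Qed.

Lemma nrm_trunc m x : nrm (trunc m x) ^+ 2 = \sum_(k < m) nrm (x k) ^+ 2.
Proof.
apply: (@cvg_unique _ (@Rhausdorff R) (series (fun k => nrm (trunc m x k) ^+ 2) N @[N --> \oo])).
  exact: sqnrm_cvg.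
apply: cvg_near_cst; exists m => // N mN.
rewrite /series/= (big_cat_nat (leq0n m) mN)/= [X in _ + X]big1_seq ?addr0; last first.
  move=> k; rewrite mem_index_iota => /andP[_ /andP[mk _]].
  by rewrite ltnNge mk nrm0 expr0n.
rewrite big_mkord; apply: eq_bigr => k _; by rewrite ltn_ord.
Qed.

Lemma nrm_sub_trunc m x : nrm (x - trunc m x) ^+ 2 = nrm x ^+ 2 - nrm (trunc m x) ^+ 2.
Proof.
have E : rdot_ell2 x (trunc m x) = nrm (trunc m x) ^+ 2 by rewrite -rdxx rd_trunc truncK.
rewrite -[LHS]rdxx -scaleN1C rdDl rdZl (rdC x) (rdC (trunc m x) (_ + _)) !rdDl !rdZl.
rewrite (rdC (trunc m x) x) E !rdxx.
by move: (nrm x ^+ 2) (nrm _ ^+ 2) => a b; ring.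
Qed.

Lemma nrm_trunc_le m x : nrm (trunc m x) <= nrm x.
Proof.
rewrite -(ler_pXn2r (n:=2)) ?nnegrE ?nrm_ge0//.
by rewrite -subr_ge0 -nrm_sub_trunc sqr_ge0.
Qed.

Lemma trunc_cvg x (e : R) : 0 < e -> exists m, nrm (x - trunc m x) < e.
Proof.
move=> e0; have := @sqnrm_cvg _ x => /cvgrPdist_lt /(_ (e ^+ 2) (exprn_gt0 2 e0)).
move=> [m _ /(_ m (leqnn m))] h; exists m.
rewrite -(ltr_pXn2r (n:=2)) ?nnegrE ?nrm_ge0 ?(ltW e0)//; move: h.
apply: le_lt_trans; rewrite /series /= big_mkord -nrm_trunc nrm_sub_trunc.
exact: ler_norm.
Qed.

End truncation_ell2.

(** The box containing the m values is cut into cells of side e and one point of [A] is kept per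
    nonempty cell, so the net consists of elements of [A]. The induction slices by the last
    function. *)
Lemma finite_cells (R : realType) (T : choiceType) (m : nat) (f : nat -> T -> R)
    (A : set T) (M e : R) : 0 < e ->
  (forall k x, (k < m)%N -> A x -> `|f k x| <= M) ->
  exists s : seq T, (forall x, x \in s -> A x) /\
    forall x, A x -> exists2 y, y \in s & forall k, (k < m)%N -> `|f k x - f k y| < e.
Proof.
move=> e0; elim: m A => [|m IH] A fM.
  have [[x0 Ax0]|nA] := pselect (exists x, A x).
    exists [:: x0]; split=> [x|x _]; first by rewrite inE => /eqP ->.
    by exists x0; rewrite ?inE.
  by exists [::]; split=> // x Ax; case: nA; exists x.
pose C i := [set x | A x /\ i%:R * e <= f m x + M < i.+1%:R * e].
have /choice[s sP] (i : nat) : exists s : seq T, (forall x, x \in s -> C i x) /\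
    forall x, C i x -> exists2 y, y \in s & forall k, (k < m)%N -> `|f k x - f k y| < e.
  by apply: IH => k x km [Ax _]; apply: fM => //; exact: ltnW.
(* [f m x + M] lies between 0 and 2 M, so the index of its slice is at most [N]. *)
pose N := Num.truncn (2 * M / e).
exists (flatten [seq s i | i <- iota 0 N.+1]); split.
  by move=> x /flattenP[l /mapP[i _ ->]] /(sP i).1[].
move=> x Ax; pose i := Num.truncn ((f m x + M) / e).
have := fM m x (ltnSn m) Ax; rewrite ler_norml => /andP[h1 h2].
have p0 : 0 <= (f m x + M) / e.
  by rewrite divr_ge0 ?(ltW e0)//; move: h1; move: (f m x); clear => *; lra.
have Cx : C i x.
  split=> //; have /andP[] := truncn_itv p0.
  by rewrite -/i ler_pdivlMr// ltr_pdivrMr// => -> ->.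
have [y ys yP] := (sP i).2 x Cx.
exists y.
  apply/flattenP; exists (s i) => //; apply: map_f.
  rewrite mem_iota/= add0n ltnS; apply: le_truncn.
  by rewrite ler_wpM2r ?invr_ge0 ?(ltW e0)//; move: h2; move: (f m x); clear => *; lra.
move=> k; rewrite ltnS leq_eqVlt => /orP[/eqP ->|]; last exact: yP.
have [_ /andP[y1 y2]] := (sP i).1 y ys; have [_ /andP[x1 x2]] := Cx.
move: x1 x2 y1 y2; rewrite -[i.+1]addn1 natrD mulrDl mul1r.
move: (f m x) (f m y) (i%:R * e); clear => a b c x1 x2 y1 y2.
by rewrite ltr_norml; apply/andP; split; lra.
Qed.

(** * Truncation of coordinates and restriction of supports *)

Section truncation.
Variables (R : realType) (n : nat) (Sp : bergman_space R n).
Local Notation V := 'rV[R[i]]_n.+1.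
Local Notation bV := (borelC R n).
Local Notation W := (dom Sp).
Local Notation sg := (sigma Sp).
Local Notation K := (ker Sp).
Local Notation kn := (knrm W sg K).
Local Notation L2 := (L2 Sp).
Local Notation B := (bergman Sp).
Implicit Types (z w u v y : V) (f g h : B) (F G : L2).

Lemma trunc_vbergman m f : vbergman W sg (fun z => trunc m (f z)).
Proof.
have [hf mf qf f0] := bergmanP f.
have E k : (fun z => trunc m (f z) k) = if (k < m)%N then (fun z => f z k) else fun=> 0.
  by apply/funext => z; rewrite truncE; case: ifP.
have mE k : cmeasurable W (fun z => trunc m (f z) k).
  by rewrite E; case: ifP => _; [exact: mf|exact: cmeasurable_cst].
split.
- move=> k; rewrite E; case: ifP => _; first exact: hf.
  by move=> z _; exact: differentiable_cst.
- exact: mE.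
- apply: le_lt_trans qf; apply: ge0_le_integral.
  + exact: mdom.
  + by move=> z _; rewrite lee_fin sqr_ge0.
  + exact: measurable_sqnrm.
  + by apply/measurable_EFinP; exact: (measurable_nrm2 (toL2 f)).
  + by move=> z _; rewrite lee_fin ler_pXn2r ?nnegrE ?nrm_ge0// nrm_trunc_le.
- move=> z nWz; rewrite f0//; apply/val_inj/funext => k /=.
  by case: ifP.
Qed.

Definition truncB m f : B := in_bergman Sp (fun z => trunc m (f z)).

Lemma truncBE m f z : truncB m f z = trunc m (f z).
Proof. by have h := in_bergmanE (trunc_vbergman m f); rewrite /truncB h. Qed.

Lemma B_eq f g : (forall z, f z = g z) -> f = g.
Proof. by move=> fg; apply/val_inj/funext. Qed.

Lemma truncBD m f g : truncB m (f + g) = truncB m f + truncB m g.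
Proof.
apply: B_eq => z; apply: (etrans (truncBE m (f + g) z)).
apply: (etrans (truncD m (f z) (g z))); apply: esym.
exact: (f_equal2 +%R (truncBE m f z) (truncBE m g z)).
Qed.

Lemma truncBZ m (a : R[i]) f : truncB m (a *: f) = a *: truncB m f.
Proof.
apply: B_eq => z; apply: (etrans (truncBE m (a *: f) z)).
apply: (etrans (truncZ m a (f z))); apply: esym.
exact: (f_equal ( *:%R a) (truncBE m f z)).
Qed.

Lemma truncBB m f g : truncB m (f - g) = truncB m f - truncB m g.
Proof. by rewrite (truncBD m f (- g)) -(scaleN1r g) (truncBZ m _ g) scaleN1r. Qed.

Lemma truncBK m f : truncB m (truncB m f) = truncB m f.
Proof. by apply: B_eq => z; rewrite !truncBE truncK. Qed.

Lemma truncB_le m m' f : (m <= m')%N -> truncB m (truncB m' f) = truncB m f.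
Proof. by move=> mm; apply: B_eq => z; rewrite !truncBE trunc_le. Qed.

Lemma nrm_truncB m f : nrm (truncB m f) <= nrm f.
Proof.
rewrite !nrm_toL2 -(ler_pXn2r (n:=2)) ?nnegrE ?nrmL2_ge0// -lee_fin !nrmL2_sqE.
apply: ge0_le_integral.
- exact: mdom.
- by move=> z _; rewrite lee_fin sqr_ge0.
- by apply/measurable_EFinP; exact: measurable_nrm2.
- by apply/measurable_EFinP; exact: measurable_nrm2.
move=> z _; rewrite lee_fin ler_pXn2r ?nnegrE ?nrm_ge0// [toL2 _ z]truncBE.
exact: nrm_trunc_le.
Qed.

Lemma rdot_truncB m f g : rdot (toL2 (truncB m f)) (toL2 g) = rdot (toL2 f) (toL2 (truncB m g)).
Proof.
by apply: eq_Rintegral => z _; rewrite [toL2 (truncB m f) z]truncBE [toL2 (truncB m g) z]truncBE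
  rd_trunc.
Qed.

(** U_y composes with phi_y and multiplies the values by scalars, so it commutes with truncation;
    hence so does its inverse. *)
Lemma truncB_Uadj m y f : (forall z, W z -> kn z != 0) -> W y ->
  truncB m (Uadj y f) = Uadj y (truncB m f).
Proof.
move=> nd Wy; rewrite -[LHS](UadjK nd _ Wy) -{2}(translation_adjK nd f Wy);
  congr (Uadj y _).
apply: B_ext => z Wz k; rewrite (translationE nd _ z Wy) !truncBE (translationE nd _ z Wy).
by rewrite truncZ.
Qed.

Definition supp (A : set V) G := forall z, W z -> ~ A z -> G z = 0.

Lemma bmfun_indic (A : set V) : measurable (A : set bV) -> bmfun Sp (\1_A : V -> R).
Proof.
move=> mA; split; first by apply: measurable_funTS; exact: measurable_indic.
by exists 1 => z _; rewrite indicE; case: (_ \in _); rewrite ?normr0 ?normr1.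
Qed.

Lemma supp_indic (A : set V) G : measurable (A : set bV) -> supp A (mulx \1_A G).
Proof.
move=> mA z Wz nA; rewrite (mulxE G z (bmfun_indic mA)) indicE memNset// scale0r.
by [].
Qed.

Lemma nrmL2_indic (A : set V) G : measurable (A : set bV) -> nrmL2 (mulx \1_A G) <= nrmL2 G.
Proof.
move=> mA; rewrite -[leRHS]mul1r; apply: nrmL2_mulx => //; first exact: bmfun_indic.
by move=> z _; rewrite indicE; case: (_ \in _); rewrite ?normr0 ?normr1.
Qed.

Lemma rdot_supp (A : set V) F G : measurable (A : set bV) -> supp A G ->
  rdot F G = rdot (mulx \1_A F) G.
Proof.
move=> mA sG; apply: eq_Rintegral => z /set_mem Wz.
rewrite (mulxE F z (bmfun_indic mA)) indicE.
have [Az|nA] := pselect (A z); first by rewrite mem_set// scale1r.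
rewrite (sG z Wz nA) memNset// scale0r.
by rewrite rd0l rdC rd0l.
Qed.

End truncation.

(** * A finite net for projections of functions supported in a ball *)

Section total_boundedness.
Variables (R : realType) (n : nat) (Sp : bergman_space R n).
Local Notation V := 'rV[R[i]]_n.+1.
Local Notation bV := (borelC R n).
Local Notation W := (dom Sp).
Local Notation sg := (sigma Sp).
Local Notation K := (ker Sp).
Local Notation kn := (knrm W sg K).
Local Notation inv := (invol Sp).
Local Notation L2 := (L2 Sp).
Local Notation B := (bergman Sp).
Implicit Types (z w u v y : V) (f g h : B) (F G : L2).
Hypothesis nd : forall z, W z -> kn z != 0.

(* The component of the kernel at z orthogonal to the kernel at a has norm
   kn z * sqrt (1 - kn (inv z a) ^- 2). *)
Lemma harnack h z a k (eta : R) : W z -> W a -> 0 <= eta -> kn (inv z a) <= 1 + eta ->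
  nrm (h z k) <= kn z * (nrm (h a k) + Num.sqrt (2 * eta) * nrm h).
Proof.
move=> Wz Wa e0 q1; have Wq := invol_dom Wz Wa.
have ka := kn_ge1 nd Wa; have kz := kn_ge1 nd Wz; have kq := kn_ge1 nd Wq.
pose c := K z a / (kn a ^+ 2)%:C%C.
pose rest : L2 := toL2 (kerv Sp z k) - c *: toL2 (kerv Sp a k).
have nc : nrm c = kn z / (kn a * kn (inv z a)).
  rewrite /c nrmM nrmcV nrmcR ger0_norm ?sqr_ge0// nrmK//.
  have := nd Wa; have := nd Wq; move: (kn z) (kn a) (kn (inv z a)); clear.
  by move=> x y q y0 q0; field; rewrite y0 q0.
have nc1 : nrm c <= kn z.
  rewrite nc ler_pdivrMr ?mulr_gt0 ?kn_gt0// ler_peMr ?kn_ge0//.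
  by rewrite mulr_ege1.
have hrest : nrmL2 rest ^+ 2 = kn z ^+ 2 * (1 - (kn (inv z a) ^+ 2)^-1).
  apply: complexI; rewrite -cdotFF /rest cdotBl !cdotBr !cdotZl !cdotZr.
  rewrite (cdotC (toL2 (kerv Sp a k)) (toL2 (kerv Sp z k))) !cdot_kerv// !kerv_coord//.
  rewrite !Kzz//.
  have ca : c * (kn a ^+ 2)%:C%C = K z a.
    rewrite /c -mulrA mulVf ?mulr1//.
    by rewrite (_ : 0 = 0%:C%C)// (inj_eq (@complexI R)) expf_neq0// nd.
  have cb : conjc c * (kn a ^+ 2)%:C%C = conjc (K z a).
    by rewrite -ca; case: (c) => x y; congr (_ +i* _)%C; rewrite /=; ring.
  rewrite cb subrr subr0.
  have -> : conjc c * K z a = (kn z ^+ 2 * (kn (inv z a) ^+ 2)^-1)%:C%C.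
    have -> : conjc c * K z a = (nrm c ^+ 2 * kn a ^+ 2)%:C%C.
      rewrite -ca sqnrmC; move: (kn a ^+ 2) => r.
      by case: (c) => x y; congr (_ +i* _)%C; rewrite /=; ring.
    congr (_%:C)%C; rewrite nc.
    have := nd Wa; have := nd Wq; move: (kn z) (kn a) (kn (inv z a)); clear.
    by move=> x y q y0 q0; field; rewrite y0 q0.
  by rewrite -rmorphB mulrBr mulr1.
have hrest1 : nrmL2 rest <= kn z * Num.sqrt (2 * eta).
  rewrite -(ler_pXn2r (n:=2)) ?nnegrE ?nrmL2_ge0 ?mulr_ge0 ?kn_ge0 ?sqrtr_ge0//.
  have s2 : Num.sqrt (2 * eta) ^+ 2 = 2 * eta by rewrite sqr_sqrtr// mulr_ge0.
  rewrite hrest exprMn s2 ler_wpM2l ?sqr_ge0//.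
  move: (kn (inv z a)) kq q1 e0; clear => q kq q1 e0.
  have q0 : 0 < q ^+ 2 by rewrite exprn_gt0// (lt_le_trans _ kq).
  have h : 1 <= q ^+ 2 by rewrite exprn_ege1.
  (* This is 1 - 1/q^2 <= 2 eta; it follows from (1 - 2 eta) (1 + eta)^2 <= 1. *)
  suff : (1 - 2 * eta) * q ^+ 2 <= 1.
    rewrite -ler_pdivlMr// div1r => h1; lra.
  have [x1|x1] := leP (1 - 2 * eta) 0.
    by apply: le_trans ler01; rewrite mulr_le0_ge0// ltW.
  apply: (@le_trans _ _ ((1 - 2 * eta) * (1 + eta) ^+ 2)).
    have h2 : q ^+ 2 <= (1 + eta) ^+ 2 by clear h q0 x1; nra.
    by rewrite ler_wpM2l ?(ltW x1).
  by nra.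
have -> : h z k = conjc c * h a k + cdot (toL2 h) rest.
  by rewrite /rest cdotBr cdotZr !cdot_kerv// addrC subrK.
apply: le_trans (nrmD _ _) _; rewrite nrmM nrmc_conj mulrDr; apply: lerD.
  by rewrite ler_wpM2r ?nrm_ge0.
apply: le_trans (cdot_le _ _) _; rewrite -nrm_toL2 mulrA [leRHS]mulrC.
by rewrite ler_wpM2l ?nrm_ge0.
Qed.

Lemma nrmL2_indic_bound (A : set V) G (c : R) : measurable (A : set bV) ->
  (forall z, W z -> A z -> nrm (G z) ^+ 2 <= c) -> 0 <= c ->
  nrmL2 (mulx \1_A G) ^+ 2 <= c * fine (sg W).
Proof.
move=> mA Gc c0; rewrite -lee_fin nrmL2_sqE EFinM fineK ?fin_num_measure//; last exact: mdom.
apply: (@le_trans _ _ (\int[sg]_(z in W) c%:E)%E); last first.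
  by rewrite integral_cst//; exact: mdom.
apply: ge0_le_integral.
- exact: mdom.
- by move=> z _; rewrite lee_fin sqr_ge0.
- by apply/measurable_EFinP; exact: measurable_nrm2.
- exact: measurable_cst.
move=> z Wz; rewrite lee_fin (mulxE G z (bmfun_indic Sp mA)) nrmZ indicE nrmcR.
have [Az|nA] := pselect (A z).
  by rewrite mem_set// normr1 mul1r; exact: Gc.
by rewrite memNset// normr0 mul0r expr0n.
Qed.

Lemma finite_cells_seq (T : choiceType) (I : eqType) (s : seq I) (phi : I -> T -> R)
    (A : set T) (M e : R) : 0 < e ->
  (forall i x, i \in s -> A x -> `|phi i x| <= M) ->
  exists t : seq T, (forall x, x \in t -> A x) /\
    forall x, A x -> exists2 y, y \in t & forall i, i \in s -> `|phi i x - phi i y| < e.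
Proof.
move=> e0; case: s => [|i0 s] sM.
  have [[x0 Ax0]|nA] := pselect (exists x, A x).
    exists [:: x0]; split=> [x|x _]; first by rewrite inE => /eqP ->.
    by exists x0; rewrite ?inE.
  by exists [::]; split=> // x Ax; case: nA; exists x.
have [|t [tA tP]] := @finite_cells R T (size (i0 :: s))
    (fun k => phi (nth i0 (i0 :: s) k)) A M e e0.
  by move=> k x ks Ax; apply: sM => //; exact: mem_nth.
exists t; split=> // x Ax; have [y yt yP] := tP x Ax; exists y => // i /(nthP i0)[k ks <-].
exact: yP.
Qed.

(** Here [X] is the norm of h on the ball and [a] its full norm: X <= 3 t sqrt(q), so a^2 <= 6 t
    sqrt(q) < e^2. The 1 in the denominator of [t] makes this strict and allows q = 0. *)
Lemma cell_size_arith (e X q t a : R) : 0 < e -> 0 <= q -> 0 <= X ->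
  t = e ^+ 2 / (6 * Num.sqrt q + 1) ->
  X ^+ 2 <= 9 * t ^+ 2 * q -> 0 <= a -> a ^+ 2 <= X * 2 -> a < e.
Proof.
move=> e0 q0 X0 tE Xq a0 aX.
have s0 := sqrtr_ge0 q; have ss := sqr_sqrtr q0.
move: (Num.sqrt q) s0 ss tE => s s0 <- tE in Xq *.
have p0 : 0 < 6 * s + 1 by lra.
have t0 : 0 <= t by rewrite tE divr_ge0 ?sqr_ge0// ltW.
have Xs : X <= 3 * t * s.
  rewrite -(ler_pXn2r (n:=2)) ?nnegrE ?mulr_ge0//.
  by apply: le_trans Xq _; rewrite !exprMn; lra.
rewrite -(ltr_pXn2r (n:=2)) ?nnegrE ?(ltW e0)//.
apply: (@le_lt_trans _ _ (t * (6 * s))); first by lra.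
have -> : e ^+ 2 = t * (6 * s + 1) by rewrite tE divfK ?gt_eqF.
by rewrite ltr_pM2l ?ltrDl// tE divr_gt0// exprn_gt0.
Qed.

Lemma cell_bound_arith (x y q t M : R) : y <= 2 -> 0 <= t -> 0 <= y -> 0 <= x -> x <= t ->
  0 <= q -> q <= M -> q * (x + t * y) <= 3 * t * M.
Proof.
move=> y2 t0 y0 x0 xt q0 qM.
have h : x + t * y <= 3 * t.
  have : t * y <= t * 2 by rewrite ler_wpM2l.
  by move: (t * y) xt; clear => *; lra.
by rewrite [leRHS]mulrC ler_pM// addr_ge0// mulr_ge0.
Qed.

(** For G, G' in the set and h the truncated projection of G - G', ||h||^2 = <1_D h, G - G'> <= 2
    ||1_D h||, so that only the values of h on the ball D matter. By [harnack] they are controlled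
    by the values at finitely many points, with finitely many coordinates each, which
    [finite_cells_seq] separates into cells. *)
Lemma truncB_proj_net m (rho e : R) : 0 < e -> exists s : seq L2,
  (forall G, G \in s -> supp (mball Sp 0 rho) G /\ nrmL2 G <= 1) /\
  forall G, supp (mball Sp 0 rho) G -> nrmL2 G <= 1 ->
    exists2 G', G' \in s & nrm (truncB m (proj G) - truncB m (proj G')) < e.
Proof.
move=> e0.
have mDr : measurable (mball Sp 0 rho : set bV) := measurable_ballW rho (@dom0 _ _ Sp).
have [M MP] := kn_bounded Sp rho.
(* ||1_D h||^2 will be at most 9 t^2 Q: there are m coordinates, each at most 3 t M, on a set of
   measure at most sigma(W). *)
pose Q : R := `|fine (sg W) * (m%:R * M ^+ 2)|.
pose t := e ^+ 2 / (6 * Num.sqrt Q + 1).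
have t0 : 0 < t by rewrite divr_gt0 ?exprn_gt0// ltr_wpDl// mulr_ge0// sqrtr_ge0.
(* So that the factor sqrt(2 eta) of [harnack] equals [t]. *)
pose eta := t ^+ 2 / 2.
have eta0 : 0 < eta by rewrite divr_gt0 ?exprn_gt0.
have seta : Num.sqrt (2 * eta) = t.
  by rewrite /eta mulrC divfK// sqrtr_sqr ger0_norm// ltW.
(* ||K|| is close to ||K_0|| = 1 at phi_z(a) as soon as d(phi_z(a), 0) = d(a, z) is small. *)
have [del del0 delP] := mcont_kn (@dom0 _ _ Sp) eta0.
have [s [sW sP]] := @d_cover _ _ Sp rho (fun=> del) (fun _ _ => del0).
(* Real and imaginary parts of the first [m] coordinates at the points of [s]. *)
pose S := [seq (p, b) | p <- [seq (a, k) | a <- s, k <- iota 0 m], b <- [:: true; false]].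
pose phi (i : V * nat * bool) G : R := let c := proj G i.1.1 i.1.2 in
  if i.2 then complex.Re c else complex.Im c.
pose A := [set G : L2 | supp (mball Sp 0 rho) G /\ nrmL2 G <= 1].
have kns a : a \in s -> kn a <= \sum_(a <- s) kn a.
  move=> sa; rewrite (big_rem a sa)/= lerDl; apply: sumr_ge0 => i _; exact: kn_ge0.
have t20 : 0 < t / 2 by rewrite divr_gt0.
have [i G|T [TA TP]] := @finite_cells_seq L2 _ S phi A (\sum_(a <- s) kn a) (t / 2) t20.
  move=> /allpairsP[[[a k] b]/= [/allpairsP[[a' k']/= [sa _ [-> ->]]] _ ->]] [_ G1].
  apply: (@le_trans _ _ (nrm (proj G a' k'))).
    by rewrite /phi/=; case: b; [exact: Re_le_nrm|exact: Im_le_nrm].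
  apply: le_trans (nrm_coord_le (proj G) k' (sW _ sa)) _.
  apply: le_trans (kns _ sa).
  by rewrite ler_piMl ?kn_ge0// (le_trans (nrm_proj G)).
exists T; split=> // G G1 G2; have [G' TG' G'P] := TP G (conj G1 G2).
exists G' => //; have [G'1 G'2] := TA G' TG'.
pose h := truncB m (proj (G - G')).
have hE : truncB m (proj G) - truncB m (proj G') = h.
  by apply: esym; apply: (etrans (f_equal (truncB m) (projB G G'))); exact: truncBB.
rewrite hE.
have H2 : nrmL2 (G - G') <= 2.
  apply: le_trans (nrmL2B G G') _; move: (nrmL2 G) (nrmL2 G') G2 G'2; clear => *; lra.
have h2 : nrm h <= 2 by apply: le_trans (nrm_truncB _ _) _; apply: le_trans (nrm_proj _) _.
have ha a k : a \in s -> (k < m)%N -> nrm (h a k) <= t.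
  move=> sa km.
  have E : h a k = proj G a k - proj G' a k.
    have E1 : h a = trunc m (proj (G - G') a) := truncBE m (proj (G - G')) a.
    have E2 : proj (G - G') = proj G - proj G' := projB G G'.
    by rewrite E1 truncE km E2.
  have iS b : (a, k, b) \in S.
    apply/allpairsP; exists (a, k, b); split=> //=; last by case: b.
    apply/allpairsP; exists (a, k); split=> //=.
    by rewrite mem_iota.
  have := G'P _ (iS true); have := G'P _ (iS false); rewrite /phi/= -!raddfB -E /=.
  have := nrm_le_ReIm (h a k).
  move: (complex.Re _) (complex.Im _) (nrm (h a k)); clear => *; lra.
have hz z k : W z -> mball Sp 0 rho z -> (k < m)%N -> nrm (h z k) <= 3 * t * M.
  move=> Wz [_ dz] km.
  have [a sa da] := sP z Wz (ltW dz); have Wa := sW _ sa.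
  have q1 : kn (inv z a) <= 1 + eta.
    have Wi := invol_dom Wz Wa.
    have := delP (inv z a) Wi; rewrite (d_sym (@dom0 _ _ Sp) Wi) (d_inv0 Wz Wa).
    move=> /(_ da); rewrite (kn_0 nd) ltr_norml => /andP[+ _].
    move: (kn _) (eta); clear => *; lra.
  apply: le_trans (harnack h k Wz Wa (ltW eta0) q1) _; rewrite seta.
  have := MP z Wz (ltW dz); have := kn_ge0 Sp z; have := ha a k sa km.
  have := nrm_ge0 (h a k); have := nrm_ge0 h; move: h2 (ltW t0).
  exact: cell_bound_arith.
pose X := nrmL2 (mulx \1_(mball Sp 0 rho) (toL2 h)).
have XQ : X ^+ 2 <= 9 * t ^+ 2 * Q.
  have hc z : W z -> mball Sp 0 rho z -> nrm (toL2 h z) ^+ 2 <= m%:R * (3 * t * M) ^+ 2.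
    move=> Wz Dz; have -> : toL2 h z = trunc m (proj (G - G') z) := truncBE m _ z.
    rewrite nrm_trunc; apply: (@le_trans _ _ (\sum_(k < m) (3 * t * M) ^+ 2)).
      apply: ler_sum => k _; have := hz z k Wz Dz (ltn_ord k).
      have -> : h z k = proj (G - G') z k by rewrite /h truncBE truncE ltn_ord.
      have := nrm_ge0 (proj (G - G') z k).
      by move: (nrm _) (3 * t * M); clear => x y x0 xy; rewrite ler_pXn2r ?nnegrE ?(le_trans x0).
    by rewrite sumr_const card_ord [leRHS]mulr_natl.
  apply: le_trans (nrmL2_indic_bound mDr hc (mulr_ge0 (ler0n _ _) (sqr_ge0 _))) _.
  have -> : m%:R * (3 * t * M) ^+ 2 * fine (sg W) = 9 * t ^+ 2 * (fine (sg W) * (m%:R * M ^+ 2)).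
    by move: (fine _) (m%:R : R); clear => *; ring.
  by rewrite ler_wpM2l ?ler_norm// mulr_ge0 ?sqr_ge0.
have X0 : 0 <= X := nrmL2_ge0 _.
have Q0 : 0 <= Q := normr_ge0 _.
have tE : t = e ^+ 2 / (6 * Num.sqrt Q + 1) := erefl.
refine (cell_size_arith e0 Q0 X0 tE XQ (nrm_ge0 h) _).
have -> : nrm h ^+ 2 = rdot (mulx \1_(mball Sp 0 rho) (toL2 h)) (G - G').
  have sH : supp (mball Sp 0 rho) (G - G').
    move=> z Wz nz; have E : (G - G') z = G z - G' z by [].
    by rewrite E (G1 z Wz nz) (G'1 z Wz nz) subr0.
  rewrite nrm_toL2 nrmL2_sq -(rdot_supp _ mDr sH).
  apply: (etrans (rdot_truncB m (proj (G - G')) h)).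
  apply: (etrans (f_equal (fun g => rdot (toL2 (proj (G - G'))) (toL2 g)) (truncBK m (proj (G -
    G'))))).
  exact: (etrans (rdot_projl h (G - G')) (rdotC (G - G') (toL2 h))).
apply: le_trans (ler_norm _) _; apply: le_trans (rdot_le _ _) _.
by rewrite ler_wpM2l ?nrmL2_ge0.
Qed.

End total_boundedness.

(** * Precompactness and total boundedness *)

Lemma nrm_sub_nbhs (R : realType) (X : normedModType R[i]) (g : X) (e : R) : 0 < e ->
  nbhs g [set x | nrm (x - g) < e].
Proof.
move=> e0; apply/nbhs_ballP; exists e%:C%C; first by rewrite /= ltcR.
by move=> x; rewrite -ball_normE /= nrmE ltcR -nrmN opprB.
Qed.

Lemma nbhs_nrm_sub (R : realType) (X : normedModType R[i]) (g : X) (U : set X) : nbhs g U ->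
  exists2 e : R, 0 < e & [set x | nrm (x - g) < e] `<=` U.
Proof.
move=> /nbhs_ballP[[a b] /=]; rewrite ltcE/= => /andP[/eqP b0 a0]; rewrite b0 => h.
exists a => // x xg; apply: h; rewrite -ball_normE /= nrmE ltcR -nrmN opprB.
exact: xg.
Qed.

Section totally_bounded.
Variables (R : realType) (n : nat) (Sp : bergman_space R n).
Local Notation B := (bergman Sp).

Definition totally_bounded (A : set B) := forall e : R, 0 < e ->
  exists s : seq B, forall x, A x -> exists2 y, y \in s & nrm (x - y) < e.

Lemma ultra_seq (F : set_system B) (T : eqType) (s : seq T) (Q : T -> B -> Prop) :
  UltraFilter F -> F [set x | exists2 y, y \in s & Q y x] ->
  exists2 y, y \in s & F [set x | Q y x].
Proof.
move=> UF; elim: s => [|y s IH] h.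
  by have [x [y]] := filter_ex h.
have [Fy|Fy] := in_ultra_setVsetC [set x | Q y x] UF.
  by exists y; rewrite ?inE ?eqxx.
have [|z zs Fz] := IH; last by exists z; rewrite // inE zs orbT.
apply: filterS (filterI h Fy) => x [[z + Qz] nQ].
by rewrite inE => /predU1P[zy|zs]; [case: nQ; rewrite /= -zy|exists z].
Qed.

(** An ultrafilter containing the closure of [A] contains, for every k, a ball of radius 1/(k+1).
    The centers form a Cauchy sequence, whose limit is the limit of the ultrafilter. *)
Lemma totally_bounded_precompact (A : set B) : totally_bounded A -> precompact A.
Proof.
move=> tA; rewrite precompactE compact_ultra => F UF FA.
have h k : exists y, F [set x | nrm (x - y) < k.+1%:R^-1].
  have e0 : 0 < k.+1%:R^-1 / 2 :> R by rewrite divr_gt0.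
  have [s sP] := tA _ e0.
  have [|y ys Fy] := @ultra_seq F _ s (fun y x => nrm (x - y) < k.+1%:R^-1) UF; last by exists y.
  apply: filterS FA => x /(_ _ (nrm_sub_nbhs x e0))[y [Ay xy]].
  have [z zs yz] := sP y Ay; exists z => //.
  have -> : x - z = (y - z) - (y - x) by rewrite opprB [RHS]addrC addrA subrK.
  apply: le_lt_trans (nrmD _ _) _; rewrite nrmN; move: xy yz => /=.
  by move: (nrm _) (nrm _) (k.+1%:R^-1); clear => *; lra.
have [y yP] := choice h.
have [|g gP] := bergman_complete (u := y).
  move=> e e0; have e20 : 0 < e / 2 by rewrite divr_gt0.
  have [N NP] := invS_lt e20; exists N => j k Nj Nk.
  have [x [xj xk]] := filter_ex (filterI (yP j) (yP k)).
  have -> : y j - y k = (x - y k) - (x - y j) by rewrite opprB [RHS]addrC addrA subrK.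
  apply: le_lt_trans (nrmD _ _) _; rewrite nrmN.
  move: xj xk (NP j Nj) (NP k Nk) => /=.
  by move: (nrm _) (nrm _) (_^-1) (_^-1); clear => *; lra.
have Fg : F --> g.
  move=> U /nbhs_nrm_sub[e e0 eU].
  have e20 : 0 < e / 2 by rewrite divr_gt0.
  have [N NP] := invS_lt e20; have [N' N'P] := gP _ e20.
  apply: filterS (yP (maxn N N')) => x /= xy; apply: eU => /=.
  have -> : x - g = (x - y (maxn N N')) + (y (maxn N N') - g) by rewrite addrA subrK.
  apply: le_lt_trans (nrmD _ _) _.
  move: xy (NP _ (leq_maxl N N')) (N'P _ (leq_maxr N N')).
  by move: (nrm _) (nrm _) (_^-1); clear => *; lra.
exists g; split=> //; apply: (@closed_closure _ A) => U Ug.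
have [x [xU xA]] := filter_ex (filterI (Fg U Ug) FA).
by exists x.
Qed.

Lemma precompact_totally_bounded (A : set B) : precompact A -> totally_bounded A.
Proof.
rewrite precompactE compact_cover => cA e e0.
have ec0 : (0 : R[i]) < e%:C%C by rewrite ltcR.
have [|x Ax|D _ DA] := cA B (closure A) (fun y => ball y e%:C%C).
- by move=> y _; exact: ball_open.
- by exists x => //; exact: ballxx.
exists (finmap.enum_fset D) => x Ax; have [y yD] := DA x (subset_closure Ax).
by rewrite -ball_normE /= nrmE ltcR -nrmN opprB => h; exists y.
Qed.

End totally_bounded.

(** * Toeplitz operators *)

Lemma linear_fun0 (A : ringType) (U V : lmodType A) (T : U -> V) : linear T -> T 0 = 0.
Proof. by move=> lT; have := lT (-1) 0 0; rewrite scaler0 addr0 scaleN1r addNr. Qed.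

Section operator_norm.
Variables (R : realType) (X : normedModType R[i]).
Implicit Types T A : X -> X.

Lemma opnorm_le T (C : R) : (forall x, nrm x <= 1 -> nrm (T x) <= C) -> (opnorm T <= C%:E)%E.
Proof. by move=> h; apply: ge_ereal_sup => _ [x x1 <-]; rewrite lee_fin; exact: h. Qed.

Lemma opnorm_ge0 T : (0 <= opnorm T)%E.
Proof.
apply: (@le_trans _ _ (nrm (T 0))%:E); first by rewrite lee_fin nrm_ge0.
by apply: ereal_sup_ubound; exists 0 => //=; rewrite nrm0.
Qed.

Lemma linear_opnorm T (C : R) x : linear T -> (opnorm T <= C%:E)%E -> nrm (T x) <= C * nrm x.
Proof.
move=> lT TC.
have T0 : T 0 = 0 := linear_fun0 lT.
have [x0|x0] := eqVneq (nrm x) 0; first by rewrite x0 (nrm_eq0 x0) T0 nrm0 mulr0.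
have xp : 0 < nrm x by rewrite lt_neqAle eq_sym x0 nrm_ge0.
have TZ (a : R[i]) y : T (a *: y) = a *: T y by have := lT a y 0; rewrite T0 !addr0.
have n1 : nrm (((nrm x)^-1)%:C%C *: x) <= 1.
  by rewrite nrmZ nrmcR ger0_norm ?invr_ge0 ?nrm_ge0// mulVf.
have : (((nrm (T (((nrm x)^-1)%:C%C *: x)))%:E) <= C%:E)%E.
  by apply: le_trans TC; apply: ereal_sup_ubound; eexists; first exact: n1.
rewrite lee_fin TZ nrmZ nrmcR ger0_norm ?invr_ge0 ?nrm_ge0//.
by rewrite mulrC ler_pdivrMr.
Qed.

Lemma bounded_opP T : bounded_op T ->
  linear T /\ exists2 C : R, 0 <= C & forall x, nrm (T x) <= C * nrm x.
Proof.
move=> [lT Too]; split=> //; have T0 := opnorm_ge0 T.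
have fT : opnorm T \is a fin_num by rewrite ge0_fin_numE.
exists (fine (opnorm T)); first exact: fine_ge0.
by move=> x; apply: linear_opnorm => //; rewrite fineK.
Qed.

End operator_norm.

Section finite_symbols.
Variable R : realType.
Implicit Types x y : ell2 R.

Lemma truncS m x : trunc m.+1 x = trunc m x + x m *: ell2_unit R m.
Proof.
apply/val_inj/funext => k; rewrite [LHS]truncE [RHS](coordD (trunc m x)) coordZ truncE ltnS.
rewrite leq_eqVlt; have [->|km] := eqVneq k m.
  by rewrite /= ltnn eqxx mulr1 add0r.
by rewrite /= (negPf km) mulr0 addr0.
Qed.

Lemma linear_trunc (T : ell2 R -> ell2 R) m x k : linear T ->
  T (trunc m x) k = \sum_(i < m) x i * T (ell2_unit R i) k.
Proof.
move=> lT; have T0 : T 0 = 0 := linear_fun0 lT.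
elim: m => [|m IH].
  rewrite big_ord0; have -> : trunc 0 x = 0 by apply/val_inj/funext.
  by rewrite T0.
by rewrite truncS addrC lT coordD IH coordZ big_ord_recr/= addrC.
Qed.

(** x - trunc m x has no coordinate below m, so [T] kills all its truncations; these converge to it,
    and boundedness carries the vanishing to the limit. *)
Lemma finite_symbol (T : ell2 R -> ell2 R) m x : bounded_op T ->
  (forall i k, (m <= i)%N || (m <= k)%N -> T (ell2_unit R i) k = 0) ->
  T x = T (trunc m x).
Proof.
move=> /bounded_opP[lT [C C0 TC]] Tm.
have TB y z : T (y - z) = T y - T z.
  by rewrite addrC -scaleN1r lT scaleN1r addrC.
apply/eqP; rewrite -subr_eq0 -TB; apply/eqP; apply: nrm_eq0.
set y := x - trunc m x; apply/le_anti; rewrite nrm_ge0 andbT.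
apply/ler_addgt0Pr => e e0; rewrite add0r.
have C1 : 0 < C + 1 by rewrite ltr_wpDl.
have [N NP] := trunc_cvg y (divr_gt0 e0 C1).
have TN : T (trunc N y) = 0.
  apply/val_inj/funext => k; rewrite [LHS](linear_trunc N y k lT) [LHS]big1// => i _.
  have [mi|im] := leqP m i; first by rewrite Tm ?mi// mulr0.
  have -> : y i = 0; last by rewrite mul0r.
  have -> : y i = x i - trunc m x i by [].
  by rewrite truncE im subrr.
have -> : T y = T (y - trunc N y) by rewrite TB TN subr0.
apply: le_trans (TC _) _; move: NP; rewrite ltr_pdivlMr// mulrDr mulr1.
have := nrm_ge0 (y - trunc N y); rewrite (mulrC C).
by move: (nrm _) (nrm _ * C); clear => *; lra.
Qed.

End finite_symbols.

Lemma sub_split (V : zmodType) (c a b : V) : a - b = (a - c) + (c - b).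
Proof. by rewrite addrA subrK. Qed.

Lemma sub_scale (A : ringType) (V : lmodType A) (a b : V) : a - b = -1 *: b + a.
Proof. by rewrite scaleN1r addrC. Qed.

Lemma subDD (V : zmodType) (a b c d : V) : (a + b) - (c + d) = (a - c) + (b - d).
Proof. by rewrite opprD addrACA. Qed.

Lemma sum_sq_split (R : realType) (m : nat) (a b c : nat -> R) :
  (forall j, 0 <= a j) -> (forall j, a j <= b j + c j) ->
  \sum_(j < m) a j ^+ 2 <= 2 * \sum_(j < m) b j ^+ 2 + 2 * \sum_(j < m) c j ^+ 2.
Proof.
move=> a0 abc; rewrite !mulr_sumr -big_split/=; apply: ler_sum => j _.
have := a0 j; have := abc j; move: (a j) (b j) (c j) => x y z xyz x0.
have h : x ^+ 2 <= (y + z) ^+ 2 by rewrite ler_pXn2r ?nnegrE// (le_trans x0).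
have := sqr_ge0 (y - z); lra.
Qed.

Lemma comp_arith (R : realType) (C D c a b p q r s : R) : p <= C * c * r ->
  C * c * r <= C * c * (b * s) -> a * q <= a * (D * c * s) ->
  2 * p + 2 * (a * q) <= (2 * (C * b) + 2 * (a * D)) * c * s.
Proof. lra. Qed.

Lemma sum_arith (R : realType) (C D c p q s : R) : p <= C * c * s -> q <= D * c * s ->
  2 * p + 2 * q <= (2 * C + 2 * D) * c * s.
Proof. lra. Qed.

Lemma toeplitz_arith (R : realType) (c a p q r s : R) : p <= c * r ->
  c * r <= c * (a * s) -> a * q <= a * (c * s) ->
  2 * p + 2 * (a * q) <= (2 * a + 2 * a) * c * s.
Proof. lra. Qed.

Section toeplitz_operators.
Variables (R : realType) (n : nat) (Sp : bergman_space R n).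
Local Notation V := 'rV[R[i]]_n.+1.
Local Notation W := (dom Sp).
Local Notation sg := (sigma Sp).
Local Notation K := (ker Sp).
Local Notation L2 := (L2 Sp).
Local Notation B := (bergman Sp).
Implicit Types (z w u v y : V) (f g h : B) (F G : L2) (S T : B -> B).

(** The commutator of multiplication by [x] with S P on L^2; for [S = idfun] it is [x, P]. *)
Definition opcomm S (x : V -> R) F : L2 :=
  mulx x (toL2 (S (proj F))) - toL2 (S (proj (mulx x F))).

(** [C] depends neither on the family [x] nor on [c]: the cutoffs can be chosen after the operator,
    so as to make C c small. *)
Definition commutator_bounded S (C : R) := forall (x : nat -> V -> R) (c : R),
  (forall j, bmfun Sp (x j)) -> 0 <= c ->
  (forall F m, \sum_(j < m) nrmL2 (opcomm idfun (x j) F) ^+ 2 <= c * nrmL2 F ^+ 2) ->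
  forall F m, \sum_(j < m) nrmL2 (opcomm S (x j) F) ^+ 2 <= C * c * nrmL2 F ^+ 2.

(** The properties of polynomials in Toeplitz operators that survive sums and products and from
    which the essential norm is estimated. *)
Definition admissible S := [/\ linear S,
  exists2 C : R, 0 <= C & forall f, nrm (S f) <= C * nrm f,
  exists m, forall f, S (truncB m f) = S f &
  exists2 C : R, 0 <= C & commutator_bounded S C].

Lemma linear_sub S f g : linear S -> S (f - g) = S f - S g.
Proof. by move=> lS; rewrite addrC -(scaleN1r g) lS scaleN1r addrC. Qed.

(** The product rule [x, S T P] F = [x, S P] T P F + S P [x, T P] F. *)
Lemma opcomm_comp S T x F : linear S ->
  opcomm (S \o T) x F = opcomm S x (toL2 (T (proj F))) + toL2 (S (proj (opcomm T x F))).
Proof.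
move=> lS; apply: (etrans (sub_split (toL2 (S (proj (mulx x (toL2 (T (proj F))))))) _ _)).
apply: (f_equal2 +%R).
  by rewrite /opcomm /= proj_toL2.
rewrite -toL2B; congr toL2; rewrite -linear_sub//; congr (S _).
apply: esym; apply: (etrans (projB _ _)); congr (_ - _); exact: proj_toL2.
Qed.

Lemma admissible_comp S T : admissible S -> admissible T -> admissible (S \o T).
Proof.
move=> [lS [a a0 Sa] _ [C C0 cS]] [lT [b b0 Tb] [m mT] [D D0 cT]]; split.
- by move=> c f g /=; rewrite lT lS.
- exists (a * b); first by rewrite mulr_ge0.
  move=> f /=; apply: le_trans (Sa _) _; rewrite -mulrA; exact: ler_wpM2l.
- by exists m => f /=; rewrite mT.
exists (2 * (C * b ^+ 2) + 2 * (a ^+ 2 * D)).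
  by rewrite addr_ge0// mulr_ge0// mulr_ge0 ?sqr_ge0.
move=> x c bx c0 xc F k.
have h2 : nrmL2 (toL2 (T (proj F))) ^+ 2 <= b ^+ 2 * nrmL2 F ^+ 2.
  rewrite -exprMn ler_pXn2r ?nnegrE ?nrmL2_ge0 ?mulr_ge0// ?nrmL2_ge0//.
  rewrite -nrm_toL2; apply: le_trans (Tb _) _; apply: ler_wpM2l => //; exact: nrm_proj.
have h1 j : nrmL2 (opcomm (S \o T) (x j) F) <=
    nrmL2 (opcomm S (x j) (toL2 (T (proj F)))) + a * nrmL2 (opcomm T (x j) F).
  have -> := opcomm_comp T (x j) F lS; apply: le_trans (nrmL2D _ _) _; apply: lerD;
    first exact: lexx.
  rewrite -nrm_toL2; apply: le_trans (Sa _) _; apply: ler_wpM2l => //; exact: nrm_proj.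
apply: le_trans (sum_sq_split k (fun j => nrmL2_ge0 _) h1) _.
have -> : \sum_(j < k) (a * nrmL2 (opcomm T (x j) F)) ^+ 2 =
    a ^+ 2 * \sum_(j < k) nrmL2 (opcomm T (x j) F) ^+ 2.
  by rewrite mulr_sumr; apply: eq_bigr => j _; rewrite exprMn.
have h3 := cS x c bx c0 xc (toL2 (T (proj F))) k.
have h4 := cT x c bx c0 xc F k.
have h5 : C * c * nrmL2 (toL2 (T (proj F))) ^+ 2 <= C * c * (b ^+ 2 * nrmL2 F ^+ 2).
  exact: ler_wpM2l (mulr_ge0 C0 c0) _ _ h2.
have h6 := ler_wpM2l (sqr_ge0 a) h4.
exact: (comp_arith h3 h5 h6).
Qed.

Lemma admissibleD S T : admissible S -> admissible T -> admissible (S \+ T).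
Proof.
move=> [lS [a a0 Sa] [m mS] [C C0 cS]] [lT [b b0 Tb] [m' mT] [D D0 cT]]; split.
- by move=> c f g /=; rewrite lT lS scalerDr addrACA.
- exists (a + b); first by rewrite addr_ge0.
  move=> f /=; apply: le_trans (nrmD _ _) _; rewrite mulrDl; exact: lerD.
- exists (maxn m m') => f /=.
  rewrite -(mS (truncB _ f)) -(mT (truncB _ f)) (truncB_le _ (leq_maxl m m')).
  by rewrite (truncB_le _ (leq_maxr m m')) mS mT.
exists (2 * C + 2 * D); first by rewrite addr_ge0// mulr_ge0.
move=> x c bx c0 xc F k.
have h1 j : nrmL2 (opcomm (S \+ T) (x j) F) <= nrmL2 (opcomm S (x j) F) + nrmL2 (opcomm T (x j) F).
  apply: (le_trans _ (nrmL2D _ _)).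
  have -> : opcomm (S \+ T) (x j) F = opcomm S (x j) F + opcomm T (x j) F; last exact: lexx.
  rewrite /opcomm; apply: (etrans (f_equal2 (fun a b => mulx (x j) a - b)
    (toL2D (S (proj F)) (T (proj F))) (toL2D (S (proj (mulx (x j) F))) (T (proj (mulx (x j) F)))))).
  apply: (etrans (f_equal (fun a => a - _) (mulxD _ _ (bx j)))); exact: subDD.
apply: le_trans (sum_sq_split k (fun j => nrmL2_ge0 _) h1) _.
have h3 := cS x c bx c0 xc F k.
have h4 := cT x c bx c0 xc F k.
exact: (sum_arith h3 h4).
Qed.

Section symbol.
Variable u : V -> ell2 R -> ell2 R.
Hypothesis uL : Linfty_fin Sp u.

Definition symbol_mul F : L2 := L2of Sp (fun z => u z (F z)).

Lemma symbol_support : exists m, forall z x, W z -> u z x = u z (trunc m x).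
Proof.
have [uB _ _ [m um]] := uL; exists m => z x Wz.
by apply: finite_symbol; [exact: uB|exact: um].
Qed.

Lemma cmeasurable_sum m (f : nat -> V -> R[i]) : (forall i, cmeasurable W (f i)) ->
  cmeasurable W (fun z => \sum_(i < m) f i z).
Proof.
move=> mf; elim: m => [|m IH].
  have -> : (fun z => \sum_(i < 0) f i z) = (fun=> 0) by apply/funext => z; rewrite big_ord0.
  exact: cmeasurable_cst.
have -> : (fun z => \sum_(i < m.+1) f i z) = (fun z => \sum_(i < m) f i z + f m z).
  by apply/funext => z; rewrite big_ord_recr.
exact: cmeasurableD.
Qed.

Lemma eq_cmeasurable (f g : V -> R[i]) : (forall z, W z -> f z = g z) ->
  cmeasurable W f -> cmeasurable W g.
Proof.
move=> fg [m1 m2]; split.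
  by apply: eq_measurable_fun m1 => z /set_mem Wz; rewrite fg.
by apply: eq_measurable_fun m2 => z /set_mem Wz; rewrite fg.
Qed.

(** As u(z) sees only finitely many coordinates, each coordinate of u(z) F(z) is a finite sum of
    products of measurable functions; this gives the measurability. *)
Lemma symbol_bound : exists2 M : R, 0 <= M & forall F,
  (fun z => u z (F z)) \in l2_pred Sp /\ nrmL2 (symbol_mul F) <= M * nrmL2 F.
Proof.
have [uB mu [M uM] _] := uL; have [m um] := symbol_support.
exists `|M|; first exact: normr_ge0.
move=> F; apply: l2_dom; first exact: normr_ge0.
  move=> k; have [mF _] := l2P F.
  have h : cmeasurable W (fun z => \sum_(i < m) F z i * u z (ell2_unit R i) k).
    apply: (@cmeasurable_sum m (fun i z => F z i * u z (ell2_unit R i) k)) => i.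
    exact: cmeasurableM (mF i) (mu i k).
  apply: eq_cmeasurable h => z Wz.
  by rewrite (um z _ Wz); apply: esym; apply: linear_trunc; case: (uB z Wz).
move: uM; apply: (@filterS _ _ (ae_filter_ringOfSetsType sg)) => z /= h Wz.
have [lu _] := uB z Wz; refine (linear_opnorm (F z) lu _).
by apply: le_trans (h Wz) _; rewrite lee_fin ler_norm.
Qed.

Lemma symbol_mulE F z : symbol_mul F z = u z (F z).
Proof.
have [M _ MP] := symbol_bound; have [h _] := MP F.
by rewrite /symbol_mul (L2ofE h).
Qed.

Lemma toeplitzE f : toeplitz u f = proj (symbol_mul (toL2 f)).
Proof.
rewrite -projectionE; congr projection; apply/funext => z.
by rewrite symbol_mulE.
Qed.

Lemma symbol_linear z : W z -> linear (u z).
Proof. by move=> Wz; have [uB _ _ _] := uL; case: (uB z Wz). Qed.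

Lemma proj_symbol_mulL (c : R[i]) F G : proj (symbol_mul (c *: F + G)) =
  c *: proj (symbol_mul F) + proj (symbol_mul G).
Proof.
transitivity (proj (c *: symbol_mul F + symbol_mul G)); last by apply: (etrans (projD _ _));
  rewrite projZ.
apply: proj_eqW => z Wz; apply: (etrans (symbol_mulE _ z)).
apply: (etrans (symbol_linear Wz c (F z) (G z))).
have h : (c *: symbol_mul F + symbol_mul G) z = c *: symbol_mul F z + symbol_mul G z by [].
apply: esym; apply: (etrans h).
exact: (f_equal2 (fun a b => c *: a + b) (symbol_mulE F z) (symbol_mulE G z)).
Qed.

Lemma proj_symbol_mulB F G : proj (symbol_mul (F - G)) = proj (symbol_mul F) - proj (symbol_mul G).
Proof.
apply: (etrans (f_equal (fun H => proj (symbol_mul H)) (sub_scale F G))).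
exact: (etrans (proj_symbol_mulL (-1) G F) (esym (sub_scale _ _))).
Qed.

Lemma proj_symbol_mul_mulx x F : bmfun Sp x ->
  proj (mulx x (symbol_mul F)) = proj (symbol_mul (mulx x F)).
Proof.
move=> bx; apply: proj_eqW => z Wz.
apply: (etrans (mulxE (symbol_mul F) z bx)); apply: esym; apply: (etrans (symbol_mulE _ z)).
apply: (etrans (f_equal (u z) (mulxE F z bx))).
apply: (etrans _ (esym (f_equal ( *:%R (x z)%:C%C) (symbol_mulE F z)))).
have := symbol_linear Wz (x z)%:C%C (F z) 0.
have u0 : u z 0 = 0.
  by have := symbol_linear Wz (-1) 0 0; rewrite scaler0 addr0 scaleN1r addNr.
by rewrite u0 !addr0.
Qed.

(** The symbol commutes with the scalar [x], so only the two projections in P u P produce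
    commutators. *)
Lemma opcomm_toeplitz x F : bmfun Sp x ->
  opcomm (toeplitz u) x F = opcomm idfun x (symbol_mul (toL2 (proj F))) +
    toL2 (proj (symbol_mul (opcomm idfun x F))).
Proof.
move=> bx; rewrite /opcomm !toeplitzE.
apply: (etrans (sub_split (toL2 (proj (mulx x (symbol_mul (toL2 (proj F)))))) _ _)).
apply: (f_equal2 +%R); first by [].
apply: (etrans (esym (toL2B _ _))); congr toL2.
apply: esym; apply: (etrans (proj_symbol_mulB (mulx x (toL2 (proj F))) (toL2 (proj (mulx x F))))).
exact: (f_equal (fun a => a - _) (esym (proj_symbol_mul_mulx (toL2 (proj F)) bx))).
Qed.

Lemma admissible_toeplitz : admissible (toeplitz u).
Proof.
have [M M0 MP] := symbol_bound; have [m um] := symbol_support.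
have hM F : nrmL2 (symbol_mul F) <= M * nrmL2 F by case: (MP F).
split.
- move=> c f g; rewrite !toeplitzE; apply: (etrans _ (proj_symbol_mulL c (toL2 f) (toL2 g))).
  by congr (proj (symbol_mul _)); rewrite toL2D toL2Z.
- exists M => // f; rewrite toeplitzE nrm_toL2 (nrm_toL2 f) -nrm_toL2.
  exact: le_trans (nrm_proj _) (hM _).
- exists m => f; rewrite !toeplitzE; apply: proj_eqW => z Wz.
  apply: (etrans (symbol_mulE _ z)); apply: esym; apply: (etrans (symbol_mulE _ z)).
  by rewrite (um z _ Wz) [toL2 (truncB m f) z]truncBE.
exists (2 * M ^+ 2 + 2 * M ^+ 2); first by rewrite addr_ge0// mulr_ge0// sqr_ge0.
move=> x c bx c0 xc F k.
have h1 j : nrmL2 (opcomm (toeplitz u) (x j) F) <=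
    nrmL2 (opcomm idfun (x j) (symbol_mul (toL2 (proj F)))) + M * nrmL2 (opcomm idfun (x j) F).
  have -> := opcomm_toeplitz F (bx j); apply: le_trans (nrmL2D _ _) _; apply: lerD;
    first exact: lexx.
  rewrite -nrm_toL2; exact: le_trans (nrm_proj _) (hM _).
apply: le_trans (sum_sq_split k (fun j => nrmL2_ge0 _) h1) _.
have -> : \sum_(j < k) (M * nrmL2 (opcomm idfun (x j) F)) ^+ 2 =
    M ^+ 2 * \sum_(j < k) nrmL2 (opcomm idfun (x j) F) ^+ 2.
  by rewrite mulr_sumr; apply: eq_bigr => j _; rewrite exprMn.
have h2 : nrmL2 (symbol_mul (toL2 (proj F))) ^+ 2 <= M ^+ 2 * nrmL2 F ^+ 2.
  rewrite -exprMn ler_pXn2r ?nnegrE ?nrmL2_ge0 ?mulr_ge0// ?nrmL2_ge0//.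
  apply: le_trans (hM _) _; rewrite -nrm_toL2; apply: ler_wpM2l => //; exact: nrm_proj.
have h3 := xc (symbol_mul (toL2 (proj F))) k.
have h4 := ler_wpM2l (sqr_ge0 M) (xc F k).
have h5 := ler_wpM2l c0 h2.
exact: (toeplitz_arith h3 h5 h4).
Qed.

End symbol.

Lemma admissible_sum T : toeplitz_sum T -> admissible T.
Proof.
have hp S : toeplitz_product S -> admissible S.
  elim=> [u uL|u S' uL _ IH]; first exact: admissible_toeplitz.
  exact: admissible_comp (admissible_toeplitz uL) IH.
elim=> [S /hp//|S S' /hp aS _ aS']; exact: admissibleD.
Qed.

End toeplitz_operators.

(** * Essential norm *)

Section localization.
Variables (R : realType) (n : nat) (Sp : bergman_space R n).
Local Notation V := 'rV[R[i]]_n.+1.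
Local Notation W := (dom Sp).
Local Notation sg := (sigma Sp).
Local Notation K := (ker Sp).
Local Notation kn := (knrm W sg K).
Local Notation inv := (invol Sp).
Local Notation d := (mdis Sp).
Local Notation L2 := (L2 Sp).
Local Notation B := (bergman Sp).
Implicit Types (z w u v y : V) (f g h : B) (F G : L2) (S T : B -> B).
Hypothesis nd : forall z, W z -> kn z != 0.
Hypothesis kappa_gt0 : 0 < kappa Sp.

Lemma cutoff_radius (N c s : R) : 0 < N -> 0 < c -> 0 < s ->
  exists2 r, 0 < r & 2 * N * (s / r) ^+ 2 <= c.
Proof.
move=> N0 c0 s0; pose q := 2 * N / c; have q0 : 0 < q by rewrite divr_gt0// mulr_gt0.
have q1 : 0 < q + 1 by rewrite addr_gt0.
exists (s * (q + 1)); first by rewrite mulr_gt0.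
have -> : s / (s * (q + 1)) = (q + 1)^-1 by rewrite invfM mulrA divff ?mul1r// gt_eqF.
have i0 : 0 < (q + 1)^-1 by rewrite invr_gt0.
have i1 : (q + 1)^-1 <= 1 by rewrite invf_le1// lerDr ltW.
apply: (@le_trans _ _ (2 * N * (q + 1)^-1)).
  by rewrite ler_wpM2l ?mulr_ge0 ?(ltW N0)// expr2 ger_pMr.
rewrite ler_pdivrMr//; have -> : 2 * N = c * q by rewrite /q mulrCA divff ?mulr1// gt_eqF.
by rewrite ler_pM2l// lerDl.
Qed.

Lemma sum_sq_diff (m : nat) (a b : nat -> R) : \sum_(j < m) (a j - b j) ^+ 2 <=
  2 * \sum_(j < m) a j ^+ 2 + 2 * \sum_(j < m) b j ^+ 2.
Proof.
rewrite !mulr_sumr -big_split/=; apply: ler_sum => j _.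
have := sqr_ge0 (a j + b j); move: (a j) (b j); clear => x y h; nra.
Qed.

Lemma far_points_arith (p q k c N : R) : p <= 9 * N -> q <= 9 * N -> 36 * N <= k -> 0 <= c ->
  2 * p + 2 * q <= c + k.
Proof. lra. Qed.

Definition cutoffs (N c r : R) (a : nat -> V) (x : nat -> V -> R) :=
  [/\ (forall j, W (a j)) /\ 0 < r, (forall j, bmfun Sp (x j)) /\ (forall j z, W z ->
    0 <= x j z <= 3),
      (forall j z, W z -> 3 * r <= d (a j) z -> x j z = 0),
      forall z, W z -> (exists m0, forall m, (m0 <= m)%N -> 1 <= \sum_(j < m) x j z ^+ 2) /\
        forall m, \sum_(j < m) x j z ^+ 2 <= 9 * N &
      forall F m, \sum_(j < m) nrmL2 (opcomm idfun (x j) F) ^+ 2 <= c * nrmL2 F ^+ 2].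

(** [N] comes before [c], since the constant of the final estimate rests on it. The hypothesis of
    the Schur test is checked separately for d(z, w) <= s, with r large compared to s, and for d(z,
    w) > s. *)
Lemma cutoffs_ex : exists2 N : R, 0 < N & forall c, 0 < c -> exists r a x, cutoffs N c r a x.
Proof.
have [t [delta [C [d0 C0 schur]]]] := schur_constants nd kappa_gt0.
have [N N0 NP] := packing nd.
exists N => // c c0.
have C2 : 0 < (2 * C) ^+ 2 by rewrite exprn_gt0// mulr_gt0.
(* The Schur test multiplies the constant by (2 C)^2. *)
pose c' := c / (2 * C) ^+ 2; have c'0 : 0 < c' by rewrite divr_gt0.
(* For points at distance more than s, the sum of squared differences is at most 2 (9 N + 9 N) = 36
   N, and ||K_(phi_z(w))||^delta is at least [b]. *)
pose b := 36 * N / c'; have b0 : 0 < b by rewrite divr_gt0// mulr_gt0.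
have [s0 s0P] := kn_large Sp (b `^ delta^-1).
pose s := Num.max s0 1; have s_gt0 : 0 < s by rewrite lt_max ltr01 orbT.
(* For points within distance [s], each cutoff varies by at most s / r, and at most 2 N of them are
   involved. *)
have [r r0 rP] := cutoff_radius N0 c'0 s_gt0.
have [a [Wa aP]] := d_sep Sp.
have packN (l : seq nat) z : W z -> uniq l ->
    (forall i, i \in l -> d (a i) z < 3 * r) ->
    (forall i j, i \in l -> j \in l -> i != j -> r <= d (a i) (a j)) ->
    (size l)%:R <= N.
  by move=> Wz; exact: NP.
have le3 j z : W z -> 0 <= hat Sp a r j z <= 3.
  by move=> Wz; rewrite hat_ge0/=; exact: (hat_le3 Wa r0).
have bx j : bmfun Sp (hat Sp a r j).
  split; first exact: (measurable_hat Wa r0).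
  by exists 3 => z Wz; have /andP[h1 h2] := le3 j z Wz; rewrite ger0_norm.
exists r, a, (hat Sp a r); split.
- by [].
- by [].
- by move=> j z Wz; exact: (hat_supp r0).
- move=> z Wz; split; first exact: (hat_cover Wa r0 aP Wz).
  by move=> m; exact: (hat_sum Wa r0 packN m Wz).
move=> F m.
have -> : c = c' * (2 * C) ^+ 2 by rewrite /c' divfK// gt_eqF.
apply: (schur_commutator nd C0 schur F bx (ltW c'0)) => z w Wz Ww.
have Wi := invol_dom Wz Ww.
have p0 : 0 <= kn (inv z w) `^ delta := powR_ge0 _ _.
have [dzw|dzw] := leP (d z w) s.
  have e0 : 0 <= s / r by rewrite divr_ge0// ltW.
  apply: (@le_trans _ _ c'); last by rewrite ler_peMr ?(ltW c'0)// lerDl.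
  apply: le_trans rP; apply: (hat_diff Wa r0 packN m Wz Ww e0) => j.
  apply: le_trans (hat_lip Wa r0 j Wz Ww) _.
  by rewrite ler_pM2r// invr_gt0.
have bk : b <= kn (inv z w) `^ delta.
  have h : b `^ delta^-1 <= kn (inv z w).
    apply: s0P => //; rewrite d_inv0// d_sym//.
    by apply: le_lt_trans dzw; rewrite le_max lexx.
  have <- : (b `^ delta^-1) `^ delta = b.
    by rewrite -powRrM mulVf ?gt_eqF// powRr1// ltW.
  by apply: ge0_ler_powR; rewrite ?nnegrE ?powR_ge0 ?kn_ge0 ?(ltW d0).
apply: le_trans (sum_sq_diff m (hat Sp a r ^~ z) (hat Sp a r ^~ w)) _.
have h1 := hat_sum Wa r0 packN m Wz.
have h2 := hat_sum Wa r0 packN m Ww.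
have cb : c' * b = 36 * N by rewrite /b mulrCA divff ?mulr1// gt_eqF.
have h3 : c' * b <= c' * kn (inv z w) `^ delta by rewrite ler_pM2l.
rewrite cb in h3; rewrite mulrDr mulr1.
exact: (far_points_arith h1 h2 h3 (ltW c'0)).
Qed.

End localization.

(** * Bounding the essential norm of polynomials in Toeplitz operators *)

Section lower_bound.
Variables (R : realType) (n : nat) (Sp : bergman_space R n).
Local Notation V := 'rV[R[i]]_n.+1.
Local Notation bV := (borelC R n).
Local Notation W := (dom Sp).
Local Notation sg := (sigma Sp).
Local Notation K := (ker Sp).
Local Notation kn := (knrm W sg K).
Local Notation d := (mdis Sp).
Local Notation L2 := (L2 Sp).
Local Notation B := (bergman Sp).
Implicit Types (z w u v y : V) (f g h : B) (F G : L2) (S T : B -> B).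

Lemma seq_bound (T : eqType) (s : seq T) (Q : T -> R -> Prop) :
  (forall x r r', r <= r' -> Q x r -> Q x r') ->
  (forall x, x \in s -> exists r, Q x r) -> exists r, forall x, x \in s -> Q x r.
Proof.
move=> mQ; elim: s => [|x s IH] sQ; first by exists 0.
have [r1 r1P] : exists r, forall x, x \in s -> Q x r.
  by apply: IH => y ys; apply: sQ; rewrite inE ys orbT.
have [r2 r2P] := sQ x (mem_head x s).
exists (Num.max r1 r2) => y; rewrite inE => /predU1P[->|ys].
  by apply: mQ r2P; rewrite le_max lexx orbT.
by apply: mQ (r1P y ys); rewrite le_max lexx.
Qed.

Lemma limsup_infinity_lt (g : V -> R) (alpha e : R) : 0 < e ->
  (limsup_infinity Sp g <= alpha%:E)%E ->
  exists r, forall z, W z -> r < d z 0 -> g z < alpha + e.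
Proof.
move=> e0; rewrite /limsup_infinity ge_max => /andP[_ h].
have : (limf_esup (EFin \o g) (at_infinity d) < (alpha + e)%:E)%E.
  by apply: le_lt_trans h _; rewrite lte_fin ltrDl.
move=> /ereal_inf_lt[_ [U [r _ rU] <-] Ue].
exists r => z Wz rz; rewrite -lte_fin; apply: le_lt_trans Ue.
by apply: ereal_sup_ubound; exists z => //; apply: rU.
Qed.

Lemma limsup_infinity_le (g : V -> R) (alpha r : R) : 0 <= alpha ->
  (forall z, W z -> r < d z 0 -> g z <= alpha) ->
  (limsup_infinity Sp g <= alpha%:E)%E.
Proof.
move=> a0 h; rewrite /limsup_infinity ge_max lee_fin a0/=.
apply: (@le_trans _ _ (ereal_sup ((EFin \o g) @` [set z | W z /\ r < d z 0]))).
  by apply: ereal_inf_lbound; exists [set z | W z /\ r < d z 0] => //; exists r.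
by apply: ge_ereal_sup => _ [z [Wz rz] <-]; rewrite lee_fin; exact: h.
Qed.

Lemma measurable_sq_mul (x : V -> R) F : bmfun Sp x ->
  measurable_fun (W : set bV) (fun z => (x z ^+ 2 * nrm (F z) ^+ 2)%:E).
Proof.
move=> [mx _]; apply/measurable_EFinP; apply: measurable_funM.
  exact: measurable_funX.
exact: measurable_nrm2.
Qed.

Lemma nrmL2_mulx_sq (x : V -> R) F : bmfun Sp x ->
  ((nrmL2 (mulx x F) ^+ 2)%:E = \int[sg]_(z in W) (x z ^+ 2 * nrm (F z) ^+ 2)%:E)%E.
Proof.
move=> bx; rewrite nrmL2_sqE; apply: eq_integral => z _; congr (_%:E).
have -> : mulx x F z = (x z)%:C%C *: F z := mulxE F z bx.
by rewrite nrmZ exprMn nrmcR real_normK// num_real.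
Qed.

(** The number of cutoffs needed at [z] depends on [z], so the infinite sum is integrated and its
    partial sums are bounded. *)
Lemma nrmL2_cover (x : nat -> V -> R) F (b : R) : (forall j, bmfun Sp (x j)) ->
  (forall z, W z -> exists m0, forall m, (m0 <= m)%N -> 1 <= \sum_(j < m) x j z ^+ 2) ->
  (forall m, \sum_(j < m) nrmL2 (mulx (x j) F) ^+ 2 <= b) -> nrmL2 F ^+ 2 <= b.
Proof.
move=> bx cx xb; rewrite -lee_fin nrmL2_sqE.
pose f j z := (x j z ^+ 2 * nrm (F z) ^+ 2)%:E : \bar R.
have f0 j z : (0 <= f j z)%E by rewrite lee_fin mulr_ge0 ?sqr_ge0.
have mf j : measurable_fun (W : set bV) (f j) by exact: measurable_sq_mul.
apply: (@le_trans _ _ (\int[sg]_(z in W) (\sum_(0 <= j <oo) f j z))%E).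
  apply: ge0_le_integral.
  - exact: mdom.
  - by move=> z _; rewrite lee_fin sqr_ge0.
  - by apply/measurable_EFinP; exact: measurable_nrm2.
  - exact: ge0_emeasurable_sum.
  move=> z Wz; have [m mP] := cx z Wz.
  apply: le_trans (nneseries_lim_ge m _); last by move=> *; exact: f0.
  rewrite big_mkord sumEFin lee_fin -mulr_suml.
  by rewrite ler_peMl ?sqr_ge0// mP.
rewrite integral_nneseries; [|exact: mdom|exact: mf|by move=> *; exact: f0].
apply: lime_le.
  by apply: is_cvg_nneseries => j _ _; apply: integral_ge0 => z _; exact: f0.
apply: nearW => m; rewrite big_mkord.
rewrite (_ : (\sum_(j < m) _)%E = (\sum_(j < m) nrmL2 (mulx (x j) F) ^+ 2)%:E).
  by rewrite lee_fin.
by rewrite -sumEFin; apply: eq_bigr => j _; rewrite nrmL2_mulx_sq.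
Qed.

Lemma nrmL2_sum (x : nat -> V -> R) F (b : R) m : (forall j, bmfun Sp (x j)) -> 0 <= b ->
  (forall z, W z -> \sum_(j < m) x j z ^+ 2 <= b) ->
  \sum_(j < m) nrmL2 (mulx (x j) F) ^+ 2 <= b * nrmL2 F ^+ 2.
Proof.
move=> bx b0 xb; rewrite -lee_fin -sumEFin EFinM nrmL2_sqE.
rewrite -(ge0_integralZl sg (mdom Sp)); first last.
- by rewrite lee_fin.
- by move=> z _; rewrite lee_fin sqr_ge0.
- by apply/measurable_EFinP; exact: measurable_nrm2.
rewrite (eq_bigr (fun j : 'I_m => \int[sg]_(z in W) (x j z ^+ 2 * nrm (F z) ^+ 2)%:E)%E);
  last by move=> j _; exact: nrmL2_mulx_sq.
rewrite -ge0_integral_sum; first last.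
- by move=> j z _; rewrite lee_fin mulr_ge0 ?sqr_ge0.
- by move=> j; exact: measurable_sq_mul.
- exact: mdom.
apply: ge0_le_integral.
- exact: mdom.
- by move=> z _; apply: sume_ge0 => j _; rewrite lee_fin mulr_ge0 ?sqr_ge0.
- by apply: emeasurable_sum => j; exact: measurable_sq_mul.
- by apply: measurable_funeM; apply/measurable_EFinP; exact: measurable_nrm2.
move=> z Wz; rewrite sumEFin -EFinM lee_fin -mulr_suml.
by rewrite ler_wpM2r ?sqr_ge0// xb.
Qed.

Hypothesis nd : forall z, W z -> kn z != 0.

(** After translation to the ball around 0, truncated projections have a finite net of unit size.
    The limsup bound holds for each of its members from some distance on, hence for all of them at
    once, and it passes to [G] because every U_y^* is an isometry. *)
Lemma local_bound S (alpha e r : R) : admissible S -> 0 <= alpha -> 0 < e ->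
  (forall f, nrm f <= 1 ->
    (limsup_infinity Sp (fun z => nrm (translate_op S z f)) <= alpha%:E)%E) ->
  exists r0, forall y, W y -> r0 < d y 0 -> forall G, supp (mball Sp y r) G ->
    nrm (S (proj G)) <= (alpha + e) * nrmL2 G.
Proof.
move=> [lS [C C0 SC] [m Sm] _] al0 e0 Sal.
have C1 : 0 < C + 1 by rewrite ltr_wpDl.
have e1 : 0 < e / 2 / (C + 1) by rewrite !divr_gt0.
have e2 : 0 < e / 2 by rewrite divr_gt0.
have [s [sA sP]] := truncB_proj_net nd m r e1.
have [r0 r0P] : exists r0, forall G, G \in s -> forall y, W y -> r0 < d y 0 ->
    nrm (S (Uadj y (truncB m (proj G)))) < alpha + e / 2.
  apply: (@seq_bound _ s (fun G r0 => forall y, W y -> r0 < d y 0 ->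
    nrm (S (Uadj y (truncB m (proj G)))) < alpha + e / 2)).
    by move=> G p q pq h y Wy qy; apply: h => //; exact: le_lt_trans qy.
  move=> G Gs; have [_ G1] := sA G Gs.
  have f1 : nrm (truncB m (proj G)) <= 1.
    by apply: le_trans (nrm_truncB _ _) _; apply: le_trans (nrm_proj _) _.
  have [p pP] := limsup_infinity_lt e2 (Sal _ f1).
  by exists p => y Wy py; have := pP y Wy py; rewrite translate_op_nrm.
exists r0 => y Wy ry.
have main G : supp (mball Sp y r) G -> nrmL2 G <= 1 -> nrm (S (proj G)) <= alpha + e.
  move=> sG G1.
  have sU : supp (mball Sp 0 r) (translL2 y G).
    move=> w Ww nw; rewrite (translL2E nd G w Wy) sG ?scaler0//; first exact: invol_dom.
    move=> [_ dw]; apply: nw; split=> //; move: dw.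
    by rewrite -(d_inv Wy Wy Ww) inv_z.
  have hU : nrmL2 (translL2 y G) <= 1 by rewrite nrmL2_translL2.
  have [G' Gs GG'] := sP _ sU hU.
  rewrite (proj_Uadj nd G Wy) -Sm (truncB_Uadj m _ nd Wy).
  set f := truncB m (proj (translL2 y G)) in GG' *; set f' := truncB m (proj G') in GG'.
  have -> : S (Uadj y f) = S (Uadj y (f - f')) + S (Uadj y f').
    have -> : Uadj y (f - f') = Uadj y f - Uadj y f'.
      apply: (etrans (f_equal (Uadj y) (sub_scale f f'))).
      rewrite (UadjD nd _ _ Wy) (UadjZ nd _ _ Wy); apply: esym; exact: sub_scale.
    by rewrite linear_sub// subrK.
  apply: le_trans (nrmD _ _) _.
  have h1 := r0P G' Gs y Wy ry.
  have h2 : nrm (S (Uadj y (f - f'))) <= e / 2.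
    apply: le_trans (SC _) _; rewrite (nrm_Uadj nd _ Wy).
    apply: (@le_trans _ _ (C * (e / 2 / (C + 1)))); first by rewrite ler_wpM2l// ltW.
    by rewrite mulrCA ger_pMr// ler_pdivrMr// mul1r lerDl.
  apply: le_trans (lerD h2 (ltW h1)) _.
  by clear; lra.
move=> G sG; have [G0|G0] := eqVneq (nrmL2 G) 0.
  have := le_trans (SC (proj G)) (ler_wpM2l C0 (nrm_proj G)).
  by rewrite G0 !mulr0.
have Gp : 0 < nrmL2 G by rewrite lt_neqAle eq_sym G0 nrmL2_ge0.
pose c : R[i] := ((nrmL2 G)^-1)%:C%C.
have nc : nrm c = (nrmL2 G)^-1 by rewrite nrmcR ger0_norm ?invr_ge0 ?nrmL2_ge0.
have scG : supp (mball Sp y r) (c *: G).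
  move=> z Wz nz; have -> : (c *: G) z = c *: G z by [].
  by rewrite sG// scaler0.
have hcG : nrmL2 (c *: G) <= 1 by rewrite nrmL2Z nc mulVf.
have := main _ scG hcG.
have -> : S (proj (c *: G)) = c *: S (proj G).
  have S0 : S 0 = 0 := linear_fun0 lS.
  rewrite projZ; have := lS c (proj G) 0; rewrite S0 !addr0; exact.
by rewrite nrmZ nc mulrC ler_pdivrMr.
Qed.

Lemma mulxZ (x : V -> R) (c : R[i]) F : bmfun Sp x -> mulx x (c *: F) = c *: mulx x F.
Proof.
move=> bx; apply: L2_ext => z; apply: (etrans (mulxE (c *: F) z bx)).
have E : (c *: mulx x F) z = c *: mulx x F z by [].
apply: esym; apply: (etrans E); apply: (etrans (f_equal ( *:%R c) (mulxE F z bx))).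
have E' : (c *: F) z = c *: F z by [].
rewrite E'; move: (F z) => y; by rewrite !scalerA mulrC.
Qed.

Definition localize S (A : set V) f : B := S (proj (mulx \1_A (toL2 f))).

Lemma localize_linear S (A : set V) : linear S -> measurable (A : set bV) ->
  linear (localize S A).
Proof.
move=> lS mA c f g; have bA := bmfun_indic Sp mA; rewrite /localize.
have -> : toL2 (c *: f + g) = c *: toL2 f + toL2 g.
  by apply: (etrans (toL2D (c *: f) g)); exact: (f_equal (fun a => a + toL2 g) (toL2Z c f)).
have -> : mulx \1_A (c *: toL2 f + toL2 g) = c *: mulx \1_A (toL2 f) + mulx \1_A (toL2 g).
  apply: (etrans (mulxD (c *: toL2 f) (toL2 g) bA)).
  exact: (f_equal (fun a => a + _) (mulxZ c (toL2 f) bA)).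
have -> : proj (c *: mulx \1_A (toL2 f) + mulx \1_A (toL2 g)) =
    c *: proj (mulx \1_A (toL2 f)) + proj (mulx \1_A (toL2 g)).
  apply: (etrans (projD _ _)); exact: (f_equal (fun a => a + _) (projZ c _)).
exact: lS.
Qed.

(** Truncating the argument does not change [S], so the unit ball is mapped into the image under [S]
    of a totally bounded set. *)
Lemma localize_compact S (rho : R) : admissible S -> compact_op (localize S (mball Sp 0 rho)).
Proof.
move=> [lS [C C0 SC] [m Sm] _].
have mD : measurable (mball Sp 0 rho : set bV) := measurable_ballW rho (@dom0 _ _ Sp).
split; first exact: localize_linear.
apply: totally_bounded_precompact => e e0.
have C1 : 0 < C + 1 by rewrite ltr_wpDl.
have e1 : 0 < e / (C + 1) by rewrite divr_gt0.
have [s [_ sP]] := truncB_proj_net nd m rho e1.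
exists [seq S (truncB m (proj G)) | G <- s] => _ [f f1 <-].
have s1 : supp (mball Sp 0 rho) (mulx \1_(mball Sp 0 rho) (toL2 f)) := supp_indic _ mD.
have s2 : nrmL2 (mulx \1_(mball Sp 0 rho) (toL2 f)) <= 1.
  by apply: le_trans (nrmL2_indic _ mD) _; rewrite -nrm_toL2.
have [G' Gs GG'] := sP _ s1 s2; exists (S (truncB m (proj G'))); first exact: map_f.
rewrite /localize -(Sm (proj (mulx _ _))) -linear_sub//.
apply: le_lt_trans (SC _) _.
apply: (@le_lt_trans _ _ (C * (e / (C + 1)))); first by rewrite ler_wpM2l// ltW.
by rewrite mulrCA -ltr_pdivlMl// mulVf ?gt_eqF// ltr_pdivrMr// mul1r ltrDl.
Qed.

Lemma sub_localize S (A : set V) f : linear S -> measurable (A : set bV) ->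
  S f - localize S A f = S (proj (mulx \1_(~` A) (toL2 f))).
Proof.
move=> lS mA; rewrite /localize -linear_sub//; congr (S _).
rewrite -{1}(proj_toL2 f); apply: (etrans (esym (projB _ _))); apply: proj_eqW => z Wz.
have E : (toL2 f - mulx \1_A (toL2 f)) z = toL2 f z - mulx \1_A (toL2 f) z by [].
apply: (etrans E); have mC : measurable (~` A : set bV) by exact: measurableC.
have E1 : mulx \1_A (toL2 f) z = (\1_A z : R)%:C%C *: toL2 f z :=
  mulxE _ z (bmfun_indic Sp mA).
have E2 : mulx \1_(~` A) (toL2 f) z = (\1_(~` A) z : R)%:C%C *: toL2 f z :=
  mulxE _ z (bmfun_indic Sp mC).
apply: (etrans (f_equal (fun a => toL2 f z - a) E1)); apply: esym; apply: (etrans E2).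
move: (toL2 f z) => y; rewrite !indicE in_setC.
by case: (z \in A); rewrite /= ?scale1r ?scale0r ?subrr ?subr0.
Qed.

Lemma ess_norm_le_opnorm S A (C : R) : compact_op A ->
  (forall f, nrm f <= 1 -> nrm (S f - A f) <= C) -> (ess_norm S <= C%:E)%E.
Proof.
move=> cA h; apply: (@le_trans _ _ (opnorm (S \- A))).
  by apply: ereal_inf_lbound; exists A.
exact: opnorm_le.
Qed.

Hypothesis kappa_gt0 : 0 < kappa Sp.

(** Origin of the constant 18 N + 1: twice the overlap 9 N of the cutoffs, plus 1 for the
    commutators, which the choice of [c] keeps below b^2. *)
Lemma ess_norm_arith (N Cs c b e : R) : 0 <= Cs -> 0 < e -> e <= b -> 
  c = e ^+ 2 / (2 * Cs + 1) -> 0 < N ->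
  2 * (Cs * c) + 2 * (b ^+ 2 * (9 * N)) <= ((18 * N + 1) * b) ^+ 2.
Proof.
move=> Cs0 e0 eb cE N0.
have C1 : 0 < 2 * Cs + 1 by lra.
have c0 : 0 < c by rewrite cE divr_gt0 ?exprn_gt0.
have h1 : 2 * (Cs * c) <= b ^+ 2.
  have : e ^+ 2 <= b ^+ 2 by rewrite ler_pXn2r ?nnegrE ?(ltW e0)// ltW// (lt_le_trans e0).
  have -> : e ^+ 2 = c * (2 * Cs + 1) by rewrite cE divfK// gt_eqF.
  move: c0; clear => *; lra.
have b0 := sqr_ge0 b; rewrite exprMn.
have : (18 * N + 1) * b ^+ 2 <= (18 * N + 1) ^+ 2 * b ^+ 2.
  by rewrite ler_wpM2r// expr2 ler_peMl; lra.
by move: h1; clear => *; lra.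
Qed.

(** The compact operator subtracted is [localize S] on a ball around 0. The rest acts on functions
    that vanish there: cutoffs centered close to 0 contribute nothing, and [local_bound] treats the
    others. *)
Lemma ess_norm_le : exists2 kap : R, 0 < kap & forall S (alpha : R), admissible S ->
  0 <= alpha ->
  (forall f, nrm f <= 1 ->
    (limsup_infinity Sp (fun z => nrm (translate_op S z f)) <= alpha%:E)%E) ->
  (ess_norm S <= (kap * alpha)%:E)%E.
Proof.
have [N N0 cut] := cutoffs_ex nd kappa_gt0.
have k0 : 0 < 18 * N + 1 by rewrite addr_gt0// mulr_gt0.
exists (18 * N + 1) => // S alpha aS al0 Sal.
apply/lee_addgt0Pr => e' e'0; rewrite -EFinD.
pose e := e' / (18 * N + 1); have e0 : 0 < e by rewrite divr_gt0.
have -> : (18 * N + 1) * alpha + e' = (18 * N + 1) * (alpha + e).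
  by rewrite mulrDr /e mulrCA divff ?mulr1// gt_eqF.
have [lS [C C0 SC] _ [Cs Cs0 com]] := aS.
pose c := e ^+ 2 / (2 * Cs + 1).
have c0 : 0 < c by rewrite divr_gt0 ?exprn_gt0// ltr_wpDl// mulr_ge0.
have [r [a [x [[Wa r0] [bx x3] xs xc comm]]]] := cut c c0.
have [r0' r0P] := local_bound (3 * r) aS al0 e0 Sal.
(* A cutoff centered within [r0'] of 0 is supported in the ball of this radius. *)
pose rho := r0' + 3 * r.
have mD : measurable (mball Sp 0 rho : set bV) := measurable_ballW rho (@dom0 _ _ Sp).
have mC : measurable (~` mball Sp 0 rho : set bV) by exact: measurableC.
apply: (ess_norm_le_opnorm (localize_compact rho aS)) => f f1.
rewrite (sub_localize f lS mD).
pose G := mulx \1_(~` mball Sp 0 rho) (toL2 f).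
have G1 : nrmL2 G <= 1 by apply: le_trans (nrmL2_indic _ mC) _; rewrite -nrm_toL2.
have b0 : 0 <= (18 * N + 1) * (alpha + e).
  by rewrite mulr_ge0 ?(ltW k0)// addr_ge0// ltW.
rewrite -(ler_pXn2r (n:=2)) ?nnegrE ?nrm_ge0//.
have eb : e <= alpha + e by rewrite lerDr.
apply: le_trans (ess_norm_arith Cs0 e0 eb erefl N0).
rewrite nrm_toL2; apply: (nrmL2_cover bx) => [z Wz|m]; first by case: (xc z Wz).
have small j : nrmL2 (toL2 (S (proj (mulx (x j) G)))) <= (alpha + e) * nrmL2 (mulx (x j) G).
  have ae0 : 0 <= alpha + e by rewrite addr_ge0// ltW.
  rewrite -nrm_toL2; have [ra|ra] := ltP r0' (d (a j) 0).
    apply: (r0P _ (Wa j) ra) => z Wz nz.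
    have -> : mulx (x j) G z = (x j z)%:C%C *: G z := mulxE G z (bx j).
    rewrite xs ?scale0r// leNgt; apply/negP => dz; exact: nz.
  have z0 z : W z -> mulx (x j) G z = (0 : L2) z.
    move=> Wz; have -> : mulx (x j) G z = (x j z)%:C%C *: G z := mulxE G z (bx j).
    have -> : (0 : L2) z = 0 by [].
    have [dz|dz] := leP (3 * r) (d (a j) z); first by rewrite xs// scale0r.
    have -> : G z = 0; last by rewrite scaler0.
    apply: (supp_indic (toL2 f) mC Wz) => nD; apply: nD; split=> //.
    have W0 := @dom0 _ _ Sp.
    have := d_tri W0 (Wa j) Wz; rewrite (d_sym W0 (Wa j)) => h.
    apply: le_lt_trans h _; exact: ler_ltD.
  have -> : proj (mulx (x j) G) = 0 by apply: (etrans (proj_eqW z0)); exact: proj0.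
  have S0 : S 0 = 0 := linear_fun0 lS.
  by rewrite S0 nrm0 mulr_ge0// nrmL2_ge0.
have tri j : nrmL2 (mulx (x j) (toL2 (S (proj G)))) <=
    nrmL2 (opcomm S (x j) G) + (alpha + e) * nrmL2 (mulx (x j) G).
  have -> : mulx (x j) (toL2 (S (proj G))) = opcomm S (x j) G + toL2 (S (proj (mulx (x j) G))).
    by rewrite /opcomm subrK.
  apply: le_trans (nrmL2D _ _) _; exact: lerD (lexx _) (small j).
apply: le_trans (sum_sq_split m (fun j => nrmL2_ge0 _) tri) _.
apply: lerD; rewrite ler_pM2l//.
  apply: le_trans (com x c bx (ltW c0) comm G m) _.
  by apply: ler_piMr (mulr_ge0 Cs0 (ltW c0)) _; apply: exprn_ile1 => //; exact: nrmL2_ge0.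
have -> : \sum_(j < m) ((alpha + e) * nrmL2 (mulx (x j) G)) ^+ 2 =
    (alpha + e) ^+ 2 * \sum_(j < m) nrmL2 (mulx (x j) G) ^+ 2.
  by rewrite mulr_sumr; apply: eq_bigr => j _; rewrite exprMn.
rewrite ler_wpM2l ?sqr_ge0//.
have N9 : 0 <= 9 * N by rewrite mulr_ge0// ltW.
apply: le_trans (nrmL2_sum G bx N9 _) _ => [z Wz|]; first by case: (xc z Wz).
by apply: ler_piMr N9 _; apply: exprn_ile1 => //; exact: nrmL2_ge0.
Qed.

End lower_bound.

(** * Compact operators at infinity and the criterion on kernels *)

Section upper_bound.
Variables (R : realType) (n : nat) (Sp : bergman_space R n).
Local Notation V := 'rV[R[i]]_n.+1.
Local Notation W := (dom Sp).
Local Notation sg := (sigma Sp).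
Local Notation K := (ker Sp).
Local Notation kn := (knrm W sg K).
Local Notation d := (mdis Sp).
Local Notation L2 := (L2 Sp).
Local Notation B := (bergman Sp).
Implicit Types (z w u v y : V) (f g h : B) (F G : L2) (S T A : B -> B).

(** The image of the unit ball lies within 1 of a finite set. *)
Lemma compact_bounded A : compact_op A -> exists2 M : R, 0 <= M &
  forall f, nrm (A f) <= M * nrm f.
Proof.
move=> [lA /precompact_totally_bounded tA]; have [s sP] := tA 1 ltr01.
pose M : R := 1 + \sum_(y <- s) nrm y.
have s0 : 0 <= \sum_(y <- s) nrm y by apply: sumr_ge0 => y _; exact: nrm_ge0.
exists M; first by rewrite addr_ge0.
move=> f; apply: linear_opnorm => //; apply: opnorm_le => g g1.
have [|y ys yg] := sP (A g); first by exists g.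
have -> : A g = (A g - y) + y by rewrite subrK.
apply: le_trans (nrmD _ _) _; apply: lerD; first exact: ltW.
rewrite (big_rem y ys)/= lerDl; apply: sumr_ge0 => i _; exact: nrm_ge0.
Qed.

Lemma vanish_arith (h e c : R) : 0 <= h -> 0 < e -> h ^+ 2 <= c + h * (e / 2) ->
  c < e ^+ 2 / 2 -> h < e.
Proof.
move=> h0 e0 h1 h2; rewrite ltNge; apply/negP => eh.
have : e * (e / 2) <= h * (h - e / 2) by apply: ler_pM => //; lra.
by nra.
Qed.

Lemma scale_small (c p q e : R) : 0 <= c -> 0 <= p -> p < e / 2 / (c + 1) -> q < e / 2 ->
  c * p + q < e.
Proof.
move=> c0 p0; rewrite ltr_pdivlMr ?ltr_wpDl// mulrDr mulr1 mulrC => h1 h2.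
by move: (c * p) h1 h2; clear -p0 => *; lra.
Qed.

Hypothesis nd : forall z, W z -> kn z != 0.

(** Let h = A U_z^* f and y a member of a finite net within e / 2 of h. Then ||h||^2 = <h, y> + <h,
    h - y>, and <h, y> = <U_z^* f, A^* y> tends to 0, uniformly over the finitely many y. *)
Lemma compact_vanishes A f (e : R) : compact_op A -> nrm f <= 1 -> 0 < e ->
  exists r, forall z, W z -> r < d z 0 -> nrm (A (Uadj z f)) < e.
Proof.
move=> cA f1 e0; have [M M0 AM] := compact_bounded cA.
have [lA /precompact_totally_bounded tA] := cA.
have e2 : 0 < e / 2 by rewrite divr_gt0.
have e3 : 0 < e ^+ 2 / 2 by rewrite divr_gt0 ?exprn_gt0.
have [s sP] := tA _ e2.
have [r rP] : exists r, forall y : B, y \in s -> forall z, W z -> r < d z 0 ->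
    nrm (cdot (toL2 (A (Uadj z f))) (toL2 y)) < e ^+ 2 / 2.
  apply: (@seq_bound R _ s (fun (y : B) r => forall z, W z -> r < d z 0 ->
    nrm (cdot (toL2 (A (Uadj z f))) (toL2 y)) < e ^+ 2 / 2)).
    by move=> y p q pq h z Wz qz; apply: h => //; exact: le_lt_trans qz.
  move=> y ys; have [g gP] := adjoint_ex y lA AM.
  have [r rP] := weakly_null nd f g e3.
  by exists r => z Wz rz; rewrite gP; exact: rP.
exists r => z Wz rz; set h := A (Uadj z f).
have [|y ys hy] := sP h; first by exists (Uadj z f); [rewrite /= (nrm_Uadj nd f Wz);
  exact: f1|].
apply: (vanish_arith (nrm_ge0 h) e0 _ (rP y ys z Wz rz)).
have -> : nrm h ^+ 2 = nrm (cdot (toL2 h) (toL2 h)).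
  by rewrite cdotFF nrmcR ger0_norm ?sqr_ge0// nrm_toL2.
have -> : cdot (toL2 h) (toL2 h) = cdot (toL2 h) (toL2 y) + cdot (toL2 h) (toL2 (h - y)).
  by rewrite toL2B cdotBr addrC subrK.
apply: le_trans (nrmD _ _) _; apply: lerD; first exact: lexx.
apply: le_trans (cdot_le _ _) _; rewrite -!nrm_toL2.
by rewrite ler_wpM2l ?nrm_ge0// ltW.
Qed.

(** [A] contributes nothing at infinity, and U_z^* f stays in the unit ball, where T - A is bounded
    by [b]. *)
Lemma limsup_le_opnorm T A f (b : R) : compact_op A -> nrm f <= 1 -> 0 <= b ->
  (opnorm (T \- A)%R <= b%:E)%E ->
  (limsup_infinity Sp (fun z => nrm (translate_op T z f)) <= b%:E)%E.
Proof.
move=> cA f1 b0 Tb; apply/lee_addgt0Pr => e e0; rewrite -EFinD.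
have [r rP] := compact_vanishes cA f1 e0.
apply: (@limsup_infinity_le _ _ _ _ _ r); first by rewrite addr_ge0// ltW.
move=> z Wz rz; rewrite (translate_op_nrm nd)//.
have -> : T (Uadj z f) = (T (Uadj z f) - A (Uadj z f)) +
  A (Uadj z f) by rewrite subrK.
apply: le_trans (nrmD _ _) _; apply: lerD; last exact: ltW (rP z Wz rz).
rewrite -lee_fin; apply: le_trans Tb; apply: ereal_sup_ubound.
by exists (Uadj z f); [rewrite /= (nrm_Uadj nd f Wz); exact: f1|].
Qed.

Lemma kvecE z k : W z -> kvec Sp z (ell2_unit R k) = ((kn z)^-1)%:C%C *: kerv Sp z k.
Proof.
move=> Wz; apply: B_eq => w.
have E : (((kn z)^-1)%:C%C *: kerv Sp z k) w = ((kn z)^-1)%:C%C *: kerv Sp z k w by [].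
rewrite E kervE// scalerA.
have E2 : (fun w => normalized_ker Sp z w *: ell2_unit R k) =
    (((kn z)^-1)%:C%C *: kerv Sp z k : B).
  apply/funext => v; rewrite /normalized_ker /kunit.
  have -> : (((kn z)^-1)%:C%C *: kerv Sp z k : B) v = ((kn z)^-1)%:C%C *: kerv Sp z k v by [].
  rewrite kervE// scalerA; congr (_ *: _); rewrite mulrC; congr (_ * _).
  by rewrite -fmorphV.
have h := in_bergmanE (bergmanP (((kn z)^-1)%:C%C *: kerv Sp z k)).
rewrite /kvec E2 h.
by rewrite E kervE// scalerA.
Qed.

Lemma linear_scale T (c : R[i]) f : linear T -> T (c *: f) = c *: T f.
Proof.
move=> lT; have T0 : T 0 = 0 := linear_fun0 lT.
by have := lT c f 0; rewrite T0 !addr0.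
Qed.

(** The multiple of the normalized kernel at phi_z(w) that occurs has modulus ||K_w||, independent
    of z. Linearity extends the convergence to the span, and density to all [f], because the
    operators T U_z^* share the bound of [T]. *)
Lemma kernel_vanishes T : bounded_op T ->
  (forall k (e : R), 0 < e -> exists r, forall z, W z -> r < d z 0 ->
    nrm (T (kvec Sp z (ell2_unit R k))) < e) ->
  forall f (e : R), 0 < e -> exists r, forall z, W z -> r < d z 0 -> nrm (T (Uadj z f)) < e.
Proof.
move=> /bounded_opP[lT [C C0 TC]] Tk.
have TD f g : T (f + g) = T f + T g by have := lT 1 f g; rewrite !scale1r.
have hk w k (e : R) : W w -> 0 < e -> exists r, forall z, W z -> r < d z 0 ->
    nrm (T (Uadj z (kerv Sp w k))) < e.
  move=> Ww e0; have kw := kn_gt0 nd Ww.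
  have [r rP] := Tk k (e / kn w) (divr_gt0 e0 kw).
  exists (r + d w 0) => z Wz rz; have Wi := invol_dom Wz Ww; have W0 := @dom0 _ _ Sp.
  have ki := kn_gt0 nd Wi.
  have := rP _ Wi; rewrite (d_inv0 Wz Ww).
  (* The point phi_z(w) has distance d(w, z) from 0, at least d(z, 0) - d(w, 0). *)
  have h1 : r < d w z.
    have := d_tri Wz Ww W0; rewrite (d_sym Wz Ww); move: rz.
    by move: (d z 0) (d w z) (d w 0); clear => *; lra.
  move=> /(_ h1); rewrite (kvecE k Wi) (linear_scale _ _ lT) nrmZ nrmcR.
  rewrite ger0_norm ?invr_ge0 ?kn_ge0// (Uadj_kerv nd k Wz Ww) (linear_scale _ _ lT) nrmZ.
  rewrite nrmc_conj (nrm_ku nd Wz Ww) ltr_pdivlMr//.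
  move: (kn w) (_^-1) (nrm _); clear => p q x.
  by have -> : q * x * p = p * q * x by ring.
have hs g : kspan g -> forall e : R, 0 < e -> exists r, forall z, W z -> r < d z 0 ->
    nrm (T (Uadj z g)) < e.
  elim=> [|c w k h Ww _ IH] e e0.
    exists 0 => z Wz _; rewrite (Uadj0 nd Wz).
    have -> : T 0 = 0 by have := linear_scale 0 0 lT; rewrite !scale0r.
    by rewrite nrm0.
  have e2 : 0 < e / 2 by rewrite divr_gt0.
  have c1 : 0 < nrm c + 1 by rewrite ltr_wpDl ?nrm_ge0.
  have [r1 h1] := hk w k _ Ww (divr_gt0 e2 c1).
  have [r2 h2] := IH _ e2.
  exists (Num.max r1 r2) => z Wz; rewrite gt_max => /andP[z1 z2].
  rewrite (UadjD nd _ _ Wz) (UadjZ nd _ _ Wz) TD (linear_scale _ _ lT).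
  apply: le_lt_trans (nrmD _ _) _; rewrite nrmZ.
  exact: (scale_small (nrm_ge0 c) (nrm_ge0 _) (h1 z Wz z1) (h2 z Wz z2)).
move=> f e e0; have C1 : 0 < C + 1 by rewrite ltr_wpDl.
have e2 : 0 < e / 2 by rewrite divr_gt0.
have [g kg fg] := kspan_dense f (divr_gt0 e2 C1).
have [r rP] := hs g kg _ e2.
exists r => z Wz rz; have -> : f = (f - g) + g by rewrite subrK.
rewrite (UadjD nd _ _ Wz) TD; apply: le_lt_trans (nrmD _ _) _.
have h2 := TC (Uadj z (f - g)); rewrite (nrm_Uadj nd _ Wz) in h2.
apply: le_lt_trans (lerD h2 (lexx _)) _.
exact: (scale_small C0 (nrm_ge0 _) fg (rP z Wz rz)).
Qed.

Hypothesis kappa_gt0 : 0 < kappa Sp.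

(** [kap] is the same for all polynomials in Toeplitz operators, so the estimate passes to their
    norm limits: an approximation within e changes both sides by multiples of e. *)
Lemma ess_norm_toeplitz : exists2 kap : R, 0 < kap & forall T (alpha : R),
  toeplitz_algebra T -> 0 <= alpha ->
  (forall f, nrm f <= 1 ->
    (limsup_infinity Sp (fun z => nrm (translate_op T z f)) <= alpha%:E)%E) ->
  (ess_norm T <= (kap * alpha)%:E)%E.
Proof.
have [kap k0 kapP] := ess_norm_le nd kappa_gt0.
exists kap => // T alpha [bT Tapp] al0 Tal.
apply/lee_addgt0Pr => e' e'0; rewrite -EFinD.
(* The losses are 2 kap e from the limsup, e from the infimum defining the essential norm, and e
   from T - S. *)
pose e := e' / (2 * kap + 2).
have k2 : 0 < 2 * kap + 2 by rewrite addr_gt0// mulr_gt0.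
have e0 : 0 < e by rewrite divr_gt0.
have [S sS TS] := Tapp e e0.
have TSe f : nrm f <= 1 -> nrm (T f - S f) <= e.
  move=> f1; rewrite -lee_fin; apply: le_trans (ltW TS); apply: ereal_sup_ubound.
  by exists f.
have Sal f : nrm f <= 1 ->
    (limsup_infinity Sp (fun z => nrm (translate_op S z f)) <= (alpha + 2 * e)%:E)%E.
  move=> f1; have [r rP] := limsup_infinity_lt e0 (Tal f f1).
  apply: (@limsup_infinity_le _ _ _ _ _ r); first by rewrite addr_ge0// mulr_ge0// ltW.
  move=> z Wz rz; have := rP z Wz rz; rewrite !(translate_op_nrm nd)//.
  have Vf : nrm (Uadj z f) <= 1 by rewrite (nrm_Uadj nd).
  have := TSe _ Vf; have := nrmB (T (Uadj z f)) (T (Uadj z f) - S (Uadj z f)).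
  rewrite opprB addrCA subrr addr0.
  by move: (nrm _) (nrm _) (nrm _); clear => *; lra.
have al2 : 0 <= alpha + 2 * e by rewrite addr_ge0// mulr_ge0// ltW.
have := kapP S _ (admissible_sum sS) al2 Sal.
have kee : kap * (alpha + 2 * e) < kap * (alpha + 2 * e) + e by rewrite ltrDl.
move=> h; have := le_lt_trans h (_ : _ < (kap * (alpha + 2 * e) + e)%:E)%E.
rewrite lte_fin => /(_ kee) /ereal_inf_lt[_ [A cA <-] hA].
apply: (ess_norm_le_opnorm cA) => f f1.
have h1 : nrm (S f - A f) <= kap * (alpha + 2 * e) + e.
  by rewrite -lee_fin; apply: le_trans (ltW hA); apply: ereal_sup_ubound; exists f.
have -> : T f - A f = (T f - S f) + (S f - A f) by rewrite addrA subrK.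
apply: le_trans (nrmD _ _) _; apply: le_trans (lerD (TSe f f1) h1) _.
have <- : e * (2 * kap + 2) = e' by rewrite /e divfK// gt_eqF.
by clear; lra.
Qed.

End upper_bound.

Lemma ess_norm_ge0 (R : realType) (X : normedModType R[i]) (T : X -> X) : (0 <= ess_norm T)%E.
Proof. by apply: le_ereal_inf_tmp => _ [A _ <-]; exact: opnorm_ge0. Qed.

(** If [A] is compact with ||T - A|| < e / 2, an (e / 2)-net for the image of the unit ball under
    [A] is an e-net for its image under [T]. *)
Lemma ess_norm0_compact (R : realType) (n : nat) (Sp : bergman_space R n)
    (T : bergman Sp -> bergman Sp) : linear T -> (ess_norm T <= 0)%E -> compact_op T.
Proof.
move=> lT T0; split=> //; apply: totally_bounded_precompact => e e0.
have e2 : 0 < e / 2 by rewrite divr_gt0.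
have : (ess_norm T < (e / 2)%:E)%E by apply: le_lt_trans T0 _; rewrite lte_fin.
move=> /ereal_inf_lt[_ [A [_ /precompact_totally_bounded tA] <-] hA].
have [s sP] := tA _ e2; exists s => _ [f f1 <-].
have [|y ys yP] := sP (A f); first by exists f.
exists y => //; have -> : T f - y = (T f - A f) + (A f - y) by rewrite addrA subrK.
apply: le_lt_trans (nrmD _ _) _.
have h : nrm (T f - A f) < e / 2.
  rewrite -lte_fin; apply: le_lt_trans hA; apply: ereal_sup_ubound.
  by exists f.
by apply: lt_le_trans (ltrD h yP) _; clear; lra.
Qed.

(** Makes the supremum in (a) finite, so that it can serve as the real number [alpha]. *)
Lemma limsup_bounded (R : realType) (n : nat) (Sp : bergman_space R n)
    (nd : forall z, dom Sp z -> knrm (dom Sp) (sigma Sp) (ker Sp) z != 0)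
    (T : bergman Sp -> bergman Sp) : bounded_op T -> exists2 C : R, 0 <= C &
  forall f, nrm f <= 1 ->
    (limsup_infinity Sp (fun z => nrm (translate_op T z f)) <= C%:E)%E.
Proof.
move=> /bounded_opP[_ [C C0 TC]]; exists C => // f f1.
apply: (@limsup_infinity_le _ _ _ _ _ 0 C0) => z Wz _.
rewrite (translate_op_nrm nd T f Wz); apply: le_trans (TC _) _.
by rewrite (nrm_Uadj nd f Wz) ler_piMr.
Qed.

Lemma limsup_infinity_ge0 (R : realType) (n : nat) (Sp : bergman_space R n)
    (g : 'rV[R[i]]_n.+1 -> R) : (0 <= limsup_infinity Sp g)%E.
Proof. by rewrite /limsup_infinity le_max lexx. Qed.

(** For a basis vector the limit is at most the supremum, which is 0. *)
Lemma kernel_limit (R : realType) (n : nat) (Sp : bergman_space R n)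
    (T : bergman Sp -> bergman Sp) :
  (forall e : ell2 R, ell2_finite e -> nrm e = 1 ->
    cvg (nrm (T (kvec Sp z e)) @[z --> at_infinity (mdis Sp)])) ->
  ereal_sup
    [set (lim (nrm (T (kvec Sp z e)) @[z --> at_infinity (mdis Sp)]))%:E |
      e in [set e : ell2 R | ell2_finite e /\ nrm e = 1]] = 0%E ->
  forall k (e : R), 0 < e -> exists r, forall z, dom Sp z -> r < mdis Sp z 0 ->
    nrm (T (kvec Sp z (ell2_unit R k))) < e.
Proof.
move=> H1 H2 k e e0; have n1 : nrm (ell2_unit R k) = 1 := nrm_unit R k.
have fk : ell2_finite (ell2_unit R k).
  by exists k.+1 => j kj; rewrite /= gtn_eqF.
have := H1 _ fk n1; set l := lim _ => cl.
have l0 : l <= 0.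
  rewrite -lee_fin -[leRHS]H2; apply: ereal_sup_ubound.
  by exists (ell2_unit R k).
have [|r _ rP] := cl [set x | `|l - x| < e].
  by apply/nbhs_ballP; exists e.
exists r => z Wz rz; have /= := rP z (conj Wz rz).
by rewrite ltr_norml => /andP[+ _]; move: l0; clear => *; lra.
Qed.

Theorem corollary4p5 (R : realType) (n : nat) (Sp : bergman_space R n)
    (kappa_gt0 : 0 < kappa Sp) :
  exists c C : R, [/\ 0 < c, 0 < C &
    forall T : bergman Sp -> bergman Sp, toeplitz_algebra T ->
    let a := ereal_sup
      [set limsup_infinity Sp (fun z => nrm (translate_op T z f)) |
        f in [set f : bergman Sp | nrm f <= 1]] in
    [/\ (c%:E * ess_norm T <= a)%E,
        (a <= C%:E * ess_norm T)%E &
        (forall e : ell2 R, ell2_finite e -> nrm e = 1 ->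
          cvg (nrm (T (kvec Sp z e)) @[z --> at_infinity (mdis Sp)])) ->
        ereal_sup
          [set (lim (nrm (T (kvec Sp z e)) @[z --> at_infinity (mdis Sp)]))%:E |
            e in [set e : ell2 R | ell2_finite e /\ nrm e = 1]] = 0%E ->
        compact_op T]].
Proof.
have a_ge0 (T : bergman Sp -> bergman Sp) : (0 <= ereal_sup
    [set limsup_infinity Sp (fun z => nrm (translate_op T z f)) |
      f in [set f : bergman Sp | (nrm f <= 1)%R]])%E.
  apply: le_trans (limsup_infinity_ge0 Sp (fun z => nrm (translate_op T z 0))) _.
  by apply: ereal_sup_ubound; exists 0 => //=; rewrite nrm0.
have [nd|] := pselect (forall z, dom Sp z -> knrm (dom Sp) (sigma Sp) (ker Sp) z != 0);
  last first.
  (* Some kernel vanishes: the space is trivial and any constants do. *)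
  move=> /existsNP[w /not_implyP[Ww /negP/negbNE/eqP kw0]].
  have B0 := kn_degenerate Ww kw0.
  exists 1, 1; split=> // T [[lT _] _] a; rewrite !mul1e.
  have cT : compact_op T.
    split=> //; apply: totally_bounded_precompact => e e0; exists [:: 0] => f _.
    by exists 0; rewrite ?inE// (B0 (f - 0)) nrm0.
  have e0 : (ess_norm T <= 0)%E.
    apply: (ess_norm_le_opnorm cT) => f _; by rewrite subrr nrm0.
  split=> //; first exact: le_trans e0 (a_ge0 T).
  apply: (le_trans _ (ess_norm_ge0 T)); apply: ge_ereal_sup => _ [f _ <-].
  by apply: (@limsup_infinity_le _ _ _ _ _ 0) => // z _ _; rewrite (B0 (translate_op T z f)) nrm0.
have [kap k0 kapP] := ess_norm_toeplitz nd kappa_gt0.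
(* The upper bound holds with constant 1, since translations are isometries and compact operators
   vanish along them. *)
exists kap^-1, 1; split; rewrite ?invr_gt0// => T TA a.
have [bT _] := TA; have [lT _] := bT.
have [C C0 CT] := limsup_bounded nd bT.
have aC : (a <= C%:E)%E by apply: ge_ereal_sup => _ [f f1 <-]; exact: CT.
have afin : a \is a fin_num by rewrite ge0_fin_numE ?a_ge0// (le_lt_trans aC)// ltry.
have al0 : 0 <= fine a by apply: fine_ge0; exact: a_ge0.
split.
- have h : (ess_norm T <= (kap * fine a)%:E)%E.
    apply: kapP => // f f1; rewrite fineK//; apply: ereal_sup_ubound.
    by exists f.
  apply: le_trans (lee_wpmul2l _ h) _; first by rewrite lee_fin invr_ge0 ltW.
  by rewrite -EFinM mulKf ?gt_eqF// fineK.
- rewrite mul1e; apply: le_ereal_inf_tmp => _ [A cA <-].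
  apply: ge_ereal_sup => _ [f f1 <-].
  have := opnorm_ge0 (T \- A)%R; case E : (opnorm (T \- A)%R) => [b| |] // b0; last exact: leey.
  by apply: (limsup_le_opnorm nd cA f1) => //; rewrite ?E.
move=> H1 H2; apply: ess_norm0_compact => //.
have Tk := kernel_limit H1 H2.
have Tf := kernel_vanishes nd bT Tk.
(* Part (b) is the lower bound of (a) with alpha = 0. *)
have -> : 0%E = (kap * 0)%:E :> \bar R by rewrite mulr0.
apply: kapP => // f f1.
apply/lee_addgt0Pr => e e0; rewrite add0e; have [r rP] := Tf f e e0.
apply: (@limsup_infinity_le _ _ _ _ _ r); first exact: ltW.
by move=> z Wz rz; rewrite (translate_op_nrm nd T f Wz); apply: ltW; exact: rP.
Qed.
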